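(* Let $1<p<\infty$ and let $R=\{R_s\}_{s=1}^N$ be a lower bound collection of linear operators. Then for any $m\in\mathbb{N}$, any $m\times m$ matrix $\mathrm{A}_p$ weights $U,V$ on $\mathbb{R}^d$ and any locally integrable $m\times m$ matrix symbol $B$, $$\|B\|_{\mathrm{BMO}^p_{V,U}}\le C\max_{1\le s\le N}\|[M_B,R_s\otimes\mathbf{I}_m]\|_{L^p(U)\to L^p(V)},$$ where $C$ may depend on $m,d,p,R,[U]_{\mathrm{A}_p},[V]_{\mathrm{A}_p}$ but not on $B$.
   Context: $\frac1p+\frac1{p'}=1$. $\fint_Q$ and $m_Q$ denote the unweighted average over $Q$ (entrywise for matrix functions). $\|\cdot\|$ on matrices is the operator norm. An $n\times n$ matrix weight is a measurable $n\times n$ matrix valued function $W$ on $\mathbb{R}^d$ that is positive definite a.e. $L^p(W)$ is the space of $\mathbb{C}^n$ valued functions $\vec f$ with $\|\vec f\|_{L^p(W)}=\left(\int_{\mathbb{R}^d}|W^{1/p}(x)\vec f(x)|^p\,dx\right)^{1/p}<\infty$. $W$ is a matrix $\mathrm{A}_p$ weight if $$[W]_{\mathrm{A}_p}=\sup_{Q\text{ cube}}\fint_Q\left(\fint_Q\|W^{1/p}(x)W^{-1/p}(y)\|^{p'}\,dy\right)^{p/p'}dx<\infty.$$ $T\otimes\mathbf{I}_n$ acts on $\mathbb{C}^n$ valued functions by applying $T$ to each component; $M_B$ is pointwise multiplication by $B$; $[M_B,S]=M_BS-SM_B$. $\|\cdot\|_{L^p(U)\to L^p(V)}$ is the operator norm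 ($+\infty$ if the operator is not bounded). Lower bound collection: a finite collection $R=\{R_s\}_{s=1}^N$ of linear operators defined on scalar valued functions on $\mathbb{R}^d$ such that for every $n\in\mathbb{N}$ (i) there is a constant $C_n$ (possibly depending on $n$) with $[W]_{\mathrm{A}_p}^{1/p}\le C_n\max_{1\le s\le N}\|R_s\otimes\mathbf{I}_n\|_{L^p(W)\to L^p(W)}$ for every $n\times n$ matrix weight $W$, and (ii) each $R_s\otimes\mathbf{I}_n$ is bounded on $L^p(W)$ whenever $W$ is an $n\times n$ matrix $\mathrm{A}_p$ weight. Finally $$\|B\|_{\mathrm{BMO}^p_{V,U}}=\sup_{Q\text{ cube}}\fint_Q\left\|(m_QV^{1/p})(B(x)-m_QB)(m_QU^{1/p})^{-1}\right\|dx.$$ *)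

(* Defs.v *)
From HB Require Import structures.
From mathcomp Require Import all_boot all_order all_algebra.
From mathcomp Require Import sesquilinear spectral.
From mathcomp Require Import all_classical all_reals all_analysis.
From mathcomp Require Import complex.

Set Implicit Arguments.
Unset Strict Implicit.
Unset Printing Implicit Defensive.

Import Order.TTheory GRing.Theory Num.Theory.
Import numFieldNormedType.Exports.

Local Open Scope classical_set_scope.
Local Open Scope ring_scope.
Local Open Scope complex_scope.
Local Open Scope sesquilinear_scope.

Section LebesgueMeasure.
Context {R : realType}.

Section cons_measure.
Variables (d : nat) (m : {sigma_finite_measure set (d.-tuple R) -> \bar R}).

Definition cons_pair (x : measurableTypeR R * d.-tuple R) : d.+1.-tuple R :=
  [tuple of x.1 :: x.2].

Let measurable_cons_pair : measurable_fun [set: _] cons_pair.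
Proof. exact: measurable_cons. Qed.

Definition cons_measure : set (d.+1.-tuple R) -> \bar R :=
  pushforward (@lebesgue_measure R \x m)%E cons_pair.

Let cons_measure0 : cons_measure set0 = 0%E.
Proof. by rewrite /cons_measure /pushforward preimage_set0 measure0. Qed.

Let cons_measure_ge0 A : (0 <= cons_measure A)%E.
Proof. exact: measure_ge0. Qed.

Let cons_measure_semi_sigma_additive : semi_sigma_additive cons_measure.
Proof. exact: measure_semi_sigma_additive. Qed.

HB.instance Definition _ := isMeasure.Build _ _ _ cons_measure
  cons_measure0 cons_measure_ge0 cons_measure_semi_sigma_additive.

Let uncons (t : d.+1.-tuple R) : measurableTypeR R * d.-tuple R :=
  (thead t, [tuple of behead t]).

Let cons_pairK : cancel cons_pair uncons.
Proof.
by case=> x t; rewrite /uncons /cons_pair /= theadE; congr pair; exact: val_inj.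
Qed.

Let measurable_uncons : measurable_fun [set: _] uncons.
Proof.
apply/measurable_fun_pairP; split; first exact: measurable_tnth.
exact: measurable_behead.
Qed.

Let cons_measure_sigma_finite : sigma_finite setT cons_measure.
Proof.
have /sigma_finiteP[F [FT ndF Foo]] := sigma_finiteT (@lebesgue_measure R).
have /sigma_finiteP[G [GT ndG Goo]] := sigma_finiteT m.
exists (fun k => uncons @^-1` (F k `*` G k)).
  apply/seteqP; split=> // t _.
  have [i _ Fi] : (\bigcup_i F i) (thead t) by rewrite -FT.
  have [j _ Gj] : (\bigcup_i G i) [tuple of behead t] by rewrite -GT.
  exists (maxn i j) => //; split => /=.
    by move: Fi; exact/subsetPset/ndF/leq_maxl.
  by move: Gj; exact/subsetPset/ndG/leq_maxr.
move=> k; have [mF Fk] := Foo k; have [mG Gk] := Goo k; split.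
  rewrite -[X in measurable X]setTI; apply: measurable_uncons => //.
  exact: measurableX.
rewrite /cons_measure /pushforward (_ : cons_pair @^-1` _ = F k `*` G k).
  by rewrite product_measure1E// lte_mul_pinfty// ge0_fin_numE.
by apply/funext => x; rewrite /preimage /mkset cons_pairK.
Qed.

HB.instance Definition _ := Measure_isSigmaFinite.Build _ _ _ cons_measure
  cons_measure_sigma_finite.
End cons_measure.

(* d-dimensional Lebesgue measure on the Borel sets of R^d = d.-tuple R, as an
   iterated product; boxes have the expected volume by [leb_box] below. *)
Fixpoint leb (d : nat) : {sigma_finite_measure set (d.-tuple R) -> \bar R} :=
  match d return {sigma_finite_measure set (d.-tuple R) -> \bar R} with
  | 0 => \d_ [tuple]
  | d'.+1 => cons_measure (leb d')
  end.

Lemma leb_box d (a b : 'I_d -> R) : (forall i, a i <= b i) ->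
  leb d [set x | forall i, a i <= tnth x i <= b i] = (\prod_i (b i - a i))%:E.
Proof.
elim: d a b => [|d IH] a b ab.
  rewrite big_ord0 /= diracE mem_set//= => -[].
  by [].
rewrite /= /cons_measure /pushforward.
rewrite (_ : _ @^-1` _ = `[a ord0, b ord0] `*`
  [set t | forall i, a (lift ord0 i) <= tnth t i <= b (lift ord0 i)]); last first.
  apply/seteqP; split=> -[x t] /=.
    move=> h; split; first by have := h ord0; rewrite in_itv.
    by move=> i; have := h (lift ord0 i); rewrite tnthS.
  rewrite in_itv /= => -[x01 h] i.
  case: (unliftP ord0 i) => [j ->|-> //].
  by rewrite tnthS.
rewrite product_measure1E//=.
- rewrite [X in (X * _)%E]lebesgue_measure_itv /= lte_fin IH// big_ord_recl.
  case: ltgtP (ab ord0) => // -> _.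
  by rewrite mul0e subrr mul0r.
- rewrite (_ : mkset _ = \bigcap_(i in [set: 'I_d])
     ((@tnth _ R ^~ i) @^-1` `[a (lift ord0 i), b (lift ord0 i)])).
    apply: fin_bigcap_measurable => // i _.
    rewrite -[X in measurable X]setTI.
    exact: (@measurable_tnth _ (measurableTypeR R)).
  apply/seteqP; split=> t /= h i; first by move=> _; rewrite /= in_itv/=.
  by have := h i I; rewrite /= in_itv/=.
Qed.
End LebesgueMeasure.

Section MatrixAlgebra.
Context {R : realType}.
Local Notation C := R[i].

Definition vnorm n (v : 'cV[C]_n) : R :=
  Num.sqrt (\sum_i (complex.Re (v i 0) ^+ 2 + complex.Im (v i 0) ^+ 2)).

Definition mxnorm n (A : 'M[C]_n) : R :=
  sup [set vnorm (A *m v) | v in [set v : 'cV[C]_n | vnorm v <= 1]].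

Definition posdef n (A : 'M[C]_n) : Prop :=
  A \is hermsymmx /\
  forall v : 'cV[C]_n, v != 0 -> 0 < (v^t* *m A *m v) 0 0.

(* A^r by functional calculus: if A = P^-1 D P is the spectral decomposition of
   a positive definite A, this is P^-1 D^r P. *)
Definition mxpow n (A : 'M[C]_n) (r : R) : 'M[C]_n :=
  invmx (spectralmx A)
  *m diag_mx (map_mx (fun z : C => (complex.Re z `^ r)%:C) (spectral_diag A))
  *m spectralmx A.
End MatrixAlgebra.

Section Weights.
Context {R : realType} {d : nat}.
Local Notation C := R[i].
Local Notation E := (d.-tuple R).
Local Notation mu := (@leb R d).

Definition cmeasurable (f : E -> C) : Prop :=
  measurable_fun [set: E] (fun x => complex.Re (f x)) /\
  measurable_fun [set: E] (fun x => complex.Im (f x)).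

Definition mxmeasurable m n (F : E -> 'M[C]_(m, n)) : Prop :=
  forall i j, cmeasurable (fun x => F x i j).

Definition cube (a : E) (l : R) : set E :=
  [set x | forall i, tnth a i <= tnth x i <= tnth a i + l].

Definition cubes : set (set E) :=
  [set Q | exists a l, 0 < l /\ Q = cube a l].

Definition eavg (Q : set E) (f : E -> \bar R) : \bar R :=
  ((fine (mu Q))^-1%:E * \int[mu]_(x in Q) f x)%E.

Definition ravg (Q : set E) (f : E -> R) : R :=
  (fine (mu Q))^-1 * Rintegral mu Q f.

Definition mxavg n (Q : set E) (F : E -> 'M[C]_n) : 'M[C]_n :=
  \matrix_(i, j)
    (ravg Q (fun x => complex.Re (F x i j)) +i*
     ravg Q (fun x => complex.Im (F x i j))).

Definition locally_integrable_mx n (B : E -> 'M[C]_n) : Prop :=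
  mxmeasurable B /\
  forall Q, cubes Q -> (\int[mu]_(x in Q) (mxnorm (B x))%:E < +oo)%E.

Definition matrix_weight n (W : E -> 'M[C]_n) : Prop :=
  mxmeasurable W /\ {ae mu, forall x, posdef (W x)}.

Definition conj_exp (p : R) : R := (1 - p^-1)^-1.

Definition Ap_char n (p : R) (W : E -> 'M[C]_n) : \bar R :=
  ereal_sup [set eavg Q (fun x =>
      poweR (eavg Q (fun y =>
          (mxnorm (mxpow (W x) p^-1 *m mxpow (W y) (- p^-1))
             `^ conj_exp p)%:E))
        (p / conj_exp p)) | Q in cubes].

Definition Ap_weight n (p : R) (W : E -> 'M[C]_n) : Prop :=
  matrix_weight W /\ (Ap_char p W < +oo)%E.

Definition LpW_norm n (p : R) (W : E -> 'M[C]_n) (f : E -> 'cV[C]_n) : \bar R :=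
  poweR (\int[mu]_x (vnorm (mxpow (W x) p^-1 *m f x) `^ p)%:E) p^-1.

Definition LpW n (p : R) (W : E -> 'M[C]_n) : set (E -> 'cV[C]_n) :=
  [set f | mxmeasurable f /\ (LpW_norm p W f < +oo)%E].

Definition BMO_norm n (p : R) (V U B : E -> 'M[C]_n) : \bar R :=
  ereal_sup [set eavg Q (fun x =>
      (mxnorm (mxavg Q (fun y => mxpow (V y) p^-1)
               *m (B x - mxavg Q B)
               *m invmx (mxavg Q (fun y => mxpow (U y) p^-1))))%:E)
    | Q in cubes].
End Weights.

Section Operators.
Context {R : realType} {d : nat}.
Local Notation C := R[i].
Local Notation E := (d.-tuple R).
Local Notation mu := (@leb R d).

(* A partially defined operator: e.g. a singular integral is not defined on all
   functions. The values of [app] outside of [dom] are irrelevant. *)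
Record op (X : Type) := Op { dom : set (E -> X) ; app :> (E -> X) -> (E -> X) }.

(* The values of operators matter only almost everywhere, so linearity is an
   almost everywhere identity between (Borel) representatives. *)
Definition linear_op (T : op C) : Prop :=
  [/\ dom T (fun=> 0),
      forall (c : C) f g, dom T f -> dom T g -> dom T (fun x => c * f x + g x),
      forall f, dom T f -> cmeasurable (T f) &
      forall (c : C) f g, dom T f -> dom T g ->
        {ae mu, forall x, T (fun y => c * f y + g y) x = c * T f x + T g x}].

Definition op_comp X (S T : op X) : op X :=
  Op [set f | dom T f /\ dom S (T f)] (fun f => S (T f)).

Definition op_sub n (S T : op 'cV[C]_n) : op 'cV[C]_n :=
  Op (dom S `&` dom T) (fun f x => S f x - T f x).

Definition tensor_id (T : op C) n : op 'cV[C]_n :=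
  Op [set f : E -> 'cV[C]_n | forall i, dom T (fun x => f x i 0)]
     (fun f x => \col_i T (fun y => f y i 0) x).

Definition mult_op n (B : E -> 'M[C]_n) : op 'cV[C]_n :=
  Op setT (fun f x => B x *m f x).

Definition commutator n (S T : op 'cV[C]_n) : op 'cV[C]_n :=
  op_sub (op_comp S T) (op_comp T S).

(* Least M such that |T f|_{L^p(V)} <= M |f|_{L^p(U)} for all f in L^p(U) in the
   domain of T; the infimum of the empty set is +oo. *)
Definition op_norm n (p : R) (U V : E -> 'M[C]_n) (T : op 'cV[C]_n) : \bar R :=
  ereal_inf [set M%:E | M in [set M : R | 0 <= M /\
    forall f, LpW p U f -> dom T f ->
      LpW p V (T f) /\ (LpW_norm p V (T f) <= M%:E * LpW_norm p U f)%E]].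

(* Boundedness from L^p(U) to L^p(V) includes being defined on all of L^p(U). *)
Definition bounded_op n (p : R) (U V : E -> 'M[C]_n) (T : op 'cV[C]_n) : Prop :=
  LpW p U `<=` dom T /\ (op_norm p U V T < +oo)%E.

(* All norms are nonnegative, so 0 is a neutral base for the maximum. *)
Definition max_norm N n (p : R) (U V : E -> 'M[C]_n) (T : 'I_N -> op 'cV[C]_n)
    : \bar R :=
  \big[maxe/0%E]_(s < N) op_norm p U V (T s).

Definition lower_bound_collection N (p : R) (T : 'I_N -> op C) : Prop :=
  [/\ forall s, linear_op (T s),
      forall n, (0 < n)%N -> exists2 c : R, 0 < c & forall W : E -> 'M[C]_n,
        matrix_weight W ->
        (poweR (Ap_char p W) p^-1 <=
           c%:E * max_norm p W W (fun s => tensor_id (T s) n))%E &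
      forall n, (0 < n)%N -> forall W : E -> 'M[C]_n, Ap_weight p W ->
        forall s, bounded_op p W W (tensor_id (T s) n)].
End Operators.

(* Main.v *)
Require Import Defs.
From HB Require Import structures.
From mathcomp Require Import all_boot all_order all_algebra.
From mathcomp Require Import sesquilinear spectral.
From mathcomp Require Import all_classical all_reals all_analysis.
From mathcomp Require Import complex perm.
From mathcomp Require Import ring lra measurable_realfun.

(** A commutator is the off-diagonal block of a conjugated operator. Write
    a = V^(1/p), b = U^(1/p), let T be one of the operators of the collection,
    acting componentwise, and let Phi_r be the upper triangular 2m x 2m matrix
    function with diagonal blocks a, b and corner r a B. Conjugating T by Phi_r
    gives the upper triangular operator with diagonal a T a^-1, b T b^-1 and
    corner r a [B, T] b^-1. By polar decomposition Phi_r is pointwise isometric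
    to W_r^(1/p) for the weight W_r = (Phi_r^* Phi_r)^(p/2) (vnorm_block_weight).
    Hence the norm of T on L^p(W_r) is at most a constant times
    MV + MU + r MC, where MV, MU and MC bound T on L^p(V), T on L^p(U) and the
    commutator from L^p(U) to L^p(V) (block_opbound). On the other hand the
    corner of Phi_r(x) Phi_r(y)^-1 is r a(x) (B(x) - B(y)) b(y)^-1, so that the
    A_p characteristic of W_r controls r times this kernel (mxnorm_offdiag).
    The lower bound property in dimension 2m compares the two; as r may be taken
    so large that r MC dominates MV + MU, every cube Q satisfies
      avg_x (avg_y |a(x) (B(x) - B(y)) b(y)^-1|^p')^(p/p') <= (L MC)^p
    with L independent of all weights (mixed_commutator).

    Only the passage from this kernel to the BMO norm (core_bound) uses the A_p
    constants of U and V. With A = avg a and G = (avg b)^-1, the matrix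
    A (B(x) - avg B) G is the average over y of
      (A a(x)^-1) (a(x) (B(x) - B(y)) b(y)^-1) (b(y) G),
    and by Hoelder it suffices to bound the L^p' mean of A a^-1 and the L^p mean
    of b G. For a weight with root w the kernel F(x, y) = |w(x) w(y)^-1|
    satisfies F(x, z) <= F(x, y) F(y, z), and together with the A_p bound this
    produces a point x0 for which the q-th moment of F(x0, .) and the p-th moment
    of F(., x0) are bounded, with q = p' (good_point). Comparing A with
    a(x0) settles the left factor. For the right factor one also needs a bound
    on |b(x0) (avg b)^-1|: since |b(x0) v| <= F(x0, y) |b(y) v| implies
    b(x0) <= F(x0, y) b(y) as quadratic forms (loewner), the eigenvalues of
    (avg b) b(x0)^-1 are bounded below, and a matrix with bounded entries and a
    determinant away from zero has a bounded inverse (inverse_bound).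

    Two points make this rigorous. The operator norm is replaced by the sum of
    the absolute values of the real and imaginary parts of all entries, which is
    submultiplicative and visibly measurable. And x |-> W(x)^r is measurable
    when W is (mxmeas_mxpow); as this is only available where W is
    positive definite, the weights are first redefined on a null set, and
    integrals of functions that need not be measurable are compared outside of
    null sets (ae_le_integral). *)

Set Implicit Arguments.
Unset Strict Implicit.
Unset Printing Implicit Defensive.

Import Order.TTheory GRing.Theory Num.Theory.
Import numFieldNormedType.Exports.

Local Open Scope classical_set_scope.
Local Open Scope ring_scope.
Local Open Scope complex_scope.
Local Open Scope sesquilinear_scope.

(** * An entrywise norm, compared with the Euclidean and operator norms *)

Section EntryNorm.
Context {R : realType}.
Local Notation C := R[i].
Implicit Types (z w : C).

Lemma cReD z w : complex.Re (z + w) = complex.Re z + complex.Re w.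
Proof. by case: z w => [? ?] [? ?]. Qed.
Lemma cImD z w : complex.Im (z + w) = complex.Im z + complex.Im w.
Proof. by case: z w => [? ?] [? ?]. Qed.
Lemma cReN z : complex.Re (- z) = - complex.Re z.
Proof. by case: z => [? ?]. Qed.
Lemma cImN z : complex.Im (- z) = - complex.Im z.
Proof. by case: z => [? ?]. Qed.
Lemma cReM z w : complex.Re (z * w) =
  complex.Re z * complex.Re w - complex.Im z * complex.Im w.
Proof. by case: z w => [? ?] [? ?]. Qed.
Lemma cImM z w : complex.Im (z * w) =
  complex.Re z * complex.Im w + complex.Im z * complex.Re w.
Proof. by case: z w => [? ?] [? ?]. Qed.

Lemma cRe_sum (I : Type) (s : seq I) (P : pred I) (F : I -> C) :
  complex.Re (\sum_(i <- s | P i) F i) = \sum_(i <- s | P i) complex.Re (F i).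
Proof. exact: (big_morph (@complex.Re R) cReD). Qed.
Lemma cIm_sum (I : Type) (s : seq I) (P : pred I) (F : I -> C) :
  complex.Im (\sum_(i <- s | P i) F i) = \sum_(i <- s | P i) complex.Im (F i).
Proof. exact: (big_morph (@complex.Im R) cImD). Qed.

(** Taxicab norm of a complex number: unlike the modulus it involves no square
    root, and it is still submultiplicative. *)
Definition cnorm1 z : R := `|complex.Re z| + `|complex.Im z|.

Lemma cnorm1_ge0 z : 0 <= cnorm1 z. Proof. by rewrite addr_ge0. Qed.
Lemma cnorm1_0 : cnorm1 0 = 0. Proof. by rewrite /cnorm1 /= normr0 addr0. Qed.
Lemma cnorm1_1 : cnorm1 1 = 1. Proof. by rewrite /cnorm1 /= normr0 addr0 normr1. Qed.
Lemma cnorm1N z : cnorm1 (- z) = cnorm1 z.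
Proof. by rewrite /cnorm1 cReN cImN !normrN. Qed.
Lemma cnorm1D z w : cnorm1 (z + w) <= cnorm1 z + cnorm1 w.
Proof. by rewrite /cnorm1 cReD cImD addrACA lerD// ler_normD. Qed.
Lemma cnorm1M z w : cnorm1 (z * w) <= cnorm1 z * cnorm1 w.
Proof.
rewrite /cnorm1 cReM cImM.
apply: le_trans (lerD (ler_normB _ _) (ler_normD _ _)) _.
by rewrite !normrM; lra.
Qed.
Lemma cnorm1Zr (r : R) z : cnorm1 (r%:C * z) = `|r| * cnorm1 z.
Proof. by rewrite /cnorm1 cReM cImM /= !mul0r subr0 addr0 !normrM mulrDr. Qed.
Lemma cnorm1_sum (I : Type) (s : seq I) (P : pred I) (F : I -> C) :
  cnorm1 (\sum_(i <- s | P i) F i) <= \sum_(i <- s | P i) cnorm1 (F i).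
Proof.
elim/big_ind2 : _ => //; first by rewrite cnorm1_0.
by move=> a b c d ab cd; apply: le_trans (cnorm1D _ _) _; exact: lerD.
Qed.
Lemma cnorm1_prod (I : Type) (s : seq I) (P : pred I) (F : I -> C) :
  cnorm1 (\prod_(i <- s | P i) F i) <= \prod_(i <- s | P i) cnorm1 (F i).
Proof.
suff : 0 <= cnorm1 (\prod_(i <- s | P i) F i) <= \prod_(i <- s | P i) cnorm1 (F i).
  by case/andP.
elim/big_ind2 : _ => [|a b c d|i _]; last by rewrite cnorm1_ge0 lexx.
  by rewrite cnorm1_1 lexx ler01.
move=> /andP[a0 ab] /andP[c0 cd]; rewrite cnorm1_ge0/=.
by apply: le_trans (cnorm1M _ _) _; apply: ler_pM.
Qed.

Definition entrynorm m n (A : 'M[C]_(m, n)) : R := \sum_i \sum_j cnorm1 (A i j).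

Lemma entrynorm_ge0 m n (A : 'M[C]_(m, n)) : 0 <= entrynorm A.
Proof. by rewrite sumr_ge0// => i _; rewrite sumr_ge0// => j _; exact: cnorm1_ge0. Qed.

Lemma cnorm1_le_entrynorm m n (A : 'M[C]_(m, n)) i j : cnorm1 (A i j) <= entrynorm A.
Proof.
rewrite /entrynorm (bigD1 i)//= (bigD1 j)//= -addrA lerDl addr_ge0//.
  by rewrite sumr_ge0// => k _; exact: cnorm1_ge0.
by rewrite sumr_ge0// => k _; rewrite sumr_ge0// => l _; exact: cnorm1_ge0.
Qed.

Lemma entrynormM m n k (A : 'M[C]_(m, n)) (B : 'M[C]_(n, k)) :
  entrynorm (A *m B) <= entrynorm A * entrynorm B.
Proof.
rewrite /entrynorm mulr_suml; apply: ler_sum => i _.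
apply: (@le_trans _ _ (\sum_(j < k) \sum_(l < n) cnorm1 (A i l) * cnorm1 (B l j))).
  apply: ler_sum => j _; rewrite mxE; apply: le_trans (cnorm1_sum _ _ _) _.
  by apply: ler_sum => l _; exact: cnorm1M.
rewrite exchange_big/= mulr_suml; apply: ler_sum => l _.
rewrite -mulr_sumr ler_wpM2l ?cnorm1_ge0// (bigD1 l)//= lerDl sumr_ge0// => a _.
by rewrite sumr_ge0// => b _; exact: cnorm1_ge0.
Qed.

Lemma entrynormD m n (A B : 'M[C]_(m, n)) : entrynorm (A + B) <= entrynorm A + entrynorm B.
Proof.
rewrite /entrynorm -big_split/=; apply: ler_sum => i _.
by rewrite -big_split/=; apply: ler_sum => j _; rewrite mxE cnorm1D.
Qed.

Lemma entrynormZr m n (r : R) (A : 'M[C]_(m, n)) : entrynorm (r%:C *: A) = `|r| * entrynorm A.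
Proof.
rewrite /entrynorm mulr_sumr; apply: eq_bigr => i _.
by rewrite mulr_sumr; apply: eq_bigr => j _; rewrite mxE cnorm1Zr.
Qed.

Lemma cnorm1_eq0 z : cnorm1 z = 0 -> z = 0.
Proof.
case: z => a b /eqP; rewrite /cnorm1 /= paddr_eq0// !normr_eq0.
by case/andP => /eqP -> /eqP ->.
Qed.

Lemma entrynorm_gt0 m n (A : 'M[C]_(m, n)) : A != 0 -> 0 < entrynorm A.
Proof.
move=> A0; rewrite lt_def entrynorm_ge0 andbT; apply: contra A0 => /eqP A0.
apply/eqP/matrixP => i j; rewrite mxE; apply: cnorm1_eq0.
by apply/eqP; rewrite eq_le cnorm1_ge0 andbT -A0 cnorm1_le_entrynorm.
Qed.

(** The squared Euclidean norm; [vnorm] is its square root. *)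
Definition sqnorm n (v : 'cV[C]_n) : R :=
  \sum_i (complex.Re (v i 0) ^+ 2 + complex.Im (v i 0) ^+ 2).

Lemma vnormE n (v : 'cV[C]_n) : vnorm v = Num.sqrt (sqnorm v).
Proof. by []. Qed.

Lemma sqnorm_ge0 n (v : 'cV[C]_n) : 0 <= sqnorm v.
Proof. by rewrite sumr_ge0// => i _; rewrite addr_ge0 ?sqr_ge0. Qed.

Lemma vnorm_ge0 n (v : 'cV[C]_n) : 0 <= vnorm v.
Proof. exact: sqrtr_ge0. Qed.

Lemma vnorm_sqr n (v : 'cV[C]_n) : vnorm v ^+ 2 = sqnorm v.
Proof. by rewrite sqr_sqrtr// sqnorm_ge0. Qed.

Lemma vnorm0 n : vnorm (0 : 'cV[C]_n) = 0.
Proof.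
rewrite vnormE /sqnorm big1 ?sqrtr0// => i _.
by rewrite mxE /= expr0n /= addr0.
Qed.

Lemma cnorm1_le_vnorm n (v : 'cV[C]_n) i : cnorm1 (v i 0) <= 2 * vnorm v.
Proof.
have h : complex.Re (v i 0) ^+ 2 + complex.Im (v i 0) ^+ 2 <= sqnorm v.
  rewrite /sqnorm (bigD1 i)//= lerDl sumr_ge0// => j _.
  by rewrite addr_ge0 ?sqr_ge0.
rewrite /cnorm1 mulr_natl mulr2n; apply: lerD.
  rewrite -sqrtr_sqr; apply: ler_wsqrtr; apply: le_trans h.
  by rewrite lerDl sqr_ge0.
rewrite -sqrtr_sqr; apply: ler_wsqrtr; apply: le_trans h.
by rewrite lerDr sqr_ge0.
Qed.

Lemma entrynorm_cV n (v : 'cV[C]_n) : entrynorm v = \sum_i cnorm1 (v i 0).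
Proof. by apply: eq_bigr => i _; rewrite big_ord1. Qed.

Lemma entrynorm_le_vnorm n (v : 'cV[C]_n) : entrynorm v <= (2 * n%:R) * vnorm v.
Proof.
rewrite entrynorm_cV; apply: (@le_trans _ _ (\sum_(i < n) 2 * vnorm v)).
  by apply: ler_sum => i _; exact: cnorm1_le_vnorm.
by rewrite sumr_const card_ord -[_ *+ n]mulr_natr mulrAC.
Qed.

Lemma vnorm_le_entrynorm n (v : 'cV[C]_n) : vnorm v <= entrynorm v.
Proof.
rewrite -(@ler_pXn2r _ 2) ?nnegrE ?entrynorm_ge0 ?vnorm_ge0// vnorm_sqr.
rewrite /sqnorm [leRHS]expr2 {1}entrynorm_cV mulr_suml; apply: ler_sum => i _.
apply: (@le_trans _ _ (cnorm1 (v i 0) * cnorm1 (v i 0))); last first.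
  by rewrite ler_wpM2l ?cnorm1_ge0// cnorm1_le_entrynorm.
rewrite /cnorm1 -(real_normK (num_real (complex.Re _))).
rewrite -(real_normK (num_real (complex.Im _))).
by rewrite -expr2 sqrrD lerD2r lerDl mulrn_wge0// mulr_ge0.
Qed.

Lemma vnormZ n (r : R) (v : 'cV[C]_n) : vnorm (r%:C *: v) = `|r| * vnorm v.
Proof.
rewrite !vnormE -sqrtr_sqr -sqrtrM ?sqr_ge0//; congr Num.sqrt.
rewrite /sqnorm mulr_sumr; apply: eq_bigr => i _; rewrite mxE cReM cImM /= !mul0r.
by rewrite subr0 addr0 !exprMn mulrDr.
Qed.

Lemma vnorm_eq0 n (v : 'cV[C]_n) : vnorm v = 0 -> v = 0.
Proof.
move=> v0; apply/eqP; apply: contraT => /entrynorm_gt0.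
by rewrite ltNge (le_trans (entrynorm_le_vnorm v))// v0 mulr0.
Qed.

Lemma mxnorm_ub n (A : 'M[C]_n) (v : 'cV[C]_n) :
  vnorm v <= 1 -> vnorm (A *m v) <= 2 * entrynorm A.
Proof.
move=> v1; apply: le_trans (vnorm_le_entrynorm _) _.
rewrite entrynorm_cV /entrynorm mulr_sumr; apply: ler_sum => i _; rewrite mxE.
apply: le_trans (cnorm1_sum _ _ _) _; rewrite mulr_sumr; apply: ler_sum => j _.
apply: le_trans (cnorm1M _ _) _; rewrite mulrC ler_wpM2r ?cnorm1_ge0//.
apply: le_trans (cnorm1_le_vnorm _ _) _.
by rewrite -[leRHS]mulr1 ler_wpM2l.
Qed.

Lemma mxnorm_has_sup n (A : 'M[C]_n) :
  has_sup [set vnorm (A *m v) | v in [set v : 'cV[C]_n | vnorm v <= 1]].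
Proof.
split; first by exists (vnorm (A *m 0)), 0 => //=; rewrite vnorm0 ler01.
by exists (2 * entrynorm A) => _ [v /= v1 <-]; exact: mxnorm_ub.
Qed.

Lemma mxnorm_le_entrynorm n (A : 'M[C]_n) : mxnorm A <= 2 * entrynorm A.
Proof.
apply: ge_sup; first by case: (mxnorm_has_sup A).
by move=> _ [v /= v1 <-]; exact: mxnorm_ub.
Qed.

Lemma vnorm_mul1 n (A : 'M[C]_n) (v : 'cV[C]_n) :
  vnorm v <= 1 -> vnorm (A *m v) <= mxnorm A.
Proof.
by move=> v1; apply: sup_upper_bound; [exact: mxnorm_has_sup|exists v].
Qed.

Lemma mxnorm_ge0 n (A : 'M[C]_n) : 0 <= mxnorm A.
Proof.
apply: le_trans (vnorm_mul1 A (_ : vnorm 0 <= 1)); first exact: vnorm_ge0.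
by rewrite vnorm0 ler01.
Qed.

Lemma vnorm_mul n (A : 'M[C]_n) (v : 'cV[C]_n) :
  vnorm (A *m v) <= mxnorm A * vnorm v.
Proof.
have [v0|v0] := eqVneq (vnorm v) 0.
  by rewrite v0 mulr0 (vnorm_eq0 v0) mulmx0 vnorm0.
have vp : 0 < vnorm v by rewrite lt_def v0 vnorm_ge0.
have := @vnorm_mul1 _ A ((vnorm v)^-1%:C *: v).
rewrite -scalemxAr !vnormZ ger0_norm ?invr_ge0 ?vnorm_ge0// mulVf//.
by move=> /(_ (lexx _)); rewrite mulrC ler_pdivrMr.
Qed.

Lemma mxnorm_le n (A : 'M[C]_n) (c : R) :
  (forall v : 'cV[C]_n, vnorm v <= 1 -> vnorm (A *m v) <= c) -> mxnorm A <= c.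
Proof.
move=> h; apply: ge_sup; first by case: (mxnorm_has_sup A).
by move=> _ [v /= v1 <-]; exact: h.
Qed.

Lemma vnorm_delta n (j : 'I_n) : vnorm (delta_mx j 0 : 'cV[C]_n) = 1.
Proof.
rewrite vnormE /sqnorm (bigD1 j)//= big1 ?addr0; last first.
  by move=> i /negbTE ij; rewrite mxE ij /= expr0n /= addr0.
by rewrite mxE !eqxx /= expr1n expr0n addr0 sqrtr1.
Qed.

Lemma entrynorm_le_mxnorm n (A : 'M[C]_n) : entrynorm A <= (2 * n%:R ^+ 2) * mxnorm A.
Proof.
apply: (@le_trans _ _ (\sum_(i < n) \sum_(j < n) 2 * mxnorm A)).
  apply: ler_sum => i _; apply: ler_sum => j _.
  have -> : A i j = (A *m (delta_mx j 0 : 'cV[C]_n)) i 0.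
    by rewrite -colE mxE.
  apply: le_trans (cnorm1_le_vnorm _ _) _; rewrite ler_wpM2l//.
  by apply: vnorm_mul1; rewrite vnorm_delta.
rewrite !sumr_const card_ord -[_ *+ n *+ n]mulr_natr -[_ *+ n]mulr_natr expr2 -!mulrA ler_wpM2l//.
by rewrite mulrC mulrA.
Qed.

End EntryNorm.

(** * Functional calculus of Hermitian matrices *)

Section AbstractCalculus.
Variable C : numClosedFieldType.

Lemma trmxCM m n k (A : 'M[C]_(m, n)) (B : 'M[C]_(n, k)) :
  (A *m B)^t* = B^t* *m A^t*.
Proof. by rewrite trmx_mul map_mxM. Qed.

Lemma hermsymmxP n (A : 'M[C]_n) : A \is hermsymmx <-> A^t* = A.
Proof.
split; first by move/is_hermitianmxP; rewrite expr0 scale1r => <-.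
by move=> h; apply/is_hermitianmxP; rewrite expr0 scale1r h.
Qed.

Definition specfun n (f : C -> C) (A : 'M[C]_n) : 'M[C]_n :=
  invmx (spectralmx A) *m diag_mx (map_mx f (spectral_diag A)) *m spectralmx A.

Lemma herm_spectral n (A : 'M[C]_n) : A \is hermsymmx ->
  A = invmx (spectralmx A) *m diag_mx (spectral_diag A) *m spectralmx A.
Proof. by move=> hA; exact/orthomx_spectralP/hermitian_normalmx. Qed.

(** The functional calculus does not depend on the diagonalization: if D, D' are
    diagonal and D Y = Y D', then each entry Y_ij is zero or links equal
    eigenvalues, so f(D) Y = Y f(D'). *)
Lemma specfun_diag n (f : C -> C) (A P : 'M[C]_n) (d : 'rV[C]_n) :
  A \is hermsymmx -> P \in unitmx -> A = invmx P *m diag_mx d *m P ->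
  specfun f A = invmx P *m diag_mx (map_mx f d) *m P.
Proof.
move=> /herm_spectral AE Pu AP; rewrite /specfun.
move: AE (spectral_unit A).
move: (spectralmx A) (spectral_diag A) => S e AE Su.
have [Y YE] : {Y | Y = S *m invmx P} by eexists.
have eY : diag_mx e *m Y = Y *m diag_mx d.
  have : S *m A *m invmx P = S *m A *m invmx P by [].
  rewrite {1}AE AP !mulmxA mulmxV// mul1mx -!mulmxA mulmxV// mulmx1.
  by rewrite YE !mulmxA.
have fY : diag_mx (map_mx f e) *m Y = Y *m diag_mx (map_mx f d).
  apply/matrixP => i j; move/matrixP : eY => /(_ i j).
  rewrite !mul_diag_mx !mul_mx_diag !mxE => h.
  have [->|/mulIf eq] := eqVneq (Y i j) 0; first by rewrite mulr0 mul0r.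
  by rewrite mulrC; congr (_ * f _); apply: eq; rewrite h mulrC.
have SY : S = Y *m P by rewrite YE -mulmxA mulVmx// mulmx1.
rewrite [X in _ *m X = _]SY mulmxA -(mulmxA _ _ Y) fY YE.
by rewrite !mulmxA mulVmx// mul1mx.
Qed.

Lemma specfun_id n (A : 'M[C]_n) f : A \is hermsymmx ->
  (forall i, f (spectral_diag A 0 i) = spectral_diag A 0 i) -> specfun f A = A.
Proof.
move=> hA h; rewrite [RHS]herm_spectral// /specfun; congr (_ *m diag_mx _ *m _).
by apply/rowP => i; rewrite mxE h.
Qed.

Lemma specfun_herm n (A : 'M[C]_n) f : (forall z, Num.conj_op (f z) = f z) ->
  specfun f A \is hermsymmx.
Proof.
move=> h; apply/hermsymmxP; rewrite /specfun invmx_unitary ?spectral_unitarymx//.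
rewrite !trmxCM trmxCK mulmxA tr_diag_mx map_diag_mx; congr (_ *m diag_mx _ *m _).
apply/rowP => i; rewrite !mxE. exact: h.
Qed.

Lemma specfunM n (A : 'M[C]_n) f g :
  specfun (fun t => f t * g t) A = specfun f A *m specfun g A.
Proof.
rewrite /specfun !mulmxA mulmxK ?spectral_unit//; congr (_ *m _).
rewrite -!mulmxA mulmx_diag; congr (_ *m diag_mx _).
by apply/rowP => i; rewrite !mxE.
Qed.

Lemma specfunD n (A : 'M[C]_n) f g :
  specfun (fun t => f t + g t) A = specfun f A + specfun g A.
Proof.
rewrite /specfun -mulmxDl -mulmxDr; congr (_ *m _ *m _).
by rewrite -raddfD; congr diag_mx; apply/rowP => i; rewrite !mxE.
Qed.

Lemma specfun_cst n (A : 'M[C]_n) c : specfun (fun=> c) A = c%:M.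
Proof.
rewrite /specfun (_ : diag_mx _ = c%:M); last first.
  by apply/matrixP => i j; rewrite !mxE.
by rewrite mul_mx_scalar -scalemxAl mulVmx ?spectral_unit// scalemx1.
Qed.

Lemma eq_specfun n (A : 'M[C]_n) f g :
  (forall i, f (spectral_diag A 0 i) = g (spectral_diag A 0 i)) ->
  specfun f A = specfun g A.
Proof.
move=> h; rewrite /specfun; congr (_ *m diag_mx _ *m _).
by apply/rowP => i; rewrite !mxE h.
Qed.

Lemma specfun_comp n (A : 'M[C]_n) f g : (forall z, Num.conj_op (f z) = f z) ->
  specfun g (specfun f A) = specfun (g \o f) A.
Proof.
move=> h.
rewrite (specfun_diag g (specfun_herm A h) (spectral_unit A) (erefl _)).
congr (_ *m diag_mx _ *m _).
by apply/rowP => i; rewrite !mxE.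
Qed.

Lemma specfun_form n (A : 'M[C]_n) f (v : 'cV[C]_n) :
  (v^t* *m specfun f A *m v) 0 0 = \sum_i f (spectral_diag A 0 i) *
    ((spectralmx A *m v) i 0 * Num.conj_op ((spectralmx A *m v) i 0)).
Proof.
rewrite /specfun invmx_unitary ?spectral_unitarymx// !mulmxA -trmxCM -!mulmxA.
move: (spectralmx A *m v) => w; rewrite mxE; apply: eq_bigr => i _.
by rewrite mul_diag_mx !mxE mulrCA (mulrC (w i 0)).
Qed.

(** The witness is a column of the adjoint of the unitary matrix that
    diagonalizes A. *)
Lemma spectral_vec n (A : 'M[C]_n) (i : 'I_n) : A \is hermsymmx ->
  exists2 v : 'cV[C]_n, v != 0 & A *m v = spectral_diag A 0 i *: v.
Proof.
move=> /herm_spectral; move: (spectral_unitarymx A).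
move: (spectralmx A) (spectral_diag A) => S e uS AE.
exists (S^t* *m delta_mx i 0).
  apply/eqP => v0; have := congr1 (mulmx S) v0.
  rewrite mulmxA (unitarymxP uS) mul1mx mulmx0 => /matrixP /(_ i 0).
  by rewrite !mxE !eqxx => /eqP; rewrite oner_eq0.
rewrite AE -!mulmxA (mulmxA S) (unitarymxP uS) mul1mx invmx_unitary//.
rewrite scalemxAr; congr (_ *m _).
apply/matrixP => k j; rewrite mul_diag_mx !mxE.
by case: eqP => [->//|]; rewrite !mulr0.
Qed.

End AbstractCalculus.

Section Calculus.
Context {R : realType}.
Local Notation C := R[i].

Lemma conj_realC (r : R) : Num.conj_op (r%:C : C) = r%:C.
Proof. exact: conjc_real. Qed.

(** Functional calculus for real functions of Hermitian matrices; [mxpow] is the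
    case of a power function. *)
Definition mxfun n (f : R -> R) (A : 'M[C]_n) : 'M[C]_n :=
  specfun (fun z : C => (f (complex.Re z))%:C) A.

Lemma mxpowE n (A : 'M[C]_n) r : mxpow A r = mxfun (fun t => t `^ r) A.
Proof. by []. Qed.

Lemma mxfun_herm n (A : 'M[C]_n) f : mxfun f A \is hermsymmx.
Proof. by apply: specfun_herm => z; exact: conj_realC. Qed.

Lemma mxfunM n (A : 'M[C]_n) f g :
  mxfun (fun t => f t * g t) A = mxfun f A *m mxfun g A.
Proof.
by rewrite /mxfun -specfunM; apply: eq_specfun => i; rewrite rmorphM.
Qed.

Lemma mxfunD n (A : 'M[C]_n) f g :
  mxfun (fun t => f t + g t) A = mxfun f A + mxfun g A.
Proof.
by rewrite /mxfun -specfunD; apply: eq_specfun => i; rewrite rmorphD.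
Qed.

Lemma mxfun_cst n (A : 'M[C]_n) c : mxfun (fun=> c) A = (c%:C)%:M.
Proof. exact: specfun_cst. Qed.

Lemma mxfun_comp n (A : 'M[C]_n) f g :
  mxfun g (mxfun f A) = mxfun (g \o f) A.
Proof. by rewrite /mxfun specfun_comp// => z; exact: conj_realC. Qed.

Lemma spectral_diag_Re n (A : 'M[C]_n) i : A \is hermsymmx ->
  spectral_diag A 0 i = (complex.Re (spectral_diag A 0 i))%:C.
Proof.
move=> hA; have /mxOverP /(_ 0 i) := hermitian_spectral_diag_real hA.
by move/RRe_real => ->.
Qed.

Lemma mxfun_id n (A : 'M[C]_n) : A \is hermsymmx -> mxfun id A = A.
Proof.
by move=> hA; apply: specfun_id => // i; rewrite [RHS]spectral_diag_Re.
Qed.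

Lemma mulC_conj (z : C) :
  z * Num.conj_op z = (complex.Re z ^+ 2 + complex.Im z ^+ 2)%:C.
Proof. by rewrite add_Re2_Im2 sqr_normc. Qed.

Lemma qform_mxfunE n (A : 'M[C]_n) f (v : 'cV[C]_n) :
  (v^t* *m mxfun f A *m v) 0 0 = (\sum_i f (complex.Re (spectral_diag A 0 i)) *
    (complex.Re ((spectralmx A *m v) i 0) ^+ 2 +
     complex.Im ((spectralmx A *m v) i 0) ^+ 2))%:C.
Proof.
rewrite specfun_form rmorph_sum; apply: eq_bigr => i _.
by rewrite mulC_conj -rmorphM.
Qed.

(** The form v^* A v of a Hermitian matrix is real; only its real part is kept,
    to be able to compare forms in R. *)
Definition qform n (A : 'M[C]_n) (v : 'cV[C]_n) : R :=
  complex.Re ((v^t* *m A *m v) 0 0).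

Lemma dot_sqnorm n (v : 'cV[C]_n) : (v^t* *m v) 0 0 = (sqnorm v)%:C.
Proof.
rewrite mxE /sqnorm rmorph_sum; apply: eq_bigr => i _.
by rewrite mxE mxE mulrC mulC_conj.
Qed.

Lemma herm_real n (A : 'M[C]_n) (v : 'cV[C]_n) : A \is hermsymmx ->
  (v^t* *m A *m v) 0 0 = (qform A v)%:C.
Proof.
by move=> hA; rewrite /qform -{1 2}(mxfun_id hA) qform_mxfunE.
Qed.

Lemma posdef_herm n (A : 'M[C]_n) : posdef A -> A \is hermsymmx.
Proof. by case. Qed.

Lemma posdef_qform n (A : 'M[C]_n) v : posdef A -> v != 0 -> 0 < qform A v.
Proof.
by case=> hA pA v0; have := pA _ v0; rewrite herm_real// ltcR.
Qed.

Lemma posdefP n (A : 'M[C]_n) : A \is hermsymmx ->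
  (forall v, v != 0 -> 0 < qform A v) -> posdef A.
Proof. by move=> hA h; split=> // v v0; rewrite herm_real// ltcR h. Qed.

Lemma qform_mxfun n (A : 'M[C]_n) f (v : 'cV[C]_n) :
  qform (mxfun f A) v = \sum_i f (complex.Re (spectral_diag A 0 i)) *
    (complex.Re ((spectralmx A *m v) i 0) ^+ 2 +
     complex.Im ((spectralmx A *m v) i 0) ^+ 2).
Proof. by rewrite /qform qform_mxfunE. Qed.

Lemma posdef_spectral n (A : 'M[C]_n) i : posdef A ->
  0 < complex.Re (spectral_diag A 0 i).
Proof.
move=> pA; have hA := posdef_herm pA.
have [v v0 Av] := spectral_vec i hA.
have := posdef_qform pA v0; rewrite /qform -mulmxA Av -scalemxAr mxE dot_sqnorm.
rewrite spectral_diag_Re// -rmorphM /=.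
by rewrite pmulr_lgt0// lt_def sqnorm_ge0 andbT -vnorm_sqr sqrf_eq0;
   apply: contraNN v0 => /eqP/vnorm_eq0 ->.
Qed.

Lemma eq_mxfun n (A : 'M[C]_n) f g : posdef A ->
  (forall t, 0 < t -> f t = g t) -> mxfun f A = mxfun g A.
Proof.
move=> pA fg; apply: eq_specfun => i; rewrite fg//.
exact: posdef_spectral.
Qed.

Lemma mxfun_posdef n (A : 'M[C]_n) f : posdef A ->
  (forall t, 0 < t -> 0 < f t) -> posdef (mxfun f A).
Proof.
move=> pA f0; apply: posdefP; first exact: mxfun_herm.
move=> v v0; pose w := spectralmx A *m v.
have w0 : w != 0.
  apply: contraNN v0 => /eqP w0.
  by rewrite -(mulKmx (spectral_unit A) v) -/w w0 mulmx0.
rewrite qform_mxfun -/w.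
rewrite lt_def sumr_ge0 ?andbT; last first.
  move=> i _; rewrite mulr_ge0// ?addr_ge0 ?sqr_ge0// ltW// f0//.
  exact: posdef_spectral.
apply: contraNN w0; rewrite psumr_eq0; last first.
  move=> i _; rewrite mulr_ge0// ?addr_ge0 ?sqr_ge0// ltW// f0//.
  exact: posdef_spectral.
move=> /allP h; apply/eqP/matrixP => i j; rewrite ord1 [RHS]mxE.
have := h i (mem_index_enum i); rewrite mulf_eq0 gt_eqF/=; last first.
  by apply/f0/posdef_spectral.
rewrite paddr_eq0 ?sqr_ge0// !sqrf_eq0.
by case: (w i 0) => a b /= /andP[/eqP -> /eqP ->].
Qed.

Lemma mxpow_posdef n (A : 'M[C]_n) r : posdef A -> posdef (mxpow A r).
Proof. by move=> pA; rewrite mxpowE; apply: mxfun_posdef => // t; exact: powR_gt0. Qed.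

Lemma mxpowD n (A : 'M[C]_n) r s : posdef A ->
  mxpow A (r + s) = mxpow A r *m mxpow A s.
Proof.
move=> pA; rewrite !mxpowE -mxfunM; apply: eq_mxfun => // t t0.
by rewrite powRD// (gt_eqF t0) /= implybT.
Qed.

Lemma mxpow0 n (A : 'M[C]_n) : mxpow A 0 = 1%:M.
Proof.
rewrite mxpowE -[RHS](mxfun_cst A 1); congr mxfun.
by apply/funext => t; rewrite powRr0.
Qed.

Lemma mxpow1 n (A : 'M[C]_n) : posdef A -> mxpow A 1 = A.
Proof.
move=> pA; transitivity (mxfun id A); last exact/mxfun_id/posdef_herm.
by rewrite mxpowE; apply: eq_mxfun => // t t0; rewrite powRr1// ltW.
Qed.

Lemma mxpowM n (A : 'M[C]_n) r s : posdef A ->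
  mxpow (mxpow A r) s = mxpow A (r * s).
Proof.
by move=> pA; rewrite !mxpowE mxfun_comp; apply: eq_mxfun => // t t0 /=;
   rewrite powRrM.
Qed.

Lemma mxpowN n (A : 'M[C]_n) r : posdef A ->
  mxpow A r *m mxpow A (- r) = 1%:M /\ mxpow A (- r) *m mxpow A r = 1%:M.
Proof.
by move=> pA; split; rewrite -(mxpowD _ _ pA) ?subrr ?addNr mxpow0.
Qed.

End Calculus.

(** * Order of quadratic forms, and bounded inverses *)

Section AbstractInverse.

Lemma invmx_factor (F : fieldType) n (A S : 'M[F]_n) : S \in unitmx ->
  A *m invmx S \in unitmx ->
  A \in unitmx /\ S *m invmx A = invmx (A *m invmx S).
Proof.
move=> Su Mu; have Au : A \in unitmx by move: Mu; rewrite unitmx_mul => /andP[].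
split=> //; apply: (can_inj (mulmxK Mu)).
by rewrite mulVmx// !mulmxA mulmxKV// mulmxV.
Qed.

Lemma det_eigenvalues (C : numClosedFieldType) n (M : 'M[C]_n) :
  exists2 s : seq C, size s = n & all (eigenvalue M) s /\
    `|\det M| = \prod_(z <- s) `|z|.
Proof.
have [s sE] := closed_field_poly_normal (char_poly M).
have lc : lead_coef (char_poly M) = 1 by apply/eqP; exact: char_poly_monic.
rewrite lc scale1r in sE.
have sz : size s = n.
  have := size_char_poly M; rewrite sE size_prod_XsubC; exact: succn_inj.
exists s => //; split.
  apply/allP => z zs; rewrite eigenvalue_root_char sE root_prod_XsubC//.
have := char_poly_det M; rewrite -horner_coef0 sE horner_prod => h.
have -> : `|\det M| = `|(- 1) ^+ n * \det M|.
  by rewrite normrM normrX normrN1 expr1n mul1r.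
rewrite -h normr_prod; apply: eq_bigr => z _.
by rewrite !hornerE normrN.
Qed.

Lemma prod_lower (F : numDomainType) (T : eqType) (s : seq T) (f : T -> F) c :
  0 <= c -> (forall z, z \in s -> c <= f z) ->
  c ^+ size s <= \prod_(z <- s) f z.
Proof.
move=> c0; elim: s => [|z s IH] h; first by rewrite big_nil.
rewrite big_cons exprS ler_pM ?exprn_ge0//; first by apply: h; rewrite mem_head.
by apply: IH => y ys; apply: h; rewrite inE ys orbT.
Qed.

End AbstractInverse.

Section Comparison.
Context {R : realType}.
Local Notation C := R[i].

Lemma dot_Re n (u v : 'cV[C]_n) : complex.Re ((v^t* *m u) 0 0) =
  \sum_i (complex.Re (v i 0) * complex.Re (u i 0) +
          complex.Im (v i 0) * complex.Im (u i 0)).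
Proof.
rewrite mxE cRe_sum; apply: eq_bigr => i _.
rewrite !mxE cReM; case: (v i 0) => a b /=; ring.
Qed.

Lemma sqnorm_comb n (x y : R) (u v : 'cV[C]_n) :
  sqnorm (x%:C *: u + y%:C *: v) =
  x ^+ 2 * sqnorm u + 2 * x * y * complex.Re ((v^t* *m u) 0 0) + y ^+ 2 * sqnorm v.
Proof.
rewrite dot_Re /sqnorm !mulr_sumr -!big_split/=; apply: eq_bigr => i _.
rewrite !mxE cReD cImD !cReM !cImM /=; ring.
Qed.

Lemma qformB n (A B : 'M[C]_n) c v : qform (A - c%:C *: B) v = qform A v - c * qform B v.
Proof.
rewrite /qform mulmxBr mulmxBl -scalemxAr -scalemxAl.
move: (v^t* *m A *m v) (v^t* *m B *m v) => X Y.
by rewrite !mxE cReD cReN cReM /= mul0r subr0.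
Qed.

(** S^2 <= c^2 B^2 implies S <= c B. If S - c B had an eigenvalue r > 0 with
    eigenvector w, then S w = c B w + r w would give
    |S w|^2 = c^2 |B w|^2 + 2 c r <B w, w> + r^2 |w|^2 > c^2 |B w|^2. *)
Lemma loewner n (S B : 'M[C]_n) (c : R) : S \is hermsymmx -> posdef B -> 0 <= c ->
  (forall v : 'cV[C]_n, vnorm (S *m v) <= c * vnorm (B *m v)) ->
  forall v, qform S v <= c * qform B v.
Proof.
move=> hS pB c0 SB v.
have hH : S - c%:C *: B \is hermsymmx.
  apply/hermsymmxP; rewrite linearB linearZ/= map_mxB map_mxZ/= conj_realC.
  by move/hermsymmxP : hS => ->; move/hermsymmxP : (posdef_herm pB) => ->.
rewrite -subr_le0 -qformB -(mxfun_id hH) qform_mxfun sumr_le0// => i _.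
rewrite mulr_le0_ge0// ?addr_ge0 ?sqr_ge0//.
rewrite leNgt; apply/negP => d0.
have [w w0 Hw] := spectral_vec i hH.
rewrite (spectral_diag_Re i hH) in Hw.
move: d0 Hw; set r := complex.Re _ => r0 Hw.
have Sw : S *m w = c%:C *: (B *m w) + r%:C *: w.
  by rewrite -Hw mulmxBl -scalemxAl addrC subrK.
have := SB w; rewrite -(@ler_pXn2r _ 2) ?nnegrE ?vnorm_ge0 ?mulr_ge0 ?vnorm_ge0//.
rewrite exprMn !vnorm_sqr Sw sqnorm_comb mulmxA -/(qform B w).
apply/negP; rewrite -ltNge -addrA ltrDl.
rewrite ltr_wpDl// ?mulr_ge0// ?ltW// ?posdef_qform//.
rewrite mulr_gt0 ?exprn_gt0// lt_def sqnorm_ge0 andbT -vnorm_sqr sqrf_eq0.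
by apply: contraNN w0 => /eqP/vnorm_eq0 ->.
Qed.

Lemma cnorm1_det n (M : 'M[C]_n) : cnorm1 (\det M) <= (n`!)%:R * entrynorm M ^+ n.
Proof.
rewrite /determinant; apply: le_trans (cnorm1_sum _ _ _) _.
apply: (@le_trans _ _ (\sum_(s : {perm 'I_n}) entrynorm M ^+ n)); last first.
  by rewrite sumr_const card_Sn mulr_natl.
apply: ler_sum => s _.
rewrite (_ : cnorm1 _ = cnorm1 (\prod_i M i (s i))); last first.
  by case: (odd_perm s); rewrite ?expr1 ?mulN1r ?cnorm1N ?expr0 ?mul1r.
apply: le_trans (cnorm1_prod _ _ _) _.
rewrite -[X in _ ^+ X](card_ord n) -prodr_const; apply: ler_prod => i _.
by rewrite cnorm1_ge0 cnorm1_le_entrynorm.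
Qed.

Lemma entrynorm_minor m n (M : 'M[C]_(m, n)) i j : entrynorm (row' i (col' j M)) <= entrynorm M.
Proof.
case: m n M i j => [|m] [|n] M [i ilt] // [j jlt] //.
set I := Ordinal ilt; set J := Ordinal jlt.
rewrite /entrynorm [leRHS](bigD1_ord I)//= ler_wpDl//.
  by rewrite sumr_ge0// => k _; exact: cnorm1_ge0.
apply: ler_sum => k _; rewrite [leRHS](bigD1_ord J)//= ler_wpDl ?cnorm1_ge0//.
by apply: ler_sum => l _; rewrite !mxE.
Qed.

Lemma entrynorm_adj n (M : 'M[C]_n) :
  entrynorm (\adj M) <= (n ^ 2)%:R * ((n.-1`!)%:R * entrynorm M ^+ n.-1).
Proof.
apply: (@le_trans _ _
  (\sum_(i < n) \sum_(j < n) ((n.-1`!)%:R * entrynorm M ^+ n.-1))).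
  apply: ler_sum => i _; apply: ler_sum => j _; rewrite mxE /cofactor.
  rewrite (_ : cnorm1 _ = cnorm1 (\det (row' j (col' i M)))); last first.
    rewrite -signr_odd.
    by case: (odd _); rewrite ?expr1 ?mulN1r ?cnorm1N ?expr0 ?mul1r.
  apply: le_trans (cnorm1_det _) _; rewrite ler_wpM2l//.
  by apply: lerXn2r; rewrite ?nnegrE ?entrynorm_ge0// entrynorm_minor.
rewrite !sumr_const card_ord -[_ *+ n *+ n]mulr_natr -[_ *+ n]mulr_natr.
by rewrite -mulrA -natrM mulrC.
Qed.

(** The hypothesis bounds the modulus of z from below; the factor 2 compares the
    modulus with [cnorm1]. *)
Lemma cnorm1_inv_le (z : C) (k : R) : 0 < k -> (k^-1)%:C <= `|z| -> cnorm1 z^-1 <= 2 * k.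
Proof.
move=> k0; rewrite {1}normc_def lecR => kz.
have z0 : z != 0.
  apply: contraTneq kz => ->; rewrite /= expr0n/= addr0 sqrtr0 -ltNge.
  by rewrite invr_gt0.
have : `|z^-1| <= k%:C.
  rewrite normfV -[leRHS]invrK lef_pV2 ?posrE ?normr_gt0//.
    by rewrite -fmorphV normc_def lecR.
  by rewrite -fmorphV ltcR invr_gt0.
rewrite normc_def lecR => h.
rewrite /cnorm1 mulr_natl mulr2n; apply: lerD; apply: le_trans h;
  rewrite -sqrtr_sqr; apply: ler_wsqrtr; [rewrite lerDl|rewrite lerDr];
  exact: sqr_ge0.
Qed.

(** 2 k^n bounds the inverse of the determinant and the other factor bounds the
    adjugate, in [inverse_bound]. *)
Definition inv_const (n : nat) (k : R) : R :=
  2 * k ^+ n * ((n ^ 2)%:R * ((n.-1`!)%:R * k ^+ n.-1)).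

Lemma posdef_unit n (A : 'M[C]_n) : posdef A -> A \in unitmx.
Proof.
move=> pA; rewrite -unitmx_tr -row_free_unit -kermx_eq0; apply/eqP.
apply/row_matrixP => i; rewrite row0; apply/eqP; apply: contraT => r0.
have kr : row i (kermx A^T) *m A^T = 0 by apply/sub_kermxP; exact: row_sub.
move: (row i _) r0 kr => r r0 kr.
have Ar : A *m r^T = 0.
  by apply: (@trmx_inj C n 1); rewrite trmx_mul trmxK kr trmx0.
have := @posdef_qform _ _ A r^T pA.
rewrite -trmx0 (inj_eq (@trmx_inj _ _ _)) => /(_ r0).
by rewrite /qform -mulmxA Ar mulmx0 mxE ltxx.
Qed.

(** A left eigenvector v of M = A S^-1 with eigenvalue z satisfies v A = z v S,
    so z is the quotient of the forms of A and S at v^*, and 1/k <= Re z. Thus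
    the determinant of M, the product of its eigenvalues, is at least k^-n in
    modulus, and S A^-1 = M^-1 is the quotient of the adjugate of M by it. *)
Lemma inverse_bound n (A S : 'M[C]_n) (k : R) : 0 < k -> posdef S ->
  (forall v, qform S v <= k * qform A v) -> entrynorm (A *m invmx S) <= k ->
  A \in unitmx /\ entrynorm (S *m invmx A) <= inv_const n k.
Proof.
move=> k0 pS SA Mk; have Su := posdef_unit pS.
have [s sz [/allP sev detE]] := det_eigenvalues (A *m invmx S).
have dlb : ((k ^+ n)^-1)%:C <= `|\det (A *m invmx S)|.
  rewrite detE -exprVn rmorphXn -sz; apply: prod_lower => [|z zs].
    by rewrite lecR invr_ge0 (ltW k0).
  have /eigenvalueP[v vM v0] := sev _ zs.
  have vA : v *m A = z *: (v *m S).
    by rewrite scalemxAl -vM -!mulmxA mulVmx// mulmx1.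
  have : qform A (v^t*) = complex.Re z * qform S (v^t*).
    rewrite /qform trmxCK vA -scalemxAl mxE cReM.
    have := herm_real (v^t*) (posdef_herm pS); rewrite trmxCK => -> /=.
    by rewrite mulr0 subr0 /qform trmxCK.
  have pv : 0 < qform S (v^t*).
    apply: posdef_qform => //; apply: contraNN v0 => /eqP h.
    by rewrite -(trmxCK v) h trmx0 map_mx0.
  have := SA (v^t*) => /[swap] -> h.
  have rz : k^-1 <= complex.Re z.
    by rewrite -[leLHS]mulr1 ler_pdivrMl// -(ler_pM2r pv) mul1r -mulrA.
  rewrite normc_def lecR; apply: le_trans rz _; apply: le_trans (ler_norm _) _.
  by rewrite -sqrtr_sqr; apply: ler_wsqrtr; rewrite lerDl sqr_ge0.
have kn0 : 0 < k ^+ n by rewrite exprn_gt0.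
have d0 : \det (A *m invmx S) != 0.
  rewrite -normr_gt0; apply: lt_le_trans dlb.
  by rewrite ltcR invr_gt0.
have Mu : A *m invmx S \in unitmx by rewrite unitmxE unitfE.
have [Au ->] := invmx_factor Su Mu; split=> //.
rewrite /invmx Mu; move: Mk dlb; move: (A *m invmx S) => M Mk dlb.
have -> : (\det M)^-1 *: \adj M = ((\det M)^-1)%:M *m \adj M.
  by rewrite mul_scalar_mx.
apply: (@le_trans _ _ (cnorm1 (\det M)^-1 * entrynorm (\adj M))).
  rewrite mul_scalar_mx /entrynorm mulr_sumr; apply: ler_sum => i _.
  by rewrite mulr_sumr; apply: ler_sum => j _; rewrite mxE cnorm1M.
rewrite /inv_const ler_pM ?cnorm1_ge0 ?entrynorm_ge0//; first exact: cnorm1_inv_le.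
apply: le_trans (entrynorm_adj _) _; rewrite !ler_wpM2l//.
by apply: lerXn2r; rewrite ?nnegrE ?entrynorm_ge0// ltW.
Qed.

End Comparison.

(** * Measurability of real powers of a measurable matrix function *)

Section Newton.
Context {R : realType}.

Lemma cvg_sumr (I : Type) (s : seq I) (f : I -> R^nat) (l : I -> R) :
  (forall i, f i @ \oo --> l i) ->
  (fun k => \sum_(i <- s) f i k) @ \oo --> \sum_(i <- s) l i.
Proof.
move=> h; elim: s => [|i s IH].
  rewrite big_nil (_ : (fun k => _) = cst 0); first exact: cvg_cst.
  by apply/funext => k; rewrite big_nil.
rewrite big_cons (_ : (fun k => _) =
  (fun k => f i k + \sum_(j <- s) f j k)); first exact: cvgD.
by apply/funext => k; rewrite big_cons.
Qed.

(** Newton's iteration for the equation expR y = t, started at 0. It only uses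
    the ring operations and the exponential, which is itself a limit of
    polynomials: this presents the logarithm as an iterated pointwise limit of
    polynomials, for which the functional calculus is visibly measurable. *)
Fixpoint newton_ln (k : nat) (t : R) : R :=
  if k is k'.+1 then newton_ln k' t - 1 + t * expR (- newton_ln k' t) else 0.

(** By convexity of the exponential, every step lands above ln t; from there the
    iteration decreases, so it converges, and its limit is a fixed point. *)
Lemma newton_ln_cvg (t : R) : 0 < t -> newton_ln ^~ t @ \oo --> ln t.
Proof.
move=> t0; pose y k := newton_ln k.+1 t.
have yS k : y k.+1 = y k - 1 + t * expR (- y k) by [].
have step (s : R) : ln t <= s - 1 + t * expR (- s).
  rewrite -{2}(lnK (t0 : t \is Num.pos)) -expRD.
  by have := expR_ge1Dx (ln t - s); lra.
have ylb k : ln t <= y k by exact: step.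
have ydec : {homo y : n m / (n <= m)%N >-> m <= n}.
  apply/nonincreasing_seqP => k; rewrite yS.
  suff : t * expR (- y k) <= 1 by lra.
  rewrite -{1}(lnK (t0 : t \is Num.pos)) -expRD -expR0 ler_expR subr_le0.
  exact: ylb.
have ycvg : cvgn y.
  by apply: nonincreasing_is_cvgn => //; exists (ln t) => _ [k _ <-]; exact: ylb.
set l := limn y in ycvg.
have yS' : y k.+1 @[k --> \oo] --> l - 1 + t * expR (- l).
  rewrite (_ : (fun k => y k.+1) = fun k => y k - 1 + t * expR (- y k)); last first.
    by apply/funext.
  apply: cvgD; first by apply: cvgB => //; exact: cvg_cst.
  apply: cvgM; first exact: cvg_cst.
  apply: continuous_cvg; first exact: continuous_expR.
  exact: cvgN.
have lE : l = l - 1 + t * expR (- l).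
  have h : y k.+1 @[k --> \oo] --> l.
    by move: ycvg; rewrite -(cvg_shiftS y (nbhs l)).
  exact: (cvg_unique _ h yS').
have tl : ln t = l.
  have : t * expR (- l) = 1 by lra.
  rewrite expRN => /(canRL (mulfK _)) -> //; last by rewrite invr_eq0 gt_eqF ?expR_gt0.
  by rewrite mul1r invrK expRK.
by rewrite tl -(cvg_shiftS (newton_ln ^~ t) (nbhs l)).
Qed.
End Newton.

Section Measurability.
Context {R : realType} d (T : measurableType d).
Local Notation C := R[i].

Definition cmeas (f : T -> C) : Prop :=
  measurable_fun [set: T] (fun x => complex.Re (f x)) /\
  measurable_fun [set: T] (fun x => complex.Im (f x)).

Definition mxmeas m n (F : T -> 'M[C]_(m, n)) : Prop :=
  forall i j, cmeas (fun x => F x i j).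

Lemma cmeas_cst c : cmeas (fun=> c).
Proof. by split; exact: measurable_cst. Qed.

Lemma cmeas_real (f : T -> R) : measurable_fun [set: T] f ->
  cmeas (fun x => (f x)%:C).
Proof. by move=> mf; split => //=; exact: measurable_cst. Qed.

Lemma cmeasD f g : cmeas f -> cmeas g -> cmeas (fun x => f x + g x).
Proof.
move=> [f1 f2] [g1 g2]; split.
  by under eq_fun do rewrite cReD; exact: measurable_funD.
by under eq_fun do rewrite cImD; exact: measurable_funD.
Qed.

Lemma cmeasM f g : cmeas f -> cmeas g -> cmeas (fun x => f x * g x).
Proof.
move=> [f1 f2] [g1 g2]; split.
  by under eq_fun do rewrite cReM; apply: measurable_funB; exact: measurable_funM.
by under eq_fun do rewrite cImM; apply: measurable_funD; exact: measurable_funM.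
Qed.

Lemma cmeas_sum (I : Type) (s : seq I) (P : pred I) (F : I -> T -> C) :
  (forall i, cmeas (F i)) -> cmeas (fun x => \sum_(i <- s | P i) F i x).
Proof.
move=> h; elim: s => [|i s IH].
  by under eq_fun do rewrite big_nil; exact: cmeas_cst.
under eq_fun do rewrite big_cons; case: (P i) => //.
by apply: cmeasD.
Qed.

Lemma cmeas_conj f : cmeas f -> cmeas (fun x => Num.conj_op (f x)).
Proof.
move=> [f1 f2]; split.
  by rewrite (_ : (fun x => _) = (fun x => complex.Re (f x)))//;
     apply/funext => x; case: (f x).
rewrite (_ : (fun x => _) = (fun x => - complex.Im (f x))).
  exact: measurable_funN.
by apply/funext => x; case: (f x).
Qed.

Lemma mxmeas_cst m n (A : 'M[C]_(m, n)) : mxmeas (fun=> A).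
Proof. by move=> i j; exact: cmeas_cst. Qed.

Lemma mxmeasD m n (F G : T -> 'M[C]_(m, n)) : mxmeas F -> mxmeas G ->
  mxmeas (fun x => F x + G x).
Proof.
by move=> mF mG i j; under eq_fun do rewrite mxE; exact: cmeasD.
Qed.

Lemma mxmeasZ m n (c : C) (F : T -> 'M[C]_(m, n)) : mxmeas F ->
  mxmeas (fun x => c *: F x).
Proof.
move=> mF i j; under eq_fun do rewrite mxE.
by apply: cmeasM => //; exact: cmeas_cst.
Qed.

Lemma mxmeasB m n (F G : T -> 'M[C]_(m, n)) : mxmeas F -> mxmeas G ->
  mxmeas (fun x => F x - G x).
Proof.
move=> mF mG; under eq_fun do rewrite -scaleN1r.
by apply: mxmeasD => //; exact: mxmeasZ.
Qed.

Lemma mxmeasM m n k (F : T -> 'M[C]_(m, n)) (G : T -> 'M[C]_(n, k)) :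
  mxmeas F -> mxmeas G -> mxmeas (fun x => F x *m G x).
Proof.
move=> mF mG i j; under eq_fun do rewrite mxE.
by apply: cmeas_sum => l; exact: cmeasM.
Qed.

Lemma mxmeas_trC m n (F : T -> 'M[C]_(m, n)) : mxmeas F ->
  mxmeas (fun x => (F x)^t*).
Proof.
by move=> mF i j; under eq_fun do rewrite !mxE; exact: cmeas_conj.
Qed.

Lemma mxmeas_block m n k l (F : T -> 'M[C]_(m, n)) (G : T -> 'M[C]_(m, k))
  (H : T -> 'M[C]_(l, n)) (K : T -> 'M[C]_(l, k)) :
  mxmeas F -> mxmeas G -> mxmeas H -> mxmeas K ->
  mxmeas (fun x => block_mx (F x) (G x) (H x) (K x)).
Proof.
move=> mF mG mH mK i j.
case: (split_ordP i) (split_ordP j) => i' -> [] j' ->.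
- by under eq_fun do rewrite block_mxEul; exact: mF.
- by under eq_fun do rewrite block_mxEur; exact: mG.
- by under eq_fun do rewrite block_mxEdl; exact: mH.
- by under eq_fun do rewrite block_mxEdr; exact: mK.
Qed.

Lemma measurable_cnorm1 (f : T -> C) : cmeas f -> measurable_fun [set: T] (cnorm1 \o f).
Proof.
by move=> [f1 f2]; apply: measurable_funD; apply: measurableT_comp.
Qed.

Lemma measurable_sumr (I : Type) (s : seq I) (F : I -> T -> R) :
  (forall i, measurable_fun [set: T] (F i)) ->
  measurable_fun [set: T] (fun x => \sum_(i <- s) F i x).
Proof.
move=> h; elim: s => [|i s IH].
  by under eq_fun do rewrite big_nil; exact: measurable_cst.
by under eq_fun do rewrite big_cons; exact: measurable_funD.
Qed.

Lemma measurable_entrynorm m n (F : T -> 'M[C]_(m, n)) : mxmeas F ->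
  measurable_fun [set: T] (fun x => entrynorm (F x)).
Proof.
move=> mF; apply: measurable_sumr => i; apply: measurable_sumr => j.
exact: measurable_cnorm1.
Qed.

Lemma measurable_vnorm n (F : T -> 'cV[C]_n) : mxmeas F ->
  measurable_fun [set: T] (fun x => vnorm (F x)).
Proof.
move=> mF; under eq_fun do rewrite vnormE -powR12_sqrt ?sqnorm_ge0//.
apply: (measurableT_comp (measurable_powR _)).
apply: measurable_sumr => i; have [m1 m2] := mF i 0.
by apply: measurable_funD; exact: measurable_funX.
Qed.

(** Each entry is a linear combination of the values of f at the eigenvalues:
    pointwise limits of functions give entrywise limits of matrices. *)
Lemma mxfun_entry n (A : 'M[C]_n) f i j :
  mxfun f A i j = \sum_l (f (complex.Re (spectral_diag A 0 l)))%:C *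
    ((invmx (spectralmx A)) i l * spectralmx A l j).
Proof.
rewrite /mxfun /specfun mxE; apply: eq_bigr => l _.
by rewrite mul_mx_diag !mxE mulrAC mulrC.
Qed.

Section SpectralCalculus.
Variables (n : nat) (A : T -> 'M[C]_n).
Hypothesis mA : mxmeas A.
Hypothesis pA : forall x, posdef (A x).

(** The class of functions with measurable functional calculus contains the
    constants and the identity and is closed under sums, products and pointwise
    limits on the positive reals, hence contains t |-> expR (r * ln t). *)
Let good (f : R -> R) := mxmeas (fun x => mxfun f (A x)).

Let eq_good f g : (forall t, 0 < t -> f t = g t) -> good g -> good f.
Proof.
move=> fg; rewrite /good.
by under [in X in _ -> X]eq_fun do rewrite (eq_mxfun (pA _) fg).
Qed.

Let good_id : good id.
Proof.
rewrite /good; under eq_fun do rewrite mxfun_id ?posdef_herm//.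
exact: mA.
Qed.

Let good_cst c : good (fun=> c).
Proof. by rewrite /good; under eq_fun do rewrite mxfun_cst; exact: mxmeas_cst. Qed.

Let goodD f g : good f -> good g -> good (fun t => f t + g t).
Proof.
move=> gf gg; rewrite /good.
have -> : (fun x => mxfun (fun t => f t + g t) (A x)) =
    (fun x => mxfun f (A x) + mxfun g (A x)).
  by apply/funext => x; exact: mxfunD.
exact: mxmeasD gf gg.
Qed.

Let goodM f g : good f -> good g -> good (fun t => f t * g t).
Proof.
move=> gf gg; rewrite /good.
have -> : (fun x => mxfun (fun t => f t * g t) (A x)) =
    (fun x => mxfun f (A x) *m mxfun g (A x)).
  by apply/funext => x; exact: mxfunM.
exact: mxmeasM gf gg.
Qed.

Let good_lim (f : (R -> R)^nat) g : (forall k, good (f k)) ->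
  (forall t, 0 < t -> f ^~ t @ \oo --> g t) -> good g.
Proof.
move=> gf fg i j.
have key (h : R[i] -> R) (hD : forall (I : Type) (s : seq I) (P : pred I) (F : I -> C),
    h (\sum_(i <- s | P i) F i) = \sum_(i <- s | P i) h (F i))
    (hM : forall (r : R) z, h (r%:C * z) = r * h z)
    (mh : forall k, measurable_fun [set: T] (fun x => h (mxfun (f k) (A x) i j))) :
    measurable_fun [set: T] (fun x => h (mxfun g (A x) i j)).
  apply: (measurable_fun_cvg mh) => x _.
  have hE phi : h (mxfun phi (A x) i j) =
      \sum_l phi (complex.Re (spectral_diag (A x) 0 l)) *
      h ((invmx (spectralmx (A x))) i l * spectralmx (A x) l j).
    by rewrite mxfun_entry hD; apply: eq_bigr => l _; rewrite hM.
  have E : (fun k => h (mxfun (f k) (A x) i j)) = (fun k =>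
      \sum_l f k (complex.Re (spectral_diag (A x) 0 l)) *
      h ((invmx (spectralmx (A x))) i l * spectralmx (A x) l j)).
    by apply/funext => k; exact: hE.
  suff H : (fun k => \sum_l f k (complex.Re (spectral_diag (A x) 0 l)) *
      h ((invmx (spectralmx (A x))) i l * spectralmx (A x) l j)) @ \oo -->
      h (mxfun g (A x) i j).
    exact: (eq_ind_r (fun u => u @ \oo --> h (mxfun g (A x) i j)) H E).
  rewrite hE; apply: cvg_sumr => l.
  apply: cvgM; last exact: cvg_cst.
  by apply: fg; exact: posdef_spectral.
split; apply: key.
- by move=> *; rewrite cRe_sum.
- by move=> r z; rewrite cReM /= mul0r subr0.
- by move=> k; have [] := gf k i j.
- by move=> *; rewrite cIm_sum.
- by move=> r z; rewrite cImM /= mul0r addr0.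
- by move=> k; have [] := gf k i j.
Qed.

Let goodX f k : good f -> good (fun t => f t ^+ k).
Proof.
move=> gf; elim: k => [|k IH]; first exact: good_cst.
have -> : (fun t => f t ^+ k.+1) = (fun t => f t * f t ^+ k).
  by apply/funext => t; rewrite exprS.
exact: goodM gf IH.
Qed.

Let good_expR f : good f -> good (fun t => expR (f t)).
Proof.
move=> gf; apply: (@good_lim (fun k t => series (exp_coeff (f t)) k)).
  elim=> [|k IH].
    have -> : (fun t => series (exp_coeff (f t)) 0) = cst 0.
      by apply/funext => t; rewrite /series/= big_geq.
    exact: good_cst.
  have -> : (fun t => series (exp_coeff (f t)) k.+1) =
      (fun t => series (exp_coeff (f t)) k + f t ^+ k * (k`!%:R)^-1).
    by apply/funext => t; rewrite /series/= big_nat_recr.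
  exact: (goodD IH (goodM (goodX k gf) (good_cst _))).
by move=> t _; exact: is_cvg_series_exp_coeff.
Qed.

Let good_newton k : good (newton_ln k).
Proof.
elim: k => [|k IH]; first exact: good_cst.
have gN : good (fun t => (-1) * newton_ln k t) by exact: goodM (good_cst _) IH.
have gE := goodM good_id (good_expR gN).
apply: (eq_good _ (goodD (goodD IH (good_cst (-1))) gE)) => t _ /=.
by rewrite mulN1r.
Qed.

Lemma mxmeas_mxpow r : mxmeas (fun x => mxpow (A x) r).
Proof.
change (good (fun t => t `^ r)).
apply: (@eq_good _ (fun t => expR (r * ln t))).
  by move=> t t0; rewrite /powR gt_eqF.
exact: good_expR (goodM (good_cst r) (good_lim good_newton (@newton_ln_cvg R))).
Qed.

End SpectralCalculus.
End Measurability.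

Lemma mxmeas_comp {R : realType} d d' (T : measurableType d)
  (T' : measurableType d') m n (g : T' -> T) (F : T -> 'M[R[i]]_(m, n)) :
  measurable_fun [set: T'] g -> mxmeas F -> mxmeas (F \o g).
Proof.
move=> mg mF i j; have [m1 m2] := mF i j.
by split; [exact: (measurableT_comp m1)|exact: (measurableT_comp m2)].
Qed.

Local Open Scope ereal_scope.

(** * Integrals of nonnegative functions *)

Section PowR.
Context {R : realType}.

Lemma lee_poweR (x y : \bar R) (r : R) : (0 <= r)%R -> 0 <= x -> x <= y ->
  x `^ r <= y `^ r.
Proof.
move=> r0 x0 xy; apply: gt0_ler_poweR => //.
  by rewrite in_itv/= x0 leey.
by rewrite in_itv/= (le_trans x0 xy) leey.
Qed.

Lemma poweR_invK (x : \bar R) (r : R) : (r != 0)%R -> 0 <= x ->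
  (x `^ r) `^ r^-1 = x.
Proof. by move=> r0 x0; rewrite -poweRrM divff// poweRe1. Qed.

Lemma poweR_invVK (x : \bar R) (r : R) : (r != 0)%R -> 0 <= x ->
  (x `^ r^-1) `^ r = x.
Proof. by move=> r0 x0; rewrite -poweRrM mulVf// poweRe1. Qed.

Section Conj.
Variable p : R.
Hypothesis p1 : (1 < p)%R.
Let q := conj_exp p.

Lemma conj_p_gt0 : (0 < p)%R. Proof. exact: lt_trans ltr01 p1. Qed.

Lemma conj_gt1 : (1 < q)%R.
Proof.
rewrite /q /conj_exp invf_gt1; last by rewrite subr_gt0 invf_lt1// conj_p_gt0.
by rewrite gtrBl invr_gt0 conj_p_gt0.
Qed.

Lemma conj_gt0 : (0 < q)%R. Proof. exact: lt_trans ltr01 conj_gt1. Qed.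

Lemma conj_sum : (p^-1 + q^-1 = 1)%R.
Proof. by rewrite /q /conj_exp invrK addrC subrK. Qed.

Lemma conj_sumC : (q^-1 + p^-1 = 1)%R. Proof. by rewrite addrC conj_sum. Qed.

Lemma conj_div_gt0 : (0 < p / q)%R.
Proof. by rewrite divr_gt0 ?conj_p_gt0 ?conj_gt0. Qed.

Lemma le_one_poweR (u : \bar R) : 0 <= u -> u `^ q^-1 <= 1 + u `^ (p / q).
Proof.
move=> u0; have q0 := conj_gt0; have pq0 := conj_div_gt0.
have qn : (q^-1 != 0)%R by rewrite invr_neq0// gt_eqF.
have pqn : (p / q != 0)%R by rewrite gt_eqF.
case: u u0 => [r| |]// r0; last first.
  by rewrite (poweRyr qn) (poweRyr pqn).
rewrite !poweR_EFin -EFinD lee_fin; rewrite lee_fin in r0.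
have [r1|r1] := lerP r 1.
  apply: (@le_trans _ _ 1%R); last by rewrite lerDl powR_ge0.
  have qi : (0 <= q^-1)%R by rewrite invr_ge0 ltW.
  have := ge0_ler_powR qi r0 ler01 r1; by rewrite powR1.
apply: (@le_trans _ _ (r `^ (p / q))%R); last by rewrite lerDr.
apply: ler_powR; first exact: ltW.
rewrite -[leLHS]mul1r; apply: ler_wpM2r; last exact: ltW.
by rewrite invr_ge0; exact: ltW.
Qed.

Lemma young_poweR (a : R) (u : \bar R) : (0 <= a)%R -> 0 <= u ->
  a%:E * u `^ q^-1 <= (a `^ q)%:E + u `^ (p / q).
Proof.
move=> a0 u0; have q0 := conj_gt0; have pq0 := conj_div_gt0.
have qn : (q^-1 != 0)%R by rewrite invr_neq0// gt_eqF.
have pqn : (p / q != 0)%R by rewrite gt_eqF.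
have p0 := conj_p_gt0.
case: u u0 => [r| |]// r0; last first.
  by rewrite (poweRyr qn) (poweRyr pqn) leey.
rewrite !poweR_EFin -EFinM -EFinD lee_fin; rewrite lee_fin in r0.
have := conjugate_powR a0 (powR_ge0 r (q^-1)%R) q0 p0 conj_sumC.
move=> /le_trans; apply; apply: lerD.
  rewrite ler_pdivrMr// ler_peMr ?powR_ge0//; exact/ltW/conj_gt1.
have -> : ((r `^ q^-1) `^ p = r `^ (p / q))%R by rewrite -powRrM mulrC.
rewrite ler_pdivrMr// ler_peMr ?powR_ge0//; exact/ltW.
Qed.

End Conj.
End PowR.


Section IntegralAE.
Import HBNNSimple.
Context {R : realType} d (T : measurableType d) (mu : {measure set T -> \bar R}).

(** Neither function is assumed measurable: the integral of a nonnegative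
    function is a supremum over simple functions, and a simple function below f
    becomes one below g, with the same integral, once it is set to 0 on N. *)
Lemma ae_le_integral (D N : set T) (f g : T -> \bar R) :
  measurable N -> mu N = 0 ->
  (forall x, D x -> 0 <= f x) -> (forall x, D x -> 0 <= g x) ->
  (forall x, D x -> ~ N x -> f x <= g x) ->
  \int[mu]_(x in D) f x <= \int[mu]_(x in D) g x.
Proof.
move=> mN N0 f0 g0 fg; rewrite !ge0_integralE//.
apply: ge_ereal_sup => _ [h /= hf <-].
have mNC : measurable (~` N) by exact: measurableC.
pose h' : {nnsfun T >-> R} := proj_nnsfun h mNC.
apply: (@le_trans _ _ (sintegral mu h')).
  have := @integral_nnsfun _ _ _ mu setT measurableT h.
  have := @integral_nnsfun _ _ _ mu setT measurableT h'.
  rewrite !patch_setT => <- <-.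
  rewrite le_eqVlt; apply/orP; left; apply/eqP.
  apply: ae_eq_integral => //.
  - by apply/measurable_EFinP.
  - by apply/measurable_EFinP.
  exists N; split=> // x /= hx; apply: contrapT => Nx; apply: hx => _.
  by rewrite mindicE mem_set//= mulr1.
apply: ereal_sup_ubound; exists h' => //= x.
rewrite /patch; case: ifPn => [|xD].
  rewrite inE => Dx; rewrite /h' /= mindicE.
  have [/set_mem Nx|_] := boolP (x \in ~` N); last by rewrite mulr0 g0.
  rewrite mulr1; apply: le_trans (fg _ Dx Nx).
  by have := hf x; rewrite patchT// inE.
have := hf x; rewrite patchN// lee_fin => hx.
rewrite lee_fin; apply: le_trans hx.
by rewrite /h' /= mindicE ler_piMr//; case: (_ \in _).
Qed.

Lemma le_integral_all (D : set T) (f g : T -> \bar R) :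
  (forall x, D x -> 0 <= f x) -> (forall x, D x -> f x <= g x) ->
  \int[mu]_(x in D) f x <= \int[mu]_(x in D) g x.
Proof.
move=> f0 fg; apply: (@ae_le_integral D set0) => //.
by move=> x Dx; apply: le_trans (f0 _ Dx) (fg _ Dx).
by move=> x Dx _; exact: fg.
Qed.

Lemma ae_eq_integral_ge0 (D N : set T) (f g : T -> \bar R) :
  measurable N -> mu N = 0 ->
  (forall x, D x -> 0 <= f x) -> (forall x, D x -> 0 <= g x) ->
  (forall x, D x -> ~ N x -> f x = g x) ->
  \int[mu]_(x in D) f x = \int[mu]_(x in D) g x.
Proof.
move=> mN N0 f0 g0 fg; apply/eqP; rewrite eq_le; apply/andP; split.
  by apply: (ae_le_integral mN) => // x Dx Nx; rewrite fg.
by apply: (ae_le_integral mN) => // x Dx Nx; rewrite fg.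
Qed.

Lemma eq_integral_off_null (D N : set T) (f g : T -> \bar R) :
  measurable N -> mu N = 0 -> (forall x, D x -> ~ N x -> f x = g x) ->
  \int[mu]_(x in D) f x = \int[mu]_(x in D) g x.
Proof.
move=> mN N0 fg; rewrite integralE [RHS]integralE; congr (_ - _);
  apply: (ae_eq_integral_ge0 mN) => // x Dx Nx.
- by rewrite !funeposE fg.
- by rewrite !funenegE fg.
Qed.

End IntegralAE.

Section Probability.
Context {R : realType} d (T : measurableType d) (P : probability T R).

Lemma integral_prob_cst (c : R) : \int[P]_x c%:E = c%:E.
Proof. by rewrite integral_cst//= [X in _ * X]probability_setT mule1. Qed.

Lemma Lnorm_nneg (s : R) (f : T -> R) : (forall x, (0 <= f x)%R) ->
  Lnorm P s%:E (EFin \o f) = (\int[P]_x (f x `^ s)%:E) `^ s^-1.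
Proof.
move=> f0; rewrite Lnorm.unlock; congr (_ `^ _); apply: eq_integral => x _.
by rewrite /= ger0_norm.
Qed.

Lemma jensen_prob (p : R) (f : T -> R) : (1 < p)%R ->
  measurable_fun [set: T] f -> (forall x, (0 <= f x)%R) ->
  \int[P]_x (f x)%:E <= (\int[P]_x (f x `^ conj_exp p)%:E) `^ (conj_exp p)^-1.
Proof.
move=> p1 mf f0.
have := @hoelder _ _ _ P f (cst 1%R) _ _ mf (measurable_cst _)
  (conj_gt0 p1) (conj_p_gt0 p1) (conj_sumC p).
rewrite Lnorm1 Lnorm_nneg// Lnorm_cst1 [X in _ * X `^ _]probability_setT poweR1r mule1.
by under eq_integral do rewrite /= mulr1 ger0_norm//.
Qed.

Lemma hoelder_prob (p : R) (f g : T -> R) : (1 < p)%R ->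
  measurable_fun [set: T] f -> measurable_fun [set: T] g ->
  (forall x, (0 <= f x)%R) -> (forall x, (0 <= g x)%R) ->
  \int[P]_x (f x * g x)%:E <=
   (\int[P]_x (f x `^ conj_exp p)%:E) `^ (conj_exp p)^-1 *
   (\int[P]_x (g x `^ p)%:E) `^ p^-1.
Proof.
move=> p1 mf mg f0 g0.
have := @hoelder _ _ _ P f g _ _ mf mg
  (conj_gt0 p1) (conj_p_gt0 p1) (conj_sumC p).
rewrite Lnorm1 !Lnorm_nneg//.
by under eq_integral do rewrite /= ger0_norm ?mulr_ge0//.
Qed.

(** A nonnegative function does not exceed its mean everywhere; the gap between
    c and k leaves room for a strict contradiction. *)
Lemma exists_le_prob (f : T -> \bar R) (c k : R) :
  (forall x, 0 <= f x) -> \int[P]_x f x <= c%:E -> (c < k)%R ->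
  exists x, f x <= k%:E.
Proof.
move=> f0 fc ck; apply: contrapT => /forallNP h.
have : k%:E <= c%:E.
  apply: le_trans fc; rewrite -[leLHS]integral_prob_cst.
  have [k0|k0] := leP 0%R k; last first.
    apply: (@le_trans _ _ 0); last exact: integral_ge0.
    by rewrite integral_prob_cst lee_fin ltW.
  apply: le_integral_all => // x _.
  by have := h x; move/negP; rewrite -ltNge => /ltW.
by rewrite lee_fin leNgt ck.
Qed.

(** A lower bound for the mean of t >= s / g by the harmonic mean of g, from the
    tangent inequality 1/g >= 2/k - g/k^2, which avoids integrating 1/g. *)
Lemma harmonic_prob (t g : T -> R) (s k : R) : (0 < k)%R -> (0 <= s)%R ->
  measurable_fun [set: T] t -> measurable_fun [set: T] g ->
  (forall x, (0 <= t x)%R) -> (forall x, (0 <= g x)%R) ->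
  (forall x, (s <= t x * g x)%R) ->
  \int[P]_x (g x)%:E <= k%:E -> (s / k)%:E <= \int[P]_x (t x)%:E.
Proof.
move=> k0 s0 mt mg t0 g0 stg gk.
have pw x : (s / k + s / k <= t x + s / k ^+ 2 * g x)%R.
  have [gx0|gx0] := eqVneq (g x) 0%R.
    have -> : s = 0%R.
      by apply/eqP; rewrite eq_le s0 andbT (le_trans (stg x))// gx0 mulr0.
    by rewrite !mul0r !addr0.
  have gx : (0 < g x)%R by rewrite lt_def gx0 g0.
  rewrite -(ler_pM2r gx) -(ler_pM2r (exprn_gt0 2 k0)).
  have -> : ((s / k + s / k) * g x * k ^+ 2 = 2 * s * k * g x)%R.
    by field; rewrite gt_eqF.
  have -> : ((t x + s / k ^+ 2 * g x) * g x * k ^+ 2 =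
     (t x * g x) * k ^+ 2 + s * g x ^+ 2)%R by field; rewrite gt_eqF.
  apply: (@le_trans _ _ (s * k ^+ 2 + s * g x ^+ 2)%R).
    rewrite -subr_ge0; have -> : (s * k ^+ 2 + s * g x ^+ 2 - 2 * s * k * g x =
      s * (k - g x) ^+ 2)%R by ring.
    by rewrite mulr_ge0 ?sqr_ge0.
  by rewrite lerD2r ler_wpM2r ?sqr_ge0.
have : (s / k + s / k)%:E <=
    \int[P]_x (t x)%:E + (s / k ^+ 2)%:E * \int[P]_x (g x)%:E.
  rewrite -ge0_integralZl//; last 3 first.
  - by apply/measurable_EFinP.
  - by move=> x _; rewrite lee_fin.
  - by rewrite lee_fin divr_ge0// sqr_ge0.
  rewrite -ge0_integralD//; last 4 first.
  - by move=> x _; rewrite lee_fin.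
  - by apply/measurable_EFinP.
  - by move=> x _; rewrite mule_ge0// lee_fin// divr_ge0// sqr_ge0.
  - apply: measurable_funeM; exact/measurable_EFinP.
  rewrite -[leLHS]integral_prob_cst; apply: le_integral_all => x _.
    by rewrite lee_fin addr_ge0// divr_ge0// ltW.
  by rewrite -EFinM -EFinD lee_fin.
have sk : (s / k ^+ 2)%:E * \int[P]_x (g x)%:E <= (s / k)%:E.
  apply: (@le_trans _ _ ((s / k ^+ 2)%:E * k%:E)).
    by rewrite lee_wpmul2l// lee_fin divr_ge0// sqr_ge0.
  by rewrite -EFinM lee_fin expr2 invfM mulrA mulfVK// gt_eqF.
move=> h; have {h} := le_trans h (leeD2l _ sk).
by rewrite EFinD leeD2rE.
Qed.

End Probability.

(** * The good point of a submultiplicative kernel *)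

Section GoodPoint.
Context {R : realType} d (T : measurableType d) (P : probability T R).
Variables (p : R) (F : T -> T -> R) (K : R).
Hypothesis p1 : (1 < p)%R.
Hypothesis mF : measurable_fun [set: T * T] (fun z => F z.1 z.2).
Hypothesis F0 : forall x y, (0 <= F x y)%R.
Hypothesis Ftri : forall x y z, (F x z <= F x y * F y z)%R.
Local Notation q := (conj_exp p).
Let u x := \int[P]_y (F x y `^ q)%:E.
Hypothesis K0 : (0 <= K)%R.
Hypothesis HK : \int[P]_x (u x `^ (p / q)) <= K%:E.

Let mFr x : measurable_fun [set: T] (F x).
Proof. exact: (@measurable_fun_pair2 _ _ _ _ _ _ (fun z => F z.1 z.2) x). Qed.
Let mFl y : measurable_fun [set: T] (F ^~ y).
Proof. exact: (@measurable_fun_pair1 _ _ _ _ _ _ (fun z => F z.1 z.2) y). Qed.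

Let u_ge0 x : 0 <= u x.
Proof. by apply: integral_ge0 => y _; rewrite lee_fin powR_ge0. Qed.

Let mu_ : measurable_fun [set: T] u.
Proof.
apply: (@measurable_fun_fubini_tonelli_F _ _ _ _ _ P (fun z => (F z.1 z.2 `^ q)%:E)).
  by apply/measurable_EFinP; exact: (measurableT_comp (measurable_powR _)).
by move=> z; rewrite lee_fin powR_ge0.
Qed.

Let jensenF x : \int[P]_y (F x y)%:E <= u x `^ q^-1.
Proof. exact: jensen_prob. Qed.

(* one more than the bound 1 + 2 K for the mean *)
Let k : R := (2 + 2 * K)%R.

Let k0 : (0 < k)%R.
Proof. by rewrite /k ltr_wpDr// mulr_ge0. Qed.

(** The mean of F is at most 1 + K, because u^(1/q) <= 1 + u^(p/q). So the mean
    over x of u(x)^(p/q) plus the integral of F(y, x) over y is at most 1 + 2 K,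
    and some x0 has this sum at most k. The last bound follows by averaging
    F(x, x0) <= F(x, y) F(y, x0) over y: the mean of F(., x0) being at most k,
    harmonic_prob gives F(x, x0) <= k u(x)^(1/q). *)
Lemma good_point : exists x0, [/\ u x0 <= (k `^ (q / p))%:E,
  \int[P]_y (F x0 y)%:E <= (1 + k)%:E,
  \int[P]_y (F y x0)%:E <= k%:E &
  \int[P]_x (F x x0 `^ p)%:E <= (k `^ p * K)%:E].
Proof.
have q0 := conj_gt0 p1; have pq0 := conj_div_gt0 p1; have p0 := conj_p_gt0 p1.
have mG : measurable_fun [set: T] (fun x => \int[P]_y (F y x)%:E).
  apply: (@measurable_fun_fubini_tonelli_F _ _ T T _ P (fun z => (F z.2 z.1)%:E)).
    apply/measurable_EFinP.
    exact: (measurableT_comp mF (@measurable_swap _ _ T T)).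
  by move=> z; rewrite lee_fin.
have mup : measurable_fun [set: T] (fun x => u x `^ (p / q)).
  exact: (measurableT_comp (measurable_poweR _)).
have [x0 hx0] : exists x, u x `^ (p / q) + \int[P]_y (F y x)%:E <= k%:E.
  apply: (@exists_le_prob _ _ _ P _ (1 + 2 * K)%R).
  - move=> x; apply: adde_ge0; first exact: poweR_ge0.
    by apply: integral_ge0 => y _; rewrite lee_fin.
  - rewrite ge0_integralD//; last 2 first.
    + by move=> x _; exact: poweR_ge0.
    + by move=> x _; apply: integral_ge0 => y _; rewrite lee_fin.
    have -> : (1 + 2 * K)%:E = K%:E + (1 + K)%:E by rewrite -EFinD; congr EFin; ring.
    apply: leeD => //.
    rewrite -(@fubini_tonelli _ _ _ _ _ P P (fun z => (F z.1 z.2)%:E)); last 2 first.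
    + exact/measurable_EFinP.
    + by move=> z; rewrite lee_fin.
    apply: (@le_trans _ _ (\int[P]_x (1 + u x `^ (p / q)))).
      apply: le_integral_all => x _.
        by apply: integral_ge0 => y _; rewrite lee_fin.
      by apply: le_trans (jensenF x) _; exact: le_one_poweR.
    rewrite ge0_integralD//; last by move=> x _; exact: poweR_ge0.
    rewrite integral_prob_cst EFinD; exact: leeD.
  - by rewrite /k; lra.
exists x0.
have G0 : 0 <= \int[P]_y (F y x0)%:E.
  by apply: integral_ge0 => y _; rewrite lee_fin.
have hu : u x0 `^ (p / q) <= k%:E.
  by apply: le_trans hx0; rewrite leeDl.
have hG : \int[P]_y (F y x0)%:E <= k%:E.
  by apply: le_trans hx0; rewrite leeDr// poweR_ge0.
split=> //.
- rewrite -poweR_EFin -[u x0](poweR_invK (r := (p / q)%R)) ?gt_eqF//.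
  rewrite invf_div; apply: lee_poweR => //; last exact: poweR_ge0.
  by rewrite divr_ge0 ?ltW.
- apply: le_trans (jensenF x0) _; apply: le_trans (le_one_poweR p1 (u_ge0 _)) _.
  by rewrite EFinD leeD2l.
- have pw x : (F x x0 `^ p)%:E <= (k `^ p)%:E * u x `^ (p / q).
    have h : (F x x0)%:E <= k%:E * u x `^ q^-1.
      have := @harmonic_prob _ _ _ P (F x) (fun y => F y x0) (F x x0) k k0
        (F0 _ _) (mFr x) (mFl x0) (F0 x) (fun y => F0 y x0) (fun y => Ftri x y x0) hG.
      move=> /le_trans/(_ (jensenF x)).
      move=> /(lee_wpmul2l (_ : 0 <= k%:E)); rewrite lee_fin ltW// => /(_ isT).
      by rewrite -EFinM mulrC divfK// gt_eqF.
    have -> : (k `^ p)%:E * u x `^ (p / q) = (k%:E * u x `^ q^-1) `^ p.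
      rewrite poweRM ?poweR_ge0 ?lee_fin ?(ltW k0)// -poweRrM poweR_EFin.
      by rewrite mulrC.
    by rewrite -poweR_EFin; apply: lee_poweR; rewrite ?lee_fin// ltW.
  apply: (@le_trans _ _ (\int[P]_x ((k `^ p)%:E * u x `^ (p / q)))).
    by apply: le_integral_all => // x _; rewrite lee_fin powR_ge0.
  rewrite ge0_integralZl//.
  + by rewrite EFinM lee_wpmul2l// lee_fin powR_ge0.
  + by move=> x _; exact: poweR_ge0.
  + by rewrite lee_fin powR_ge0.
Qed.

End GoodPoint.

Local Close Scope ereal_scope.

(** * Expectation of a matrix function *)

Section Expectation.
Context {R : realType} d (T : measurableType d) (P : probability T R).
Local Notation C := R[i].

Definition cint (f : T -> C) : Prop :=
  P.-integrable [set: T] (EFin \o (@complex.Re R \o f)) /\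
  P.-integrable [set: T] (EFin \o (@complex.Im R \o f)).

Definition cexp (f : T -> C) : C :=
  Rintegral P [set: T] (@complex.Re R \o f) +i*
  Rintegral P [set: T] (@complex.Im R \o f).

Definition mxint m n (F : T -> 'M[C]_(m, n)) := forall i j, cint (fun x => F x i j).

Definition mxexp m n (F : T -> 'M[C]_(m, n)) : 'M[C]_(m, n) :=
  \matrix_(i, j) cexp (fun x => F x i j).

Lemma integrable_bound (f g : T -> R) : measurable_fun [set: T] f ->
  (forall x, `|f x| <= g x) -> (\int[P]_x (g x)%:E < +oo)%E ->
  P.-integrable [set: T] (EFin \o f).
Proof.
move=> mf fg gy; apply/integrableP; split; first exact/measurable_EFinP.
apply: le_lt_trans gy; apply: le_integral_all => x _; first exact: abse_ge0.
by rewrite /= lee_fin.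
Qed.

Lemma cint_cnorm1 f : cmeas f -> (\int[P]_x (cnorm1 (f x))%:E < +oo)%E -> cint f.
Proof.
move=> [m1 m2] fy; split.
  by apply: integrable_bound fy => // x; rewrite /cnorm1 lerDl.
by apply: integrable_bound fy => // x; rewrite /cnorm1 lerDr.
Qed.

Lemma mxint_entrynorm m n (F : T -> 'M[C]_(m, n)) : mxmeas F ->
  (\int[P]_x (entrynorm (F x))%:E < +oo)%E -> mxint F.
Proof.
move=> mF Fy i j; apply: cint_cnorm1; first exact: mF.
apply: le_lt_trans Fy; apply: le_integral_all => x _.
  by rewrite lee_fin cnorm1_ge0.
by rewrite lee_fin cnorm1_le_entrynorm.
Qed.

Lemma cint_cst c : cint (fun=> c).
Proof.
have h (r : R) : P.-integrable [set: T] (EFin \o cst r).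
  apply: (@integrable_bound _ (cst `|r|)) => //.
  by rewrite integral_prob_cst ltry.
by split; exact: h.
Qed.

Lemma cintD f g : cint f -> cint g -> cint (fun x => f x + g x).
Proof.
move=> [f1 f2] [g1 g2]; split.
  rewrite (_ : EFin \o _ = (EFin \o (@complex.Re R \o f)) \+
    (EFin \o (@complex.Re R \o g)))%E; first exact: integrableD.
  by apply/funext => x /=; rewrite cReD.
rewrite (_ : EFin \o _ = (EFin \o (@complex.Im R \o f)) \+
    (EFin \o (@complex.Im R \o g)))%E; first exact: integrableD.
by apply/funext => x /=; rewrite cImD.
Qed.

Lemma cexpD f g : cint f -> cint g ->
  cexp (fun x => f x + g x) = cexp f + cexp g.
Proof.
move=> [f1 f2] [g1 g2]; apply/eqP; rewrite eq_complex; apply/andP; split;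
  apply/eqP.
  rewrite cReD /= -RintegralD//; apply: eq_Rintegral => x _ /=.
  by rewrite cReD.
rewrite cImD /= -RintegralD//; apply: eq_Rintegral => x _ /=.
by rewrite cImD.
Qed.

Let rintZ (r : R) (f : T -> R) : P.-integrable [set: T] (EFin \o f) ->
  P.-integrable [set: T] (EFin \o (fun x => r * f x)).
Proof. by move=> h; apply: (integrableZl measurableT r h). Qed.

Let reZ c f : @complex.Re R \o (fun x : T => c * f x) =
  (fun x => complex.Re c * complex.Re (f x) - complex.Im c * complex.Im (f x)).
Proof. by apply/funext => x /=; rewrite cReM. Qed.

Let imZ c f : @complex.Im R \o (fun x : T => c * f x) =
  (fun x => complex.Re c * complex.Im (f x) + complex.Im c * complex.Re (f x)).
Proof. by apply/funext => x /=; rewrite cImM. Qed.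

Lemma cintZ c f : cint f -> cint (fun x => c * f x).
Proof.
move=> [f1 f2]; split.
  rewrite reZ; exact: (integrableB measurableT (rintZ _ f1) (rintZ _ f2)).
rewrite imZ; exact: (integrableD measurableT (rintZ _ f2) (rintZ _ f1)).
Qed.

Lemma cexpZ c f : cint f -> cexp (fun x => c * f x) = c * cexp f.
Proof.
move=> [f1 f2]; apply/eqP; rewrite eq_complex; apply/andP; split; apply/eqP.
  rewrite cReM /cexp reZ /=.
  rewrite (@RintegralB _ _ _ _ _ _ _ measurableT (rintZ _ f1) (rintZ _ f2)).
  by rewrite !RintegralZl.
rewrite cImM /cexp imZ /=.
rewrite (@RintegralD _ _ _ _ _ _ _ measurableT (rintZ _ f2) (rintZ _ f1)).
by rewrite !RintegralZl.
Qed.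

Lemma cexp_cst c : cexp (fun=> c) = c.
Proof.
have h (r : R) : Rintegral P [set: T] (cst r) = r.
  by rewrite /Rintegral integral_prob_cst.
by rewrite /cexp !h; case: c.
Qed.

Lemma cint_sum n (F : 'I_n -> T -> C) : (forall i, cint (F i)) ->
  cint (fun x => \sum_i F i x) /\
  cexp (fun x => \sum_i F i x) = \sum_i cexp (F i).
Proof.
elim: n F => [|n IH] F h.
  have -> : (fun x => \sum_(i < 0) F i x) = (fun=> 0).
    by apply/funext => x; rewrite big_ord0.
  split; first exact: cint_cst.
  by rewrite big_ord0 cexp_cst.
have -> : (fun x => \sum_(i < n.+1) F i x) =
    (fun x => F ord0 x + \sum_(i < n) F (lift ord0 i) x).
  by apply/funext => x; rewrite big_ord_recl.
have [i1 e1] := IH (fun i => F (lift ord0 i)) (fun i => h _).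
by split; [exact: cintD|rewrite cexpD// e1 big_ord_recl].
Qed.

Lemma mxint_cst m n (A : 'M[C]_(m, n)) : mxint (fun=> A).
Proof. by move=> i j; exact: cint_cst. Qed.

Lemma mxexp_cst m n (A : 'M[C]_(m, n)) : mxexp (fun=> A) = A.
Proof. by apply/matrixP => i j; rewrite mxE cexp_cst. Qed.

Lemma mxintB m n (F G : T -> 'M[C]_(m, n)) : mxint F -> mxint G ->
  mxint (fun x => F x - G x) /\ mxexp (fun x => F x - G x) = mxexp F - mxexp G.
Proof.
move=> iF iG.
have E i j : (fun x => (F x - G x) i j) = (fun x => F x i j + (-1) * G x i j).
  by apply/funext => x; rewrite !mxE mulN1r.
split=> [i j|]; first by rewrite E; apply: cintD => //; exact: cintZ.
apply/matrixP => i j; rewrite mxE E cexpD//; last exact: cintZ.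
by rewrite cexpZ// !mxE mulN1r.
Qed.

Lemma mxint_mull m n k (L : 'M[C]_(k, m)) (F : T -> 'M[C]_(m, n)) : mxint F ->
  mxint (fun x => L *m F x) /\ mxexp (fun x => L *m F x) = L *m mxexp F.
Proof.
move=> iF.
have E i j : (fun x => (L *m F x) i j) = (fun x => \sum_l L i l * F x l j).
  by apply/funext => x; rewrite !mxE.
have h i j := @cint_sum _ (fun l x => L i l * F x l j) (fun l => cintZ (L i l) (iF l j)).
split=> [i j|]; first by rewrite E; have [] := h i j.
apply/matrixP => i j; rewrite mxE E; have [_ ->] := h i j.
by rewrite mxE; apply: eq_bigr => l _; rewrite cexpZ// mxE.
Qed.

Lemma mxint_mulr m n k (G : 'M[C]_(n, k)) (F : T -> 'M[C]_(m, n)) : mxint F ->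
  mxint (fun x => F x *m G) /\ mxexp (fun x => F x *m G) = mxexp F *m G.
Proof.
move=> iF.
have E i j : (fun x => (F x *m G) i j) = (fun x => \sum_l G l j * F x i l).
  by apply/funext => x; rewrite !mxE; apply: eq_bigr => l _; rewrite mulrC.
have h i j := @cint_sum _ (fun l x => G l j * F x i l) (fun l => cintZ (G l j) (iF i l)).
split=> [i j|]; first by rewrite E; have [] := h i j.
apply/matrixP => i j; rewrite mxE E; have [_ ->] := h i j.
by rewrite mxE; apply: eq_bigr => l _; rewrite cexpZ// mxE mulrC.
Qed.

Lemma cnorm1_cexp f : cint f ->
  ((cnorm1 (cexp f))%:E <= \int[P]_x (cnorm1 (f x))%:E)%E.
Proof.
move=> [f1 f2]; rewrite /cnorm1 EFinD.
under eq_integral do rewrite EFinD.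
have [/integrableP[m1 _] /integrableP[m2 _]] := (f1, f2).
rewrite ge0_integralD//; last 2 first.
- by apply/measurable_EFinP; apply: measurableT_comp => //; exact/measurable_EFinP.
- by apply/measurable_EFinP; apply: measurableT_comp => //; exact/measurable_EFinP.
apply: leeD; rewrite /= EFin_normr_Rintegral//.
  by apply: le_trans (le_abse_integral _ _ m1) _.
by apply: le_trans (le_abse_integral _ _ m2) _.
Qed.

Lemma sum_integral n (F : 'I_n -> T -> R) :
  (forall i, measurable_fun [set: T] (F i)) -> (forall i x, 0 <= F i x) ->
  (\int[P]_x (\sum_i F i x)%:E = \sum_i \int[P]_x (F i x)%:E)%E.
Proof.
move=> mF F0; rewrite -ge0_integral_sum//.
- by apply: eq_integral => x _; rewrite sumEFin.
- by move=> i; apply/measurable_EFinP.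
- by move=> i x _; rewrite lee_fin.
Qed.

Lemma entrynorm_mxexp m n (F : T -> 'M[C]_(m, n)) : mxmeas F -> mxint F ->
  ((entrynorm (mxexp F))%:E <= \int[P]_x (entrynorm (F x))%:E)%E.
Proof.
move=> mF iF; rewrite /entrynorm.
have mn1 i j : measurable_fun [set: T] (fun x => cnorm1 (F x i j)).
  exact: measurable_cnorm1.
rewrite sum_integral; last 2 first.
- by move=> i; exact: measurable_sumr.
- by move=> i x; rewrite sumr_ge0// => j _; exact: cnorm1_ge0.
rewrite -sumEFin; apply: lee_sum => i _.
rewrite sum_integral//; last by move=> j x; exact: cnorm1_ge0.
rewrite -sumEFin; apply: lee_sum => j _.
by rewrite mxE; exact: cnorm1_cexp.
Qed.

Lemma qform_mxexp n (b : T -> 'M[C]_n) (v : 'cV[C]_n) : mxint b ->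
  qform (mxexp b) v = Rintegral P [set: T] (fun y => qform (b y) v).
Proof.
move=> ib; rewrite /qform.
have [i1 <-] := mxint_mull (v^t*) ib.
by have [i2 <-] := mxint_mulr v i1; rewrite mxE.
Qed.

Lemma qform_int n (b : T -> 'M[C]_n) (v : 'cV[C]_n) : mxint b ->
  P.-integrable [set: T] (EFin \o (fun y => qform (b y) v)).
Proof.
move=> ib; have [i1 _] := mxint_mull (v^t*) ib.
by have [i2 _] := mxint_mulr v i1; have [] := i2 0 0.
Qed.

End Expectation.

Local Open Scope ereal_scope.

(** * From the kernel to the mean oscillation *)

Section Constants.
Context {R : realType}.
Definition good_const (K : R) : R := (2 + 2 * K)%R.
(** These bound the q-th moment of the left factor, the p-th moment of the
    right factor, and the mean oscillation: see [left_bound], [right_bound] and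
    [core_bound]. *)
Definition left_const (p K : R) : R :=
  let q := conj_exp p in (good_const K `^ q * good_const K `^ (q / p))%R.
Definition right_const (n : nat) (p K : R) : R :=
  (inv_const n (2 * (1 + good_const K)) `^ p * (good_const K `^ p * K))%R.
Definition core_const (n : nat) (p Ka Kb : R) : R :=
  ((left_const p Ka + 1) * right_const n p Kb `^ p^-1)%R.

Lemma inv_const_ge0 n (k : R) : (0 <= k)%R -> (0 <= inv_const n k)%R.
Proof. by move=> k0; rewrite /inv_const !mulr_ge0// exprn_ge0. Qed.

Lemma left_const_ge0 p K : (0 <= left_const p K)%R.
Proof. by rewrite mulr_ge0// powR_ge0. Qed.

Lemma core_const_ge0 n p Ka Kb : (0 <= core_const n p Ka Kb)%R.
Proof. by rewrite mulr_ge0 ?powR_ge0// addr_ge0// left_const_ge0. Qed.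
End Constants.

Section OneWeight.
Context {R : realType} d (T : measurableType d) (P : probability T R).
Local Notation C := R[i].
Variables (n : nat) (p : R) (a a' : T -> 'M[C]_n) (K : R).
Hypothesis p1 : (1 < p)%R.
Local Notation q := (conj_exp p).
Hypotheses (ma : mxmeas a) (ma' : mxmeas a').
Hypothesis aV : forall x, a' x *m a x = 1%:M.
Hypothesis K0 : (0 <= K)%R.
Hypothesis HK :
  \int[P]_x ((\int[P]_y (entrynorm (a x *m a' y) `^ q)%:E) `^ (p / q)) <= K%:E.
Let F x y := entrynorm (a x *m a' y).
Let k := good_const K.

Let k0 : (0 < k)%R. Proof. by rewrite /k /good_const ltr_wpDr// mulr_ge0. Qed.

Let F0 x y : (0 <= F x y)%R. Proof. exact: entrynorm_ge0. Qed.

Let mF : measurable_fun [set: T * T] (fun z => F z.1 z.2).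
Proof.
apply: measurable_entrynorm; apply: mxmeasM.
  exact: (mxmeas_comp measurable_fst ma).
exact: (mxmeas_comp measurable_snd ma').
Qed.

Let mFr x : measurable_fun [set: T] (F x).
Proof.
by apply: measurable_entrynorm; apply: mxmeasM => //; exact: mxmeas_cst.
Qed.

Let mFl y : measurable_fun [set: T] (F ^~ y).
Proof.
by apply: measurable_entrynorm; apply: mxmeasM => //; exact: mxmeas_cst.
Qed.

Let aV_mul m1 m2 y (X : 'M[C]_(m1, n)) (Y : 'M[C]_(n, m2)) :
  X *m Y = (X *m a' y) *m (a y *m Y).
Proof. by rewrite mulmxA -(mulmxA X) aV mulmx1. Qed.

Let Ftri x y z : (F x z <= F x y * F y z)%R.
Proof. by rewrite /F (aV_mul y) entrynormM. Qed.

Let good := good_point p1 mF F0 Ftri K0 HK.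

Lemma mxint_weight : mxint P a.
Proof.
have [x0 [_ _ hG _]] := good; apply: mxint_entrynorm => //.
apply: (@le_lt_trans _ _ ((entrynorm (a x0))%:E * \int[P]_y (F y x0)%:E)).
  rewrite -ge0_integralZl//; last 3 first.
  - exact/measurable_EFinP.
  - by move=> x _; rewrite lee_fin.
  - by rewrite lee_fin entrynorm_ge0.
  apply: le_integral_all => y _; first by rewrite lee_fin entrynorm_ge0.
  rewrite -EFinM lee_fin mulrC; apply: le_trans (entrynormM _ _).
  by rewrite -mulmxA aV mulmx1.
by rewrite (le_lt_trans (lee_wpmul2l _ hG)) ?ltry// lee_fin entrynorm_ge0.
Qed.

(** With x0 the good point, E(a) a'(x) = (E(a) a'(x0)) (a(x0) a'(x)), where the
    first factor is the mean of a(y) a'(x0). *)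
Lemma left_bound :
  \int[P]_x (entrynorm (mxexp P a *m a' x) `^ q)%:E <= (left_const p K)%:E.
Proof.
have [x0 [hu _ hG _]] := good; have q0 := conj_gt0 p1.
have hA : (entrynorm (mxexp P a *m a' x0) <= k)%R.
  have [i1 <-] := mxint_mulr (a' x0) mxint_weight.
  rewrite -lee_fin; apply: le_trans hG; apply: entrynorm_mxexp => //.
  by apply: mxmeasM => //; exact: mxmeas_cst.
have pw x : (entrynorm (mxexp P a *m a' x) `^ q)%:E <= (k `^ q)%:E * (F x0 x `^ q)%:E.
  rewrite -EFinM lee_fin -powRM ?(ltW k0)// ge0_ler_powR ?nnegrE ?entrynorm_ge0 ?(ltW q0)//.
    by rewrite mulr_ge0// ltW.
  rewrite (aV_mul x0); apply: le_trans (entrynormM _ _) _.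
  by apply: ler_pM => //; exact: entrynorm_ge0.
apply: (@le_trans _ _ (\int[P]_x ((k `^ q)%:E * (F x0 x `^ q)%:E))).
  by apply: le_integral_all => // x _; rewrite lee_fin powR_ge0.
rewrite ge0_integralZl//; last 3 first.
- by apply/measurable_EFinP; exact: (measurableT_comp (measurable_powR _)).
- by move=> x _; rewrite lee_fin powR_ge0.
- by rewrite lee_fin powR_ge0.
by rewrite /left_const EFinM lee_wpmul2l// lee_fin powR_ge0.
Qed.

Hypothesis pa : forall x, posdef (a x).

(** a(y) E(a)^-1 = (a(y) a'(x0)) (a(x0) E(a)^-1). The second factor is bounded by
    inverse_bound: a(x0) <= 2 F(x0, y) a(y) by loewner, and the mean over y turns
    this into a(x0) <= k2 E(a) by harmonic_prob. *)
Lemma right_bound : mxexp P a \in unitmx /\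
  \int[P]_y (entrynorm (a y *m invmx (mxexp P a)) `^ p)%:E <= (right_const n p K)%:E.
Proof.
have [x0 [_ hJ hG hL]] := good; have p0 := conj_p_gt0 p1.
have a'E x : a' x = invmx (a x).
  rewrite -[LHS]mulmx1 -(mulmxV (posdef_unit (pa x))).
  by rewrite mulmxA aV mul1mx.
pose k2 : R := (2 * (1 + k))%R.
have k20 : (0 < k2)%R by rewrite /k2 mulr_gt0// addr_gt0.
have hA : (entrynorm (mxexp P a *m invmx (a x0)) <= k2)%R.
  rewrite -a'E; have [i1 <-] := mxint_mulr (a' x0) mxint_weight.
  rewrite -lee_fin; apply: le_trans (_ : k%:E <= _); last first.
    by rewrite lee_fin /k2; have := k0; lra.
  apply: le_trans hG; apply: entrynorm_mxexp => //.
  by apply: mxmeasM => //; exact: mxmeas_cst.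
have low y v : (qform (a x0) v <= 2 * F x0 y * qform (a y) v)%R.
  apply: loewner => //.
  - exact: posdef_herm.
  - by rewrite mulr_ge0.
  move=> w; rewrite (aV_mul y (a x0) w).
  apply: le_trans (vnorm_mul _ _) _; apply: ler_wpM2r; first exact: vnorm_ge0.
  exact: mxnorm_le_entrynorm.
have SA v : (qform (a x0) v <= k2 * qform (mxexp P a) v)%R.
  have [->|v0] := eqVneq v 0%R.
    by rewrite /qform !mulmx0 !mxE /= mulr0.
  have hqa y : (0 <= qform (a y) v)%R by rewrite ltW// posdef_qform.
  have mi := qform_int v mxint_weight.
  rewrite mulrC -ler_pdivrMr// -lee_fin qform_mxexp; last exact: mxint_weight.
  rewrite /Rintegral fineK; last exact: integrable_fin_num mi.
  apply: (@harmonic_prob _ _ _ P _ (fun y => 2 * F x0 y)%R) => //.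
  - by apply/measurable_EFinP; case/integrableP : mi.
  - by apply: measurable_funM => //.
  - by move=> y; rewrite mulr_ge0.
  - by move=> y; rewrite mulrC.
  under eq_integral do rewrite EFinM.
  rewrite ge0_integralZl//; last 2 first.
  - exact/measurable_EFinP.
  - by move=> y _; rewrite lee_fin.
  by rewrite /k2 EFinM lee_wpmul2l.
have [Au hI] := inverse_bound k20 (pa x0) SA hA.
split=> //.
have pw y : (entrynorm (a y *m invmx (mxexp P a)) `^ p)%:E <=
    (inv_const n k2 `^ p)%:E * (F y x0 `^ p)%:E.
  rewrite -EFinM lee_fin -powRM ?inv_const_ge0 ?(ltW k20)//.
  rewrite ge0_ler_powR ?nnegrE ?entrynorm_ge0 ?(ltW p0)//.
    by rewrite mulr_ge0// inv_const_ge0// ltW.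
  rewrite (aV_mul x0); apply: le_trans (entrynormM _ _) _.
  by rewrite mulrC; apply: ler_pM => //; exact: entrynorm_ge0.
apply: (@le_trans _ _ (\int[P]_y ((inv_const n k2 `^ p)%:E * (F y x0 `^ p)%:E))).
  by apply: le_integral_all => // x _; rewrite lee_fin powR_ge0.
rewrite ge0_integralZl//; last 3 first.
- by apply/measurable_EFinP; exact: (measurableT_comp (measurable_powR _)).
- by move=> x _; rewrite lee_fin powR_ge0.
- by rewrite lee_fin powR_ge0.
by rewrite /right_const EFinM lee_wpmul2l// lee_fin powR_ge0.
Qed.

End OneWeight.

Section Core.
Context {R : realType} d (T : measurableType d) (P : probability T R).
Local Notation C := R[i].
Variables (n : nat) (p : R) (a a' b b' B : T -> 'M[C]_n) (Ka Kb : R).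
Hypothesis p1 : (1 < p)%R.
Local Notation q := (conj_exp p).
Hypotheses (ma : mxmeas a) (ma' : mxmeas a') (mb : mxmeas b) (mb' : mxmeas b')
  (mB : mxmeas B).
Hypothesis aV : forall x, a' x *m a x = 1%:M.
Hypothesis bV : forall x, b' x *m b x = 1%:M.
Hypothesis pb : forall x, posdef (b x).
Hypotheses (Ka0 : (0 <= Ka)%R) (Kb0 : (0 <= Kb)%R).
Hypothesis HA :
  \int[P]_x ((\int[P]_y (entrynorm (a x *m a' y) `^ q)%:E) `^ (p / q)) <= Ka%:E.
Hypothesis HB :
  \int[P]_x ((\int[P]_y (entrynorm (b x *m b' y) `^ q)%:E) `^ (p / q)) <= Kb%:E.
Hypothesis HX :
  \int[P]_x ((\int[P]_y (entrynorm (a x *m (B x - B y) *m b' y) `^ q)%:E) `^ (p / q))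
    <= 1.
Hypothesis iB : mxint P B.

(** The matrix A (B(x) - E(B)) G is the mean over y of
    (A a'(x)) (a(x) (B(x) - B(y)) b'(y)) (b(y) G). Hoelder in y and then the
    inequality of Young in x separate the three factors. *)
Theorem core_bound :
  \int[P]_x (entrynorm (mxexp P a *m (B x - mxexp P B) *m invmx (mxexp P b)))%:E <=
    (core_const n p Ka Kb)%:E.
Proof.
have [_ hR] := right_bound p1 mb mb' bV Kb0 HB pb.
have hL := left_bound p1 ma ma' aV Ka0 HA.
set A := mxexp P a in hL *; set G := invmx (mxexp P b) in hR *.
have p0 := conj_p_gt0 p1; have q0 := conj_gt0 p1.
pose D x y := entrynorm (a x *m (B x - B y) *m b' y).
pose al x := entrynorm (A *m a' x).
pose be y := entrynorm (b y *m G).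
have D0 x y : (0 <= D x y)%R by exact: entrynorm_ge0.
have al0 x : (0 <= al x)%R by exact: entrynorm_ge0.
have be0 x : (0 <= be x)%R by exact: entrynorm_ge0.
have mal : measurable_fun [set: T] al.
  by apply: measurable_entrynorm; apply: mxmeasM => //; exact: mxmeas_cst.
have mbe : measurable_fun [set: T] be.
  by apply: measurable_entrynorm; apply: mxmeasM => //; exact: mxmeas_cst.
have mDr x : measurable_fun [set: T] (D x).
  apply: measurable_entrynorm; apply: mxmeasM => //; apply: mxmeasM.
    exact: mxmeas_cst.
  by apply: mxmeasB => //; exact: mxmeas_cst.
have mD : measurable_fun [set: T * T] (fun z => D z.1 z.2).
  have c1 := fun F => @mxmeas_comp R _ _ _ _ n n _ F (@measurable_fst _ _ T T).
  have c2 := fun F => @mxmeas_comp R _ _ _ _ n n _ F (@measurable_snd _ _ T T).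
  apply: measurable_entrynorm; apply: mxmeasM; last exact: (c2 b' mb').
  apply: mxmeasM; first exact: (c1 a ma).
  by apply: mxmeasB; [exact: (c1 B mB)|exact: (c2 B mB)].
pose v x := \int[P]_y (D x y `^ q)%:E.
have v0 x : 0 <= v x by apply: integral_ge0 => y _; rewrite lee_fin powR_ge0.
have mv : measurable_fun [set: T] v.
  apply: (@measurable_fun_fubini_tonelli_F _ _ _ _ _ P
    (fun z => (D z.1 z.2 `^ q)%:E)).
    by apply/measurable_EFinP; exact: (measurableT_comp (measurable_powR _)).
  by move=> z; rewrite lee_fin powR_ge0.
have pw x : (entrynorm (A *m (B x - mxexp P B) *m G))%:E <=
    ((al x `^ q)%:E + v x `^ (p / q)) * (right_const n p Kb `^ p^-1)%:E.
  have [i1 e1] := mxintB (mxint_cst P (B x)) iB.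
  rewrite mxexp_cst in e1.
  have [i2 e2] := mxint_mull A i1; have [i3 e3] := mxint_mulr G i2.
  rewrite -e1 -e2 -e3.
  apply: le_trans (entrynorm_mxexp _ i3) _.
    apply: mxmeasM; last exact: mxmeas_cst.
    apply: mxmeasM; first exact: mxmeas_cst.
    by apply: mxmeasB => //; exact: mxmeas_cst.
  apply: (@le_trans _ _ ((al x)%:E * \int[P]_y (D x y * be y)%:E)).
    rewrite -ge0_integralZl//; last 3 first.
    - by apply/measurable_EFinP; exact: measurable_funM.
    - by move=> y _; rewrite lee_fin mulr_ge0.
    - by rewrite lee_fin.
    apply: le_integral_all => y _; first by rewrite lee_fin entrynorm_ge0.
    rewrite -EFinM lee_fin.
    have -> : A *m (B x - B y) *m G =
        (A *m a' x) *m ((a x *m (B x - B y) *m b' y) *m (b y *m G)).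
      rewrite !mulmxA -(mulmxA A (a' x) (a x)) aV mulmx1.
      by rewrite -(mulmxA (A *m (B x - B y))) bV mulmx1.
    apply: le_trans (entrynormM _ _) _; apply: ler_pM; rewrite ?entrynorm_ge0//.
    exact: le_trans (entrynormM _ _) (lexx _).
  apply: (@le_trans _ _ ((al x)%:E *
      (v x `^ q^-1 * (right_const n p Kb `^ p^-1)%:E))).
    rewrite lee_wpmul2l ?lee_fin//.
    apply: le_trans (hoelder_prob P p1 (mDr x) mbe (D0 x) be0) _.
    rewrite lee_wpmul2l ?poweR_ge0// -poweR_EFin; apply: lee_poweR => //.
      by rewrite invr_ge0 ltW.
    by apply: integral_ge0 => y _; rewrite lee_fin powR_ge0.
  rewrite muleA lee_wpmul2r ?lee_fin ?powR_ge0//.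
  exact: young_poweR.
have mvp : measurable_fun [set: T] (fun x => v x `^ (p / q)).
  exact: (measurableT_comp (measurable_poweR _)).
have malq : measurable_fun [set: T] (fun x => (al x `^ q)%:E).
  by apply/measurable_EFinP; exact: (measurableT_comp (measurable_powR _)).
apply: (@le_trans _ _ (\int[P]_x
    (((al x `^ q)%:E + v x `^ (p / q)) * (right_const n p Kb `^ p^-1)%:E))).
  by apply: le_integral_all => // x _; rewrite lee_fin entrynorm_ge0.
rewrite ge0_integralZr//; last 3 first.
- exact: emeasurable_funD.
- by move=> x _; rewrite adde_ge0 ?poweR_ge0// lee_fin powR_ge0.
- by rewrite lee_fin powR_ge0.
rewrite ge0_integralD//; last 2 first.
- by move=> x _; rewrite lee_fin powR_ge0.
- by move=> x _; rewrite poweR_ge0.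
rewrite /core_const EFinM lee_wpmul2r ?lee_fin ?powR_ge0//.
by rewrite EFinD; apply: leeD.
Qed.

End Core.

Local Close Scope ereal_scope.

(** * The block weight *)

Lemma gram_form (C : numClosedFieldType) n (S Phi : 'M[C]_n) (v : 'cV[C]_n) :
  S \is hermsymmx -> S *m S = Phi^t* *m Phi ->
  (S *m v)^t* *m (S *m v) = (Phi *m v)^t* *m (Phi *m v).
Proof.
move=> /hermsymmxP hS SS; rewrite !trmxCM hS !mulmxA -(mulmxA _ S S) SS.
by rewrite !mulmxA.
Qed.

Lemma offdiag_id (F : fieldType) m (a B B' b : 'M[F]_m) (w : 'cV[F]_m) (r : F) :
  a *m (- (r *: (B' *m (b *m w))) + r *: (B *m (b *m w))) =
  (r *: (a *m (B - B') *m b)) *m w.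
Proof.
rewrite [X in a *m X]addrC -scalerBr -mulmxBl -scalemxAr -scalemxAl.
by rewrite !mulmxA.
Qed.

Section Polar.
Context {R : realType}.
Local Notation C := R[i].

Lemma posdef_gram n (Phi : 'M[C]_n) :
  (forall v : 'cV[C]_n, Phi *m v = 0 -> v = 0) -> posdef (Phi^t* *m Phi).
Proof.
move=> inj; apply: posdefP; first by apply/hermsymmxP; rewrite trmxCM trmxCK.
move=> v v0; rewrite /qform mulmxA -trmxCM -mulmxA dot_sqnorm /=.
rewrite lt_def sqnorm_ge0 andbT -vnorm_sqr sqrf_eq0.
by apply: contraNN v0 => /eqP/vnorm_eq0/inj ->.
Qed.

(** Both squared norms are v^* Phi^* Phi v: the isometry of the polar
    decomposition. *)
Lemma vnorm_sqrt_gram n (Phi : 'M[C]_n) (v : 'cV[C]_n) :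
  posdef (Phi^t* *m Phi) ->
  vnorm (mxpow (Phi^t* *m Phi) 2^-1 *m v) = vnorm (Phi *m v).
Proof.
move=> pG; rewrite !vnormE; congr Num.sqrt; apply: complexI.
rewrite -!dot_sqnorm (@gram_form _ _ _ Phi)//.
  exact/posdef_herm/mxpow_posdef.
by rewrite -(mxpowD _ _ pG) (_ : 2^-1 + 2^-1 = 1 :> R) ?mxpow1//; field.
Qed.

Lemma sqnorm_col_mx m n (u : 'cV[C]_m) (v : 'cV[C]_n) :
  sqnorm (col_mx u v) = sqnorm u + sqnorm v.
Proof.
rewrite /sqnorm big_split_ord /=; congr (_ + _); apply: eq_bigr => i _.
  by rewrite col_mxEu.
by rewrite col_mxEd.
Qed.

Lemma vnorm_col_mxu m n (u : 'cV[C]_m) (v : 'cV[C]_n) :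
  vnorm u <= vnorm (col_mx u v).
Proof. by rewrite !vnormE sqnorm_col_mx ler_wsqrtr// lerDl sqnorm_ge0. Qed.

Lemma vnorm_col_mxd m n (u : 'cV[C]_m) (v : 'cV[C]_n) :
  vnorm v <= vnorm (col_mx u v).
Proof. by rewrite !vnormE sqnorm_col_mx ler_wsqrtr// lerDr sqnorm_ge0. Qed.

Lemma vnorm_col_mx0 m n (v : 'cV[C]_n) : vnorm (col_mx (0 : 'cV[C]_m) v) = vnorm v.
Proof.
rewrite !vnormE sqnorm_col_mx (_ : sqnorm 0 = 0) ?add0r//.
by rewrite -vnorm_sqr vnorm0 expr0n.
Qed.

Lemma entrynorm_col_mx m n (u : 'cV[C]_m) (v : 'cV[C]_n) :
  entrynorm (col_mx u v) = entrynorm u + entrynorm v.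
Proof.
rewrite /entrynorm big_split_ord /=; congr (_ + _); apply: eq_bigr => i _.
  by rewrite !big_ord1 col_mxEu.
by rewrite !big_ord1 col_mxEd.
Qed.

Definition upper_mx m (r : R) (a b B : 'M[C]_m) : 'M[C]_(m + m) :=
  block_mx a (r%:C *: (a *m B)) 0 b.

Lemma upper_mx_col m r (a b B : 'M[C]_m) (v w : 'cV[C]_m) :
  upper_mx r a b B *m col_mx v w = col_mx (a *m (v + r%:C *: (B *m w))) (b *m w).
Proof.
rewrite /upper_mx mul_block_col mul0mx add0r; congr col_mx.
by rewrite mulmxDr -scalemxAr -scalemxAl mulmxA.
Qed.

Lemma upper_mx_inj m r (a b B : 'M[C]_m) : a \in unitmx -> b \in unitmx ->
  forall v : 'cV[C]_(m + m), upper_mx r a b B *m v = 0 -> v = 0.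
Proof.
move=> au bu v; rewrite -(vsubmxK v) upper_mx_col => /eqP.
move: (usubmx v) (dsubmx v) => x y; rewrite col_mx_eq0 => /andP[/eqP h1 /eqP h2].
have y0 : y = 0 by rewrite -(mulKmx bu y) h2 mulmx0.
move: h1; rewrite y0 mulmx0 scaler0 addr0 => h1.
by rewrite -(mulKmx au x) h1 mulmx0 col_mx0.
Qed.

(** The weight whose power 1/p is the modulus of [upper_mx]. *)
Definition block_weight m (p r : R) (U V B : 'M[C]_m) : 'M[C]_(m + m) :=
  let Phi := upper_mx r (mxpow V p^-1) (mxpow U p^-1) B in
  mxpow (Phi^t* *m Phi) (p / 2).

Section BlockWeight.
Variables (m : nat) (p r : R).
Hypothesis p0 : 0 < p.
Implicit Types U V B : 'M[C]_m.

Lemma block_gram_posdef U V B : posdef U -> posdef V ->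
  let Phi := upper_mx r (mxpow V p^-1) (mxpow U p^-1) B in
  posdef (Phi^t* *m Phi).
Proof.
move=> pU pV; apply: posdef_gram; apply: upper_mx_inj;
  exact/posdef_unit/mxpow_posdef.
Qed.

Lemma block_weight_posdef U V B : posdef U -> posdef V ->
  posdef (block_weight p r U V B).
Proof. by move=> pU pV; exact/mxpow_posdef/block_gram_posdef. Qed.

Lemma vnorm_block_weight U V B (v : 'cV[C]_(m + m)) : posdef U -> posdef V ->
  vnorm (mxpow (block_weight p r U V B) p^-1 *m v) =
  vnorm (upper_mx r (mxpow V p^-1) (mxpow U p^-1) B *m v).
Proof.
move=> pU pV; have pG := block_gram_posdef B pU pV.
rewrite (mxpowM (p / 2) p^-1 pG).
have -> : p / 2 * p^-1 = 2^-1 by rewrite mulrAC divff ?gt_eqF// mul1r.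
exact: vnorm_sqrt_gram.
Qed.

(** The left side is the corner of Phi Phi'^-1, for the block matrices Phi and
    Phi' of the two triples. It suffices to test on the vectors (0, w); the
    vector v is Phi'^-1 (0, w). *)
Lemma mxnorm_offdiag U V B U' V' B' : posdef U -> posdef V -> posdef U' -> posdef V' ->
  mxnorm (r%:C *: (mxpow V p^-1 *m (B - B') *m mxpow U' (- p^-1))) <=
  mxnorm (mxpow (block_weight p r U V B) p^-1 *m
          mxpow (block_weight p r U' V' B') (- p^-1)).
Proof.
move=> pU pV pU' pV'; apply: mxnorm_le => w w1.
set b' := mxpow U' (- p^-1).
pose v : 'cV[C]_(m + m) := col_mx (- (r%:C *: (B' *m (b' *m w)))) (b' *m w).
have [bb _] := mxpowN p^-1 pU'.
have y : upper_mx r (mxpow V' p^-1) (mxpow U' p^-1) B' *m v = col_mx 0 w.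
  rewrite /v upper_mx_col addNr mulmx0; congr (col_mx 0 _).
  by rewrite (mulmxA (mxpow U' p^-1)) bb mul1mx.
have x : vnorm (r%:C *: (mxpow V p^-1 *m (B - B') *m b') *m w) <=
    vnorm (upper_mx r (mxpow V p^-1) (mxpow U p^-1) B *m v).
  rewrite /v upper_mx_col; apply: le_trans (vnorm_col_mxu _ _).
  by rewrite offdiag_id.
apply: le_trans x _; rewrite -(vnorm_block_weight B v pU pV).
have [_ WW] := mxpowN p^-1 (block_weight_posdef B' pU' pV').
have -> : v = mxpow (block_weight p r U' V' B') (- p^-1) *m
    (mxpow (block_weight p r U' V' B') p^-1 *m v) by rewrite mulmxA WW mul1mx.
rewrite mulmxA; apply: vnorm_mul1.
by rewrite vnorm_block_weight// y vnorm_col_mx0.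
Qed.

End BlockWeight.
End Polar.

(** * Norm of an operator on the block weight *)

Section PowR3.
Context {R : realType}.
Variable p : R.
Hypothesis p1 : 1 < p.
Let p0 : 0 < p. Proof. exact: lt_trans ltr01 p1. Qed.

Lemma powR_sum3 (x y z : R) : 0 <= x -> 0 <= y -> 0 <= z ->
  (x + y + z) `^ p <= 3 `^ p * (x `^ p + y `^ p + z `^ p).
Proof.
move=> x0 y0 z0.
have key w : 0 <= w -> x <= w -> y <= w -> z <= w ->
    (x + y + z) `^ p <= 3 `^ p * w `^ p.
  move=> w0 xw yw zw; rewrite -powRM// ge0_ler_powR ?nnegrE ?(ltW p0)//.
  - by rewrite !addr_ge0.
  - by rewrite mulr_ge0.
  - by lra.
have X := powR_ge0 x p; have Y := powR_ge0 y p; have Z := powR_ge0 z p.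
have [xy|/ltW xy] := leP x y.
  have [yz|/ltW yz] := leP y z.
    apply: le_trans (key z z0 (le_trans xy yz) yz (lexx z)) _.
    by rewrite ler_wpM2l ?powR_ge0// lerDr addr_ge0.
  apply: le_trans (key y y0 xy (lexx y) yz) _.
  by rewrite ler_wpM2l ?powR_ge0// -addrA addrCA lerDl addr_ge0.
have [xz|/ltW xz] := leP x z.
  apply: le_trans (key z z0 xz (le_trans xy xz) (lexx z)) _.
  by rewrite ler_wpM2l ?powR_ge0// lerDr addr_ge0.
apply: le_trans (key x x0 (lexx x) xy xz) _.
by rewrite ler_wpM2l ?powR_ge0// -addrA lerDl addr_ge0.
Qed.

Lemma powR_sum3_le (x y z : R) : 0 <= x -> 0 <= y -> 0 <= z ->
  x `^ p + y `^ p + z `^ p <= (3 * (x + y + z)) `^ p.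
Proof.
move=> x0 y0 z0; have s0 : 0 <= x + y + z by rewrite !addr_ge0.
have key w : 0 <= w -> w <= x + y + z -> w `^ p <= (x + y + z) `^ p.
  by move=> w0 ws; rewrite ge0_ler_powR ?nnegrE ?(ltW p0).
rewrite powRM//; apply: (@le_trans _ _ (3 * (x + y + z) `^ p)).
  have hx : x <= x + y + z by lra.
  have hy : y <= x + y + z by lra.
  have hz : z <= x + y + z by lra.
  by move: (key x x0 hx) (key y y0 hy) (key z z0 hz) => ? ? ?; lra.
rewrite ler_wpM2r ?powR_ge0// -[leLHS]powRr1//.
by apply: ler_powR; [lra|exact: ltW].
Qed.

End PowR3.

Lemma combE (F : comNzRingType) m n (x y : 'M[F]_(m, n)) c e i j :
  (c *: x + e *: y) i j = c * x i j + e * y i j.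
Proof. by rewrite !mxE. Qed.

Lemma commutator_id (F : fieldType) m (a : 'M[F]_m) (t w z : 'cV[F]_m) c :
  a *m (t + c *: w) = a *m (c *: z + t) + c *: (a *m (w - z)).
Proof.
rewrite scalemxAr -mulmxDr scalerBr; congr (_ *m _).
by rewrite [c *: z + t]addrC -addrA; congr (t + _); rewrite addrC subrK.
Qed.

Section OpBound.
Context {R : realType} {d : nat}.
Local Notation C := R[i].
Local Notation E := (d.-tuple R).
Local Notation mu := (@leb R d).
Variable p : R.
Hypothesis p1 : 1 < p.
Let p0 : 0 < p. Proof. exact: lt_trans ltr01 p1. Qed.

(** [op_norm] is the infimum of this set. *)
Definition opbound n (U V : E -> 'M[C]_n) (S : @op R d 'cV[C]_n) : set R :=
  [set M : R | 0 <= M /\ forall f, LpW p U f -> dom S f ->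
      LpW p V (S f) /\ (LpW_norm p V (S f) <= M%:E * LpW_norm p U f)%E].

Definition LpW_integral n (W : E -> 'M[C]_n) (f : E -> 'cV[C]_n) : \bar R :=
  (\int[mu]_x (vnorm (mxpow (W x) p^-1 *m f x) `^ p)%:E)%E.

Lemma LpW_integral_ge0 n (W : E -> 'M[C]_n) f : (0 <= LpW_integral W f)%E.
Proof. by apply: integral_ge0 => x _; rewrite lee_fin powR_ge0. Qed.

Lemma LpW_integralP n (W : E -> 'M[C]_n) f :
  LpW p W f <-> mxmeas f /\ (LpW_integral W f < +oo)%E.
Proof.
split=> -[mf h]; split=> //.
  by move: h; apply: lty_poweRy; rewrite invr_eq0 gt_eqF.
exact: poweR_lty.
Qed.

(** Removes the root from the norm inequality. *)
Lemma LpW_norm_le n k (W : E -> 'M[C]_n) (W' : E -> 'M[C]_k) f g (M : R) : 0 <= M ->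
  (LpW_norm p W f <= M%:E * LpW_norm p W' g)%E <->
  (LpW_integral W f <= (M `^ p)%:E * LpW_integral W' g)%E.
Proof.
move=> M0; rewrite /LpW_norm -!/(LpW_integral _ _).
have pn : p != 0 by rewrite gt_eqF.
have h : ((M `^ p)%:E * LpW_integral W' g = (M%:E * (LpW_integral W' g `^ p^-1)) `^ p)%E.
  rewrite poweRM ?lee_fin ?poweR_ge0// -poweRrM mulVf// poweRe1 ?LpW_integral_ge0//.
split=> [le1|le1].
  rewrite h -{1}(poweR_invVK pn (LpW_integral_ge0 W f)).
  by apply: lee_poweR => //; [exact: ltW|exact: poweR_ge0].
rewrite h in le1; rewrite -[leRHS](poweR_invK pn); last first.
  by rewrite mule_ge0 ?poweR_ge0.
by apply: lee_poweR => //; [rewrite invr_ge0 ltW|exact: LpW_integral_ge0].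
Qed.

Lemma mxmeas_usub m n k (F : E -> 'M[C]_(m + k, n)) : mxmeas F ->
  mxmeas (fun x => usubmx (F x)).
Proof. by move=> mF i j; under eq_fun do rewrite mxE; exact: mF. Qed.

Lemma mxmeas_dsub m n k (F : E -> 'M[C]_(m + k, n)) : mxmeas F ->
  mxmeas (fun x => dsubmx (F x)).
Proof. by move=> mF i j; under eq_fun do rewrite mxE; exact: mF. Qed.

Section Block.
Variables (m : nat) (r : R) (U V B : E -> 'M[C]_m) (T : @op R d C).
Hypotheses (r0 : 0 < r) (lT : linear_op T).
Hypotheses (mU : mxmeas U) (mV : mxmeas V) (mB : mxmeas B).
Hypotheses (pU : forall x, posdef (U x)) (pV : forall x, posdef (V x)).
Let W x := block_weight p r (U x) (V x) (B x).
Let a x := mxpow (V x) p^-1.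
Let b x := mxpow (U x) p^-1.
Local Notation Tm := (tensor_id T m).
Local Notation Cm := (commutator (mult_op B) Tm).

Let ma : mxmeas a. Proof. exact: (mxmeas_mxpow mV pV). Qed.
Let mb : mxmeas b. Proof. exact: (mxmeas_mxpow mU pU). Qed.

Lemma dom_comb (c e : C) f g : dom T f -> dom T g ->
  dom T (fun x => c * f x + e * g x).
Proof.
case: lT => d0 dl _ _ df dg.
have h := dl e g _ dg d0.
have -> : (fun x => c * f x + e * g x) = (fun x => c * f x + (e * g x + 0)).
  by apply/funext => x; rewrite addr0.
exact: dl.
Qed.

Lemma tensor_meas n (f : E -> 'cV[C]_n) : dom (tensor_id T n) f ->
  mxmeas (tensor_id T n f).
Proof.
case: lT => _ _ mT _ df i j; rewrite ord1 /=.
by under eq_fun do rewrite mxE; exact: mT (df i).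
Qed.

Lemma vnorm_block x (f : 'cV[C]_(m + m)) :
  vnorm (mxpow (W x) p^-1 *m f) =
  vnorm (col_mx (a x *m (usubmx f + r%:C *: (B x *m dsubmx f)))
                (b x *m dsubmx f)).
Proof. by rewrite vnorm_block_weight// -{1}(vsubmxK f) upper_mx_col. Qed.

(** If f has blocks f1 and f2, the norm of f in L^p(W) is that of the pair
    (a g, b f2) with g = f1 + r B f2. As T is linear almost everywhere, the pair
    of T f is (a (T g + r [B, T] f2), b T f2), whence the three terms. The
    hypothesis r > 0 places B f2 = (g - f1) / r in the domain of T. The
    constant 18 m is 2 m (passage to the entry norm) times 3 times 3 (the two
    elementary inequalities for three summands). *)
Lemma block_opbound (MV MU MC : R) :
  LpW p V `<=` dom Tm -> LpW p U `<=` dom Tm ->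
  opbound V V Tm MV -> opbound U U Tm MU -> opbound U V Cm MC ->
  opbound W W (tensor_id T (m + m)) (18 * m%:R * (MV + MU + r * MC)).
Proof.
move=> dV dU [MV0 hV] [MU0 hU] [MC0 hC]; split.
  by rewrite !mulr_ge0// !addr_ge0// mulr_ge0// ltW.
move=> f Lf df; have [mf If] := (LpW_integralP W f).1 Lf.
pose f1 x := usubmx (f x); pose f2 x := dsubmx (f x).
have mf1 : mxmeas f1 by exact: mxmeas_usub.
have mf2 : mxmeas f2 by exact: mxmeas_dsub.
pose g x := f1 x + r%:C *: (B x *m f2 x).
have mg : mxmeas g.
  by apply: mxmeasD => //; apply: mxmeasZ; exact: mxmeasM.
have If2 : (LpW_integral U f2 <= LpW_integral W f)%E.
  apply: le_integral_all => x _; first by rewrite lee_fin powR_ge0.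
  rewrite lee_fin ge0_ler_powR ?nnegrE ?vnorm_ge0 ?(ltW p0)//.
  by rewrite vnorm_block; exact: vnorm_col_mxd.
have Ig : (LpW_integral V g <= LpW_integral W f)%E.
  apply: le_integral_all => x _; first by rewrite lee_fin powR_ge0.
  rewrite lee_fin ge0_ler_powR ?nnegrE ?vnorm_ge0 ?(ltW p0)//.
  by rewrite vnorm_block; exact: vnorm_col_mxu.
have Lf2 : LpW p U f2 := (LpW_integralP U f2).2 (conj mf2 (le_lt_trans If2 If)).
have Lg : LpW p V g := (LpW_integralP V g).2 (conj mg (le_lt_trans Ig If)).
have df1 : dom Tm f1.
  move=> i; rewrite (_ : (fun x => _) = (fun x => f x (lshift m i) 0))//.
  by apply/funext => x; rewrite mxE.
have df2 := dU _ Lf2; have dg := dV _ Lg.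
pose Bf x := B x *m f2 x.
have rn : r%:C != 0 :> C by rewrite eq_complex /= gt_eqF.
have BfE x : Bf x = (r%:C)^-1 *: g x + (- (r%:C)^-1) *: f1 x.
  rewrite scaleNr -scalerBr /g addrC addKr scalerA mulVf// scale1r//.
have dBf : dom Tm Bf.
  move=> i; have h := dom_comb (r%:C)^-1 (- (r%:C)^-1) (dg i) (df1 i).
  have E0 : (fun x => Bf x i 0) =
      (fun x => (r%:C)^-1 * g x i 0 + - (r%:C)^-1 * f1 x i 0).
    by apply/funext => x; rewrite BfE; exact: combE.
  exact: (eq_ind_r (dom T) h E0).
have dC : dom Cm f2 by split; split.
have [LTg hTg] := hV _ Lg dg.
have [LTf2 hTf2] := hU _ Lf2 df2.
have [LCf2 hCf2] := hC _ Lf2 dC.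
have [N [mN N0 hN]] : exists N, [/\ measurable N, mu N = 0%E &
    forall x, ~ N x -> Tm g x = r%:C *: Tm Bf x + Tm f1 x].
  have [] : {ae mu, forall x, forall i, Tm g x i 0 =
      r%:C * Tm Bf x i 0 + Tm f1 x i 0}.
    apply: filter_forall => i.
    case: lT => _ _ _ /(_ r%:C _ _ (dBf i) (df1 i)) h.
    apply: filterS h => x; rewrite !mxE => <-.
    by congr (T _ x); apply/funext => y; rewrite /g /Bf !mxE addrC.
  move=> N [mN N0 hN]; exists N; split=> // x Nx.
  apply/matrixP => i j; rewrite ord1 [RHS]mxE [X in _ = X + _]mxE.
  by move: i; apply: contrapT => h; apply/Nx/hN.
pose u1 x := a x *m Tm g x.
pose u2 x := b x *m Tm f2 x.
pose u3 x := a x *m Cm f2 x.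
have mu1 : mxmeas u1 by apply: mxmeasM => //; exact: tensor_meas.
have mu2 : mxmeas u2 by apply: mxmeasM => //; exact: tensor_meas.
have mu3 : mxmeas u3.
  apply: mxmeasM => //; apply: mxmeasB; last exact: tensor_meas.
  by apply: mxmeasM => //; exact: tensor_meas.
have mpow (u : E -> 'cV[C]_m) : mxmeas u ->
    measurable_fun [set: E] (fun x => (vnorm (u x) `^ p)%:E).
  move=> mu_; apply/measurable_EFinP.
  exact: (measurableT_comp (measurable_powR _) (measurable_vnorm mu_)).
pose c0 : R := 2 * m%:R.
have c00 : 0 <= c0 by rewrite mulr_ge0.
have TfE x : tensor_id T (m + m) f x = col_mx (Tm f1 x) (Tm f2 x).
  apply/matrixP => i j; rewrite ord1 !mxE.
  case: splitP => k ik; rewrite mxE; congr (T _ x); apply/funext => y;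
    rewrite mxE; congr (f y _ 0); exact: val_inj.
have pw x : ~ N x -> ((vnorm (mxpow (W x) p^-1 *m tensor_id T (m + m) f x) `^ p)%:E <=
   ((c0 * 3) `^ p)%:E * ((vnorm (u1 x) `^ p)%:E +
     (r `^ p)%:E * (vnorm (u3 x) `^ p)%:E + (vnorm (u2 x) `^ p)%:E))%E.
  move=> /hN Tgx; rewrite -!EFinM lee_fin.
  rewrite vnorm_block TfE col_mxKu col_mxKd.
  have -> : a x *m (Tm f1 x + r%:C *: (B x *m Tm f2 x)) = u1 x + r%:C *: u3 x.
    by rewrite /u1 /u3 Tgx; exact: commutator_id.
  rewrite (powRM _ c00)// -mulrA -(powRM _ (ltW r0)) ?vnorm_ge0//.
  apply: (@le_trans _ _ ((c0 * (vnorm (u1 x) + r * vnorm (u3 x) + vnorm (u2 x))) `^ p)).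
    rewrite ge0_ler_powR ?nnegrE ?vnorm_ge0 ?(ltW p0)//.
      by rewrite mulr_ge0// !addr_ge0 ?mulr_ge0 ?vnorm_ge0// ltW.
    apply: le_trans (vnorm_le_entrynorm _) _; rewrite entrynorm_col_mx !mulrDr.
    apply: lerD; last exact: entrynorm_le_vnorm.
    apply: le_trans (entrynormD _ _) _; apply: lerD; first exact: entrynorm_le_vnorm.
    rewrite entrynormZr ger0_norm ?(ltW r0)// mulrCA ler_wpM2l ?(ltW r0)//.
    exact: entrynorm_le_vnorm.
  rewrite powRM ?addr_ge0 ?mulr_ge0 ?vnorm_ge0 ?(ltW r0)//.
  rewrite ler_wpM2l ?powR_ge0//.
  by apply: powR_sum3; rewrite ?mulr_ge0 ?vnorm_ge0 ?(ltW r0).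
have key : (LpW_integral W (tensor_id T (m + m) f) <=
    ((18 * m%:R * (MV + MU + r * MC)) `^ p)%:E * LpW_integral W f)%E.
  apply: le_trans (ae_le_integral mN N0 _ _ (fun x _ => pw x)) _.
  - by move=> x _; rewrite lee_fin powR_ge0.
  - by move=> x _; rewrite -!EFinM lee_fin !(mulr_ge0, addr_ge0)// ?powR_ge0.
  have m3 : measurable_fun [set: E] (fun x => (r `^ p)%:E * (vnorm (u3 x) `^ p)%:E)%E.
    by apply: measurable_funeM; exact: mpow.
  have m13 : measurable_fun [set: E]
      (fun x => (vnorm (u1 x) `^ p)%:E + (r `^ p)%:E * (vnorm (u3 x) `^ p)%:E)%E.
    by apply: emeasurable_funD => //; exact: mpow.
  have g0 (u : E -> 'cV[C]_m) x : (0 <= (vnorm (u x) `^ p)%:E)%E.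
    by rewrite lee_fin powR_ge0.
  have g3 x : (0 <= (r `^ p)%:E * (vnorm (u3 x) `^ p)%:E)%E.
    by rewrite -EFinM lee_fin mulr_ge0 ?powR_ge0.
  have g13 x : (0 <= (vnorm (u1 x) `^ p)%:E +
      (r `^ p)%:E * (vnorm (u3 x) `^ p)%:E)%E by exact: adde_ge0.
  have e3 : (\int[mu]_x ((r `^ p)%:E * (vnorm (u3 x) `^ p)%:E) =
      (r `^ p)%:E * \int[mu]_x (vnorm (u3 x) `^ p)%:E)%E.
    apply: ge0_integralZl; [exact: measurableT|exact: mpow|by []|].
    by rewrite lee_fin powR_ge0.
  have e2 := @ge0_integralD _ _ _ mu _ measurableT _ _
    (fun x _ => g0 u1 x) (mpow _ mu1) (fun x _ => g3 x) m3.
  have e1 := @ge0_integralD _ _ _ mu _ measurableT _ _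
    (fun x _ => g13 x) m13 (fun x _ => g0 u2 x) (mpow _ mu2).
  have c3 : (0 <= ((c0 * 3) `^ p)%:E)%E by rewrite lee_fin powR_ge0.
  have e0 := ge0_integralZl mu measurableT
    (emeasurable_funD m13 (mpow _ mu2)) (fun x _ => adde_ge0 (g13 x) (g0 u2 x))
    c3.
  rewrite [leLHS]e0 e1 e2 e3.
  have h1 : (\int[mu]_x (vnorm (u1 x) `^ p)%:E <= (MV `^ p)%:E * LpW_integral W f)%E.
    apply: le_trans ((LpW_norm_le _ _ _ _ MV0).1 hTg) _.
    apply: lee_wpmul2l; [by rewrite lee_fin powR_ge0|exact: Ig].
  have h2 : (\int[mu]_x (vnorm (u2 x) `^ p)%:E <= (MU `^ p)%:E * LpW_integral W f)%E.
    apply: le_trans ((LpW_norm_le _ _ _ _ MU0).1 hTf2) _.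
    apply: lee_wpmul2l; [by rewrite lee_fin powR_ge0|exact: If2].
  have h3 : (\int[mu]_x (vnorm (u3 x) `^ p)%:E <= (MC `^ p)%:E * LpW_integral W f)%E.
    apply: le_trans ((LpW_norm_le _ _ _ _ MC0).1 hCf2) _.
    apply: lee_wpmul2l; [by rewrite lee_fin powR_ge0|exact: If2].
  apply: (@le_trans _ _ (((c0 * 3) `^ p)%:E * ((MV `^ p)%:E * LpW_integral W f +
      ((r * MC) `^ p)%:E * LpW_integral W f + (MU `^ p)%:E * LpW_integral W f))%E).
    rewrite lee_wpmul2l ?lee_fin ?powR_ge0//.
    apply: leeD; last exact: h2.
    apply: leeD; first exact: h1.
    rewrite (powRM _ (ltW r0) MC0) EFinM -muleA.
    by apply: lee_wpmul2l; [rewrite lee_fin powR_ge0|exact: h3].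
  rewrite -!ge0_muleDl ?adde_ge0 ?lee_fin ?powR_ge0// muleA.
  rewrite lee_wpmul2r ?LpW_integral_ge0// -!EFinD -EFinM lee_fin.
  have -> : 18 * m%:R * (MV + MU + r * MC) = c0 * 3 * (3 * (MV + r * MC + MU)).
    by rewrite /c0; ring.
  have rMC0 : 0 <= r * MC by rewrite mulr_ge0// ltW.
  rewrite [leRHS]powRM ?mulr_ge0 ?addr_ge0//.
  rewrite ler_wpM2l ?powR_ge0//.
  exact: powR_sum3_le.
split; last first.
  apply: (LpW_norm_le _ _ _ _ _).2 => //.
  by rewrite !mulr_ge0// !addr_ge0// mulr_ge0// ltW.
apply: (LpW_integralP W _).2; split; first exact: tensor_meas.
apply: le_lt_trans key _; apply: lte_mul_pinfty => //.
by rewrite lee_fin powR_ge0.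
Qed.

End Block.
End OpBound.

Local Open Scope ereal_scope.

(** * Normalized measure of a cube, and mixed norms *)

Section Mixed.
Context {R : realType} d (T : measurableType d) (P : probability T R).
Variable p : R.
Hypothesis p1 : (1 < p)%R.
Local Notation q := (conj_exp p).

Definition mixed (D : T -> T -> R) : \bar R :=
  \int[P]_x ((\int[P]_y (D x y `^ q)%:E) `^ (p / q)).

Lemma mixed_scale (D : T -> T -> R) (s : R) : (0 <= s)%R ->
  measurable_fun [set: T * T] (fun z => D z.1 z.2) ->
  (forall x y, (0 <= D x y)%R) ->
  mixed (fun x y => (s * D x y)%R) = (s `^ p)%:E * mixed D.
Proof.
move=> s0 mD D0; have q0 := conj_gt0 p1.
have mDr x : measurable_fun [set: T] (D x).
  exact: (@measurable_fun_pair2 _ _ _ _ _ _ (fun z => D z.1 z.2) x).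
have mu_ : measurable_fun [set: T] (fun x => \int[P]_y (D x y `^ q)%:E).
  apply: (@measurable_fun_fubini_tonelli_F _ _ _ _ _ P
    (fun z => (D z.1 z.2 `^ q)%:E)).
    by apply/measurable_EFinP; exact: (measurableT_comp (measurable_powR _)).
  by move=> z; rewrite lee_fin powR_ge0.
have u0 x : 0 <= \int[P]_y (D x y `^ q)%:E.
  by apply: integral_ge0 => y _; rewrite lee_fin powR_ge0.
rewrite /mixed -ge0_integralZl//; last 3 first.
- exact: (measurableT_comp (measurable_poweR _)).
- by move=> x _; exact: poweR_ge0.
- by rewrite lee_fin powR_ge0.
apply: eq_integral => x _.
have -> : (s `^ p)%:E = ((s `^ q)%:E) `^ (p / q).
  by rewrite poweR_EFin -powRrM mulrCA divff ?mulr1// gt_eqF.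
rewrite -poweRM ?lee_fin ?powR_ge0//; congr (_ `^ _).
rewrite -ge0_integralZl//; last 3 first.
- by apply/measurable_EFinP; exact: (measurableT_comp (measurable_powR _)).
- by move=> y _; rewrite lee_fin powR_ge0.
- by rewrite lee_fin powR_ge0.
by apply: eq_integral => y _; rewrite powRM.
Qed.

End Mixed.

Section CoreScaled.
Context {R : realType} d (T : measurableType d) (P : probability T R).
Local Notation C := R[i].
Variables (n : nat) (p : R) (a a' b b' B : T -> 'M[C]_n) (Ka Kb t : R).
Hypothesis p1 : (1 < p)%R.
Hypotheses (ma : mxmeas a) (ma' : mxmeas a') (mb : mxmeas b) (mb' : mxmeas b')
  (mB : mxmeas B).
Hypothesis aV : forall x, a' x *m a x = 1%:M.
Hypothesis bV : forall x, b' x *m b x = 1%:M.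
Hypothesis pb : forall x, posdef (b x).
Hypotheses (Ka0 : (0 <= Ka)%R) (Kb0 : (0 <= Kb)%R) (t0 : (0 < t)%R).
Hypothesis HA : mixed P p (fun x y => entrynorm (a x *m a' y)) <= Ka%:E.
Hypothesis HB : mixed P p (fun x y => entrynorm (b x *m b' y)) <= Kb%:E.
Hypothesis HX : mixed P p (fun x y => entrynorm (a x *m (B x - B y) *m b' y))
    <= (t `^ p)%:E.
Hypothesis iB : mxint P B.

(** Both sides are homogeneous in B; apply core_bound to B / t. *)
Lemma core_bound_scaled :
  \int[P]_x (entrynorm (mxexp P a *m (B x - mxexp P B) *m invmx (mxexp P b)))%:E <=
    (core_const n p Ka Kb * t)%:E.
Proof.
pose s : R := (t^-1)%R.
have s0 : (0 < s)%R by rewrite invr_gt0.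
pose B' x := s%:C *: B x.
have mB' : mxmeas B' by exact: mxmeasZ.
have B'E : B' = (fun x => (s%:C)%:M *m B x).
  by apply/funext => x; rewrite mul_scalar_mx.
have [iB' eB'] : mxint P B' /\ mxexp P B' = s%:C *: mxexp P B.
  have [i1 e1] := mxint_mull (s%:C)%:M iB.
  by rewrite B'E -mul_scalar_mx; split.
have pull (X Y : 'M[C]_n) (Z W : 'M[C]_n) :
    (entrynorm (X *m (s%:C *: Z - s%:C *: W) *m Y) = s * entrynorm (X *m (Z - W) *m Y))%R.
  rewrite -scalerBr -scalemxAr -scalemxAl entrynormZr ger0_norm// ltW//.
have mD : measurable_fun [set: T * T]
    (fun z => entrynorm (a z.1 *m (B z.1 - B z.2) *m b' z.2)).
  have c1 := fun F => @mxmeas_comp R _ _ _ _ n n _ F (@measurable_fst _ _ T T).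
  have c2 := fun F => @mxmeas_comp R _ _ _ _ n n _ F (@measurable_snd _ _ T T).
  apply: measurable_entrynorm; apply: mxmeasM; last exact: (c2 b' mb').
  apply: mxmeasM; first exact: (c1 a ma).
  by apply: mxmeasB; [exact: (c1 B mB)|exact: (c2 B mB)].
have HX' : mixed P p (fun x y => entrynorm (a x *m (B' x - B' y) *m b' y)) <= 1.
  have -> : (fun x y => entrynorm (a x *m (B' x - B' y) *m b' y)) =
      (fun x y => s * entrynorm (a x *m (B x - B y) *m b' y))%R.
    by apply/funext => x; apply/funext => y; exact: pull.
  rewrite (mixed_scale P p1 (ltW s0) mD); last by move=> x y; exact: entrynorm_ge0.
  apply: (@le_trans _ _ ((s `^ p)%:E * (t `^ p)%:E)).
    by rewrite lee_wpmul2l// lee_fin powR_ge0.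
  by rewrite -EFinM -powRM ?(ltW s0) ?(ltW t0)// mulVf ?gt_eqF// powR1.
have := core_bound p1 ma ma' mb mb' mB' aV bV pb Ka0 Kb0 HA HB HX' iB'.
rewrite eB'; set A := mxexp P a; set G := invmx _; set EB := mxexp P B => h.
have mg : measurable_fun [set: T] (fun x => (entrynorm (A *m (B x - EB) *m G))%:E).
  apply/measurable_EFinP; apply: measurable_entrynorm; apply: mxmeasM.
    apply: mxmeasM; first exact: mxmeas_cst.
    by apply: mxmeasB => //; exact: mxmeas_cst.
  exact: mxmeas_cst.
have E : \int[P]_x (entrynorm (A *m (B' x - s%:C *: EB) *m G))%:E =
    s%:E * \int[P]_x (entrynorm (A *m (B x - EB) *m G))%:E.
  rewrite -ge0_integralZl//; last 2 first.
  - by move=> x _; rewrite lee_fin entrynorm_ge0.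
  - by rewrite lee_fin ltW.
  by apply: eq_integral => x _; rewrite -EFinM; congr EFin; exact: pull.
rewrite E in h.
have := lee_wpmul2l (_ : 0 <= t%:E) h; rewrite lee_fin (ltW t0) => /(_ isT).
by rewrite muleA -!EFinM divff ?gt_eqF// mul1e (mulrC t).
Qed.
End CoreScaled.

Section AvgMeasure.
Context {R : realType} d (T : measurableType d).
Variables (mu : {measure set T -> \bar R}) (Q : set T).
Hypotheses (mQ : measurable Q) (Q0 : 0 < mu Q) (Qy : mu Q < +oo).

Let l : R := ((fine (mu Q))^-1)%R.
Let l0 : (0 < l)%R.
Proof. by rewrite invr_gt0 fine_gt0// Q0. Qed.
Let k : {nonneg R} := NngNum (ltW l0).

(** The averages over Q are the expectations for this probability measure. *)
Definition avg_measure := mscale k (mrestr mu mQ).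

HB.instance Definition _ := Measure.on avg_measure.

Let avg_measureT : avg_measure [set: T] = 1.
Proof.
rewrite /avg_measure /mscale /= /mrestr setTI -[X in _ * X]fineK.
  by rewrite -EFinM /l mulVf// gt_eqF// fine_gt0// Q0.
by rewrite ge0_fin_numE.
Qed.

HB.instance Definition _ := Measure_isProbability.Build _ _ _ avg_measure avg_measureT.

Lemma ge0_integral_avg (f : T -> \bar R) : measurable_fun [set: T] f ->
  (forall x, 0 <= f x) ->
  \int[avg_measure]_x f x = ((fine (mu Q))^-1)%:E * \int[mu]_(x in Q) f x.
Proof.
move=> mf f0; rewrite /avg_measure ge0_integral_mscale//; congr (_ * _).
have mQC : measurable (~` Q) by exact: measurableC.
rewrite -[X in \int[_]_(x in X) _](setUv Q) ge0_integral_setU//; last 2 first.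
- by rewrite setUv.
- by apply/disj_setPS; rewrite setICr.
rewrite [X in _ + X](_ : _ = 0) ?adde0; last first.
  transitivity (\int[mrestr mu mQ]_(x in ~` Q) (cst 0 x)); last exact: integral0.
  apply: (ae_eq_integral_ge0 mQC) => //.
  by change (mu (~` Q `&` Q) = 0); rewrite setICl measure0.
apply: eq_measure_integral => A mA AQ; rewrite /mrestr.
by congr (mu _); apply/setIidPl.
Qed.

Let fine_scale (x y : \bar R) : 0 <= x -> 0 <= y ->
  fine (l%:E * x - l%:E * y) = (l * fine (x - y))%R.
Proof.
case: x => [x| |]// _; case: y => [y| |]// _ /=.
- by rewrite mulrBr.
- by rewrite gt0_muley ?lte_fin//= mulr0.
- by rewrite gt0_muley ?lte_fin//= mulr0.
- by rewrite gt0_muley ?lte_fin//= mulr0.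
Qed.

Lemma Rintegral_avg (f : T -> R) : measurable_fun [set: T] f ->
  Rintegral avg_measure [set: T] f = ((fine (mu Q))^-1 * Rintegral mu Q f)%R.
Proof.
move=> mf; have mEf : measurable_fun [set: T] (EFin \o f).
  exact/measurable_EFinP.
rewrite /Rintegral integralE [in RHS]integralE.
rewrite (ge0_integral_avg (measurable_funepos mEf))//.
rewrite (ge0_integral_avg (measurable_funeneg mEf))//.
by apply: fine_scale; exact: integral_ge0.
Qed.

End AvgMeasure.

Section Cubes.
Context {R : realType} {d : nat}.
Local Notation C := R[i].
Local Notation E := (d.-tuple R).
Local Notation mu := (@leb R d).

Lemma measurable_cube (a : E) (l : R) : measurable (cube a l).
Proof.
rewrite (_ : cube a l = \bigcap_(i in [set: 'I_d])
    ((@tnth _ R ^~ i) @^-1` `[tnth a i, (tnth a i + l)%R])).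
  apply: fin_bigcap_measurable => // i _.
  rewrite -[X in measurable X]setTI.
  exact: (@measurable_tnth _ (measurableTypeR R)).
apply/seteqP; split=> t /= h i; first by move=> _; rewrite /= in_itv/=.
by have := h i I; rewrite /= in_itv/=.
Qed.

Lemma leb_cube (a : E) (l : R) : (0 <= l)%R -> mu (cube a l) = (l ^+ d)%:E.
Proof.
move=> l0; have := @leb_box R d (tnth a) (fun i => (tnth a i + l)%R).
rewrite /cube => ->; last by move=> i; rewrite lerDl.
rewrite (eq_bigr (fun=> l)); last by move=> i _; rewrite addrC addKr.
by rewrite prodr_const card_ord.
Qed.

Lemma cubesP (Q : set E) : cubes Q ->
  [/\ measurable Q, 0 < mu Q & mu Q < +oo].
Proof.
move=> [a [l [l0 ->]]]; rewrite leb_cube ?(ltW l0)//; split.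
- exact: measurable_cube.
- by rewrite lte_fin exprn_gt0.
- exact: ltry.
Qed.

Section OneCube.
Variables (Q : set E) (mQ : measurable Q) (Q0 : 0 < mu Q) (Qy : mu Q < +oo).
Let P : probability E R := avg_measure mQ Q0 Qy.
Variable p : R.
Hypothesis p1 : (1 < p)%R.
Local Notation q := (conj_exp p).

Lemma integral_eavg (f : E -> \bar R) : measurable_fun [set: E] f ->
  (forall x, 0 <= f x) -> \int[P]_x f x = eavg Q f.
Proof. by move=> mf f0; rewrite ge0_integral_avg. Qed.

Lemma eavg_le (f g : E -> \bar R) : (forall x, 0 <= f x) ->
  (forall x, f x <= g x) -> eavg Q f <= eavg Q g.
Proof.
move=> f0 fg; rewrite /eavg lee_wpmul2l//.
  by rewrite lee_fin invr_ge0 fine_ge0.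
exact: le_integral_all.
Qed.

Lemma eavg_ge0 (f : E -> \bar R) : (forall x, 0 <= f x) -> 0 <= eavg Q f.
Proof.
move=> f0; rewrite /eavg mule_ge0//.
  by rewrite lee_fin invr_ge0 fine_ge0.
exact: integral_ge0.
Qed.

Lemma mixed_le_eavg (D K : E -> E -> R) :
  measurable_fun [set: E * E] (fun z => D z.1 z.2) ->
  (forall x y, (0 <= D x y)%R) -> (forall x y, (D x y <= K x y)%R) ->
  mixed P p D <=
  eavg Q (fun x => (eavg Q (fun y => (K x y `^ q)%:E)) `^ (p / q)).
Proof.
move=> mD D0 DK; have q0 := conj_gt0 p1.
have mDr x : measurable_fun [set: E] (D x).
  exact: (@measurable_fun_pair2 _ _ _ _ _ _ (fun z => D z.1 z.2) x).
have mu_ : measurable_fun [set: E] (fun x => \int[P]_y (D x y `^ q)%:E).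
  apply: (@measurable_fun_fubini_tonelli_F _ _ _ _ _ P
    (fun z => (D z.1 z.2 `^ q)%:E)).
    by apply/measurable_EFinP; exact: (measurableT_comp (measurable_powR _)).
  by move=> z; rewrite lee_fin powR_ge0.
rewrite /mixed integral_eavg; last 2 first.
- exact: (measurableT_comp (measurable_poweR _)).
- by move=> x; exact: poweR_ge0.
apply: eavg_le => x; first exact: poweR_ge0.
apply: lee_poweR; first exact/ltW/conj_div_gt0.
  by apply: integral_ge0 => y _; rewrite lee_fin powR_ge0.
rewrite integral_eavg; last 2 first.
- by apply/measurable_EFinP; exact: (measurableT_comp (measurable_powR _)).
- by move=> y; rewrite lee_fin powR_ge0.
apply: eavg_le => y; first by rewrite lee_fin powR_ge0.
by rewrite lee_fin ge0_ler_powR ?nnegrE ?(ltW q0)// (le_trans (D0 x y)).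
Qed.

Lemma mxavg_exp n (F : E -> 'M[C]_n) : mxmeas F -> mxavg Q F = mxexp P F.
Proof.
move=> mF; apply/matrixP => i j; rewrite !mxE /cexp; have [m1 m2] := mF i j.
by rewrite !Rintegral_avg.
Qed.

(** The factor between the entry norm and the operator norm. *)
Definition norm_ratio (m : nat) : R := (2 * m%:R ^+ 2)%R.

Lemma norm_ratio_gt0 m : (0 < m)%N -> (0 < norm_ratio m)%R.
Proof. by move=> m0; rewrite /norm_ratio mulr_gt0// exprn_gt0// ltr0n. Qed.

Lemma norm_ratio_entrynorm m (A : 'M[C]_m) : (0 < m)%N -> ((norm_ratio m)^-1 * entrynorm A <= mxnorm A)%R.
Proof. by move=> m0; rewrite ler_pdivrMl ?norm_ratio_gt0// entrynorm_le_mxnorm. Qed.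

(** The kernel is divided by norm_ratio before the comparison, as homogeneity is
    only available for the measurable entry norm. *)
Lemma mixed_Ap m (W : E -> 'M[C]_m) : (0 < m)%N -> mxmeas W ->
  (forall x, posdef (W x)) -> cubes Q -> Ap_char p W < +oo ->
  mixed P p (fun x y => entrynorm (mxpow (W x) p^-1 *m mxpow (W y) (- p^-1))) <=
  (norm_ratio m `^ p * fine (Ap_char p W))%:E.
Proof.
move=> m0 mW pW cQ Wy.
have o0 := norm_ratio_gt0 m0.
pose F x y := entrynorm (mxpow (W x) p^-1 *m mxpow (W y) (- p^-1)).
have mF : measurable_fun [set: E * E] (fun z => F z.1 z.2).
  apply: measurable_entrynorm; apply: mxmeasM.
    exact: (mxmeas_comp measurable_fst (mxmeas_mxpow mW pW _)).
  exact: (mxmeas_comp measurable_snd (mxmeas_mxpow mW pW _)).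
have F0 x y : (0 <= F x y)%R by exact: entrynorm_ge0.
have h : mixed P p (fun x y => (norm_ratio m)^-1 * F x y)%R <= Ap_char p W.
  apply: le_trans (mixed_le_eavg (K := fun x y =>
    mxnorm (mxpow (W x) p^-1 *m mxpow (W y) (- p^-1))) _ _ _) _.
  - exact: measurable_funM.
  - by move=> x y; rewrite mulr_ge0// invr_ge0 ltW.
  - by move=> x y; exact: norm_ratio_entrynorm.
  - by apply: ereal_sup_ubound; exists Q.
have oi0 : (0 <= (norm_ratio m)^-1)%R by rewrite invr_ge0 ltW.
rewrite (mixed_scale P p1 oi0 mF F0) in h.
have W0 : 0 <= Ap_char p W.
  apply: le_trans h; rewrite mule_ge0 ?lee_fin ?powR_ge0//.
  by apply: integral_ge0 => x _; exact: poweR_ge0.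
have Wf : Ap_char p W = (fine (Ap_char p W))%:E by rewrite fineK// ge0_fin_numE.
have := lee_wpmul2l (_ : 0 <= (norm_ratio m `^ p)%:E) h.
rewrite lee_fin powR_ge0 => /(_ isT); rewrite muleA -EFinM -powRM ?(ltW o0)//.
by rewrite divff ?gt_eqF// powR1 mul1e {1}Wf -EFinM.
Qed.

End OneCube.
End Cubes.

(** * The theorem for weights that are positive definite everywhere *)

Section Regular.
Context {R : realType} {d : nat}.
Local Notation C := R[i].
Local Notation E := (d.-tuple R).
Local Notation mu := (@leb R d).
Variables (p : R) (N m : nat) (T : 'I_N -> @op R d C) (c : R).
Hypotheses (p1 : (1 < p)%R) (m0 : (0 < m)%N) (c0 : (0 < c)%R).
Local Notation q := (conj_exp p).
Let p0 : (0 < p)%R. Proof. exact: lt_trans ltr01 p1. Qed.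

Lemma opbound_le n (U V : E -> 'M[C]_n) S M M' :
  (M <= M')%R -> opbound p U V S M -> opbound p U V S M'.
Proof.
move=> MM [M0 h]; split; first exact: le_trans MM.
move=> f Lf df; have [h1 h2] := h f Lf df; split=> //.
by apply: le_trans h2 _; rewrite lee_wpmul2r ?poweR_ge0 ?lee_fin.
Qed.

Lemma op_norm_lt n (U V : E -> 'M[C]_n) S M :
  op_norm p U V S < M%:E -> opbound p U V S M.
Proof.
move=> /ereal_inf_lt[_ [M' hM' <-]]; rewrite lte_fin => /ltW MM.
exact: opbound_le MM hM'.
Qed.

Lemma max_norm_le n (U V : E -> 'M[C]_n) (S : 'I_N -> op 'cV[C]_n) (M : R) :
  (0 <= M)%R -> (forall s, opbound p U V (S s) M) ->
  max_norm p U V S <= M%:E.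
Proof.
move=> M0 h; rewrite /max_norm; elim/big_ind: _ => [|x y xM yM|s _].
- by rewrite lee_fin.
- by rewrite ge_max xM yM.
- by apply: ereal_inf_lbound; exists M; first exact: h.
Qed.

Lemma le_max_norm n (U V : E -> 'M[C]_n) (S : 'I_N -> op 'cV[C]_n) s :
  op_norm p U V (S s) <= max_norm p U V S.
Proof.
by rewrite /max_norm (bigD1 s)//= le_max lexx.
Qed.

Lemma max_norm_ge0 n (U V : E -> 'M[C]_n) (S : 'I_N -> op 'cV[C]_n) :
  0 <= max_norm p U V S.
Proof.
rewrite /max_norm; elim/big_ind: _ => // [x y x0 y0|s _].
  by rewrite le_max x0.
by apply: le_ereal_inf_tmp => _ [M [M0 _] <-]; rewrite lee_fin.
Qed.

Lemma bounded_opbound n (W : E -> 'M[C]_n) (S : 'I_N -> op 'cV[C]_n) :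
  (forall s, bounded_op p W W (S s)) ->
  exists M, forall s, opbound p W W (S s) M.
Proof.
move=> h.
have [M hM] : {M : 'I_N -> R & forall s, opbound p W W (S s) (M s)}.
  apply: (@choice _ _ (fun s => opbound p W W (S s))) => s.
  by have [_ /ereal_inf_lt[_ [M' hM' <-] _]] := h s; exists M'.
exists (\sum_s M s)%R => s; apply: opbound_le (hM s).
rewrite (bigD1 s)//= lerDl sumr_ge0// => i _; by have [] := hM i.
Qed.

Hypothesis lT : forall s, linear_op (T s).
Hypothesis lower : forall W : E -> 'M[C]_(m + m), matrix_weight W ->
  (Ap_char p W) `^ p^-1 <=
    c%:E * max_norm p W W (fun s => tensor_id (T s) (m + m)).
Hypothesis bounded : forall W : E -> 'M[C]_m, Ap_weight p W ->
  forall s, bounded_op p W W (tensor_id (T s) m).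

Variables (U V B : E -> 'M[C]_m).
Hypotheses (mU : mxmeas U) (mV : mxmeas V) (mB : mxmeas B).
Hypotheses (pU : forall x, posdef (U x)) (pV : forall x, posdef (V x)).
Hypotheses (AU : Ap_weight p U) (AV : Ap_weight p V).
Let a x := mxpow (V x) p^-1.
Let b x := mxpow (U x) p^-1.
Let b' x := mxpow (U x) (- p^-1).
Let ma : mxmeas a. Proof. exact: (mxmeas_mxpow mV pV). Qed.
Let mb : mxmeas b. Proof. exact: (mxmeas_mxpow mU pU). Qed.
Let mb' : mxmeas b'. Proof. exact: (mxmeas_mxpow mU pU). Qed.
Let Cm s := commutator (mult_op B) (tensor_id (T s) m).
Let D x y := entrynorm (a x *m (B x - B y) *m b' y).

(** 36 m = 2 * 18 m: the constant of block_opbound, doubled because r is chosen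
    with MV + MU <= r MC. *)
Definition lower_const : R := (norm_ratio m * (c * (36 * m%:R)))%R.

Lemma lower_const_gt0 : (0 < lower_const)%R.
Proof. by rewrite /lower_const !mulr_gt0 ?norm_ratio_gt0// ltr0n. Qed.

Let mD : measurable_fun [set: E * E] (fun z => D z.1 z.2).
Proof.
have c1 := fun F => @mxmeas_comp R _ _ _ _ m m _ F (@measurable_fst _ _ E E).
have c2 := fun F => @mxmeas_comp R _ _ _ _ m m _ F (@measurable_snd _ _ E E).
apply: measurable_entrynorm; apply: mxmeasM; last exact: (c2 b' mb').
apply: mxmeasM; first exact: (c1 a ma).
by apply: mxmeasB; [exact: (c1 B mB)|exact: (c2 B mB)].
Qed.

Let D0 x y : (0 <= D x y)%R. Proof. exact: entrynorm_ge0. Qed.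

Section OneCube.
Variables (Q : set E) (mQ : measurable Q) (Q0 : 0 < mu Q) (Qy : mu Q < +oo).
Let P : probability E R := avg_measure mQ Q0 Qy.
Hypothesis cQ : cubes Q.
Variable MC : R.
Hypotheses (MC0 : (0 < MC)%R) (hMC : forall s, opbound p U V (Cm s) MC).

Lemma block_mxmeas r : mxmeas (fun x => block_weight p r (U x) (V x) (B x)).
Proof.
have mPhi : mxmeas (fun x => upper_mx r (a x) (b x) (B x)).
  apply: mxmeas_block; [exact: ma| |exact: mxmeas_cst|exact: mb].
  by apply: mxmeasZ; exact: mxmeasM.
have mG : mxmeas (fun x => (upper_mx r (a x) (b x) (B x))^t* *m upper_mx r (a x) (b x) (B x)).
  by apply: mxmeasM => //; exact: mxmeas_trC.
exact: (mxmeas_mxpow mG (fun x => block_gram_posdef p r (B x) (pU x) (pV x))).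
Qed.

(** Apply the lower bound property to the block weight with a large r; the
    factor r on both sides cancels. *)
Lemma mixed_commutator : mixed P p D <= ((lower_const * MC) `^ p)%:E.
Proof.
have [MV hV] := bounded_opbound (bounded AV).
have [MU hU] := bounded_opbound (bounded AU).
pose MV' : R := Num.max MV 0%R; pose MU' : R := Num.max MU 0%R.
have MV0 : (0 <= MV')%R by rewrite le_max lexx orbT.
have MU0 : (0 <= MU')%R by rewrite le_max lexx orbT.
have hV' s : opbound p V V (tensor_id (T s) m) MV'.
  by apply: opbound_le (hV s); rewrite le_max lexx.
have hU' s : opbound p U U (tensor_id (T s) m) MU'.
  by apply: opbound_le (hU s); rewrite le_max lexx.
(* with this r, MV' + MU' <= r * MC *)
pose r : R := ((MV' + MU') / MC + 1)%R.
have r0 : (0 < r)%R by rewrite ltr_wpDl// divr_ge0 ?addr_ge0// ltW.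
pose W x := block_weight p r (U x) (V x) (B x).
have pW x : posdef (W x) by exact: block_weight_posdef.
have wW : matrix_weight W by split; [exact: block_mxmeas|exact: aeW].
pose S : R := (18 * m%:R * (MV' + MU' + r * MC))%R.
have S0 : (0 <= S)%R by rewrite !mulr_ge0// !addr_ge0// mulr_ge0// ltW.
have hS s : opbound p W W (tensor_id (T s) (m + m)) S.
  apply: (block_opbound p1 r0 (lT s) mU mV mB pU pV _ _ (hV' s) (hU' s) (hMC s)).
    by have [] := bounded AV s.
  by have [] := bounded AU s.
have WS : (Ap_char p W) `^ p^-1 <= (c * S)%:E.
  apply: le_trans (lower wW) _; rewrite EFinM lee_wpmul2l ?lee_fin ?(ltW c0)//.
  exact: max_norm_le.
have o0 := norm_ratio_gt0 (R := R) m0.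
pose s : R := (r / norm_ratio m)%R.
have s0 : (0 < s)%R by rewrite divr_gt0.
have Dle x y : (s * D x y <= mxnorm (mxpow (W x) p^-1 *m mxpow (W y) (- p^-1)))%R.
  apply: le_trans (mxnorm_offdiag r p0 (B x) (B y) (pU x) (pV x) (pU y) (pV y)).
  apply: le_trans (norm_ratio_entrynorm _ m0); rewrite entrynormZr ger0_norm ?(ltW r0)//.
  by rewrite /s mulrA (mulrC _ r).
have h : mixed P p (fun x y => s * D x y)%R <= Ap_char p W.
  apply: le_trans (mixed_le_eavg mQ Q0 Qy p1 (K := fun x y =>
    mxnorm (mxpow (W x) p^-1 *m mxpow (W y) (- p^-1))) _ _ Dle) _.
  - exact: measurable_funM.
  - by move=> x y; rewrite mulr_ge0// ltW.
  - by apply: ereal_sup_ubound; exists Q.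
have mix0 f : 0 <= mixed P p f by apply: integral_ge0 => x _; exact: poweR_ge0.
have pn : (p != 0)%R by rewrite gt_eqF.
have h2 : mixed P p (fun x y => s * D x y)%R <= ((c * S) `^ p)%:E.
  rewrite -poweR_EFin -[leLHS](poweR_invVK pn)//.
  apply: lee_poweR; [exact: ltW|exact: poweR_ge0|].
  apply: le_trans WS; apply: lee_poweR => //.
  by rewrite invr_ge0 ltW.
rewrite (mixed_scale P p1 (ltW s0) mD D0) in h2.
have := lee_wpmul2l (_ : 0 <= (s^-1 `^ p)%:E) h2.
rewrite lee_fin powR_ge0 => /(_ isT); rewrite muleA -!EFinM.
have cS0 : (0 <= c * S)%R by rewrite mulr_ge0// ltW.
have si0 : (0 <= s^-1)%R by rewrite invr_ge0 ltW.
rewrite -(powRM _ si0 (ltW s0)) mulVf ?gt_eqF// powR1 mul1e.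
move=> /le_trans; apply; rewrite -powRM// lee_fin.
have x0 : (0 <= s^-1 * (c * S))%R by rewrite mulr_ge0.
have y0 : (0 <= lower_const * MC)%R.
  by rewrite mulr_ge0// ltW// lower_const_gt0.
apply: (ge0_ler_powR (ltW p0) x0 y0).
have rMC : (MV' + MU' <= r * MC)%R.
  by rewrite /r mulrDl mul1r divfK ?gt_eqF// lerDl ltW.
have Sle : (S <= 36 * m%:R * (r * MC))%R.
  apply: (@le_trans _ _ (18 * m%:R * (r * MC + r * MC))%R).
    by rewrite ler_wpM2l ?mulr_ge0// lerD2r.
  by rewrite le_eqVlt; apply/orP; left; apply/eqP; ring.
apply: (@le_trans _ _ (s^-1 * (c * (36 * m%:R * (r * MC))))%R).
  by rewrite ler_wpM2l// ler_wpM2l// ltW.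
rewrite /s /lower_const le_eqVlt; apply/orP; left; apply/eqP.
by field; rewrite !gt_eqF.
Qed.

Hypothesis iB : \int[mu]_(x in Q) (mxnorm (B x))%:E < +oo.

Let iBP : mxint P B.
Proof.
apply: mxint_entrynorm => //.
have o0 := norm_ratio_gt0 (R := R) m0.
have mmn : measurable_fun [set: E] (fun x => (entrynorm (B x))%:E).
  by apply/measurable_EFinP; exact: measurable_entrynorm.
rewrite ge0_integral_avg//; last by move=> x; rewrite lee_fin entrynorm_ge0.
apply: lte_mul_pinfty; [by rewrite lee_fin invr_ge0 fine_ge0|by []|].
have h : (norm_ratio m)^-1%:E * \int[mu]_(x in Q) (entrynorm (B x))%:E < +oo.
  rewrite -ge0_integralZl//; last 3 first.
  - exact: measurable_funTS.
  - by move=> x _; rewrite lee_fin entrynorm_ge0.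
  - by rewrite lee_fin invr_ge0 ltW.
  apply: le_lt_trans iB; apply: le_integral_all => x _.
    by rewrite -EFinM lee_fin mulr_ge0 ?entrynorm_ge0// invr_ge0 ltW.
  by rewrite -EFinM lee_fin norm_ratio_entrynorm.
have -> : \int[mu]_(x in Q) (entrynorm (B x))%:E =
   (norm_ratio m)%:E * ((norm_ratio m)^-1%:E * \int[mu]_(x in Q) (entrynorm (B x))%:E).
  by rewrite muleA -EFinM divff ?gt_eqF// mul1e.
by apply: lte_mul_pinfty => //; rewrite lee_fin ltW.
Qed.

(** The factor 2 is the passage from the entry norm to the operator norm. *)
Definition regular_const (u v : R) : R :=
  (2 * (core_const m p (norm_ratio m `^ p * v) (norm_ratio m `^ p * u) * lower_const))%R.

Lemma cube_bound :
  eavg Q (fun x => (mxnorm (mxavg Q (fun y => mxpow (V y) p^-1)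
               *m (B x - mxavg Q B)
               *m invmx (mxavg Q (fun y => mxpow (U y) p^-1))))%:E) <=
  (regular_const (fine (Ap_char p U)) (fine (Ap_char p V)) * MC)%:E.
Proof.
have mHA := mixed_Ap mQ Q0 Qy p1 m0 mV pV cQ AV.2.
have mHB := mixed_Ap mQ Q0 Qy p1 m0 mU pU cQ AU.2.
have Ap0 (W : E -> 'M[C]_m) : (0 <= fine (Ap_char p W))%R.
  apply: fine_ge0; apply: (@le_trans _ _ (eavg Q (fun x =>
    eavg Q (fun y => (mxnorm (mxpow (W x) p^-1 *m mxpow (W y) (- p^-1)) `^ q)%:E)
    `^ (p / q)))).
    by apply: eavg_ge0 => x; exact: poweR_ge0.
  by apply: ereal_sup_ubound; exists Q.
have K0 (W : E -> 'M[C]_m) : (0 <= norm_ratio m `^ p * fine (Ap_char p W))%R.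
  by rewrite mulr_ge0 ?powR_ge0.
have LM0 : (0 < lower_const * MC)%R by rewrite mulr_gt0 ?lower_const_gt0.
have aV x : mxpow (V x) (- p^-1) *m a x = 1%:M by exact: (mxpowN p^-1 (pV x)).2.
have bV x : b' x *m b x = 1%:M by exact: (mxpowN p^-1 (pU x)).2.
have pb x : posdef (b x) by exact: mxpow_posdef.
have := core_bound_scaled p1 ma (mxmeas_mxpow mV pV _) mb mb' mB aV bV pb
  (K0 V) (K0 U) LM0 mHA mHB mixed_commutator iBP.
have eA : mxavg Q (fun y => mxpow (V y) p^-1) = mxexp P a.
  exact: (mxavg_exp mQ Q0 Qy ma).
have eb : mxavg Q (fun y => mxpow (U y) p^-1) = mxexp P b.
  exact: (mxavg_exp mQ Q0 Qy mb).
have eB : mxavg Q B = mxexp P B by exact: (mxavg_exp mQ Q0 Qy mB).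
rewrite eA eb eB.
set G := invmx _; set A := mxexp P a; set EB := mxexp P B => h.
have mG : measurable_fun [set: E] (fun x => (entrynorm (A *m (B x - EB) *m G))%:E).
  apply/measurable_EFinP; apply: measurable_entrynorm; apply: mxmeasM.
    apply: mxmeasM; first exact: mxmeas_cst.
    by apply: mxmeasB => //; exact: mxmeas_cst.
  exact: mxmeas_cst.
apply: (@le_trans _ _ (eavg Q (fun x => 2%:E * (entrynorm (A *m (B x - EB) *m G))%:E))).
  apply: eavg_le => x; first by rewrite lee_fin mxnorm_ge0.
  by rewrite -EFinM lee_fin mxnorm_le_entrynorm.
rewrite -(integral_eavg mQ Q0 Qy); last 2 first.
- exact: measurable_funeM.
- by move=> x; rewrite -EFinM lee_fin mulr_ge0 ?entrynorm_ge0.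
rewrite ge0_integralZl//; last by move=> x _; rewrite lee_fin entrynorm_ge0.
rewrite /regular_const -mulrA EFinM; apply: lee_wpmul2l => //.
by rewrite -mulrA.
Qed.

End OneCube.

Lemma regular_BMO :
  (forall Q, cubes Q -> \int[mu]_(x in Q) (mxnorm (B x))%:E < +oo) ->
  BMO_norm p V U B <=
    (regular_const (fine (Ap_char p U)) (fine (Ap_char p V)) + 1)%:E *
    max_norm p U V Cm.
Proof.
move=> iB; apply: ge_ereal_sup => _ [Q cQ <-].
set K := regular_const _ _.
have K0 : (0 <= K)%R.
  apply: mulr_ge0 => //; apply: mulr_ge0; first exact: core_const_ge0.
  exact: ltW lower_const_gt0.
have K1 : (0 < K + 1)%R by rewrite ltr_wpDl.
have [My|] := eqVneq (max_norm p U V Cm) +oo.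
  by rewrite My gt0_muley ?leey// lte_fin.
move=> Mn; have Mf : max_norm p U V Cm \is a fin_num.
  by rewrite ge0_fin_numE ?max_norm_ge0// ltey.
have [mQ Q0 Qy] := cubesP cQ.
have M0 := max_norm_ge0 U V Cm.
move: Mf M0 => /fineK <-; set M := fine _; rewrite lee_fin => M0.
apply/lee_addgt0Pr => e e0.
(* a bound for the commutators strictly above their norms, whose excess
   contributes e after multiplication by K + 1 *)
have MC0 : (0 < M + e / (K + 1))%R by rewrite ltr_wpDl// divr_gt0.
have hMC s : opbound p U V (Cm s) (M + e / (K + 1))%R.
  apply: op_norm_lt; apply: le_lt_trans (le_max_norm U V Cm s) _.
  rewrite -[ltLHS]fineK ?lte_fin ?ltrDl ?divr_gt0//.
  by rewrite ge0_fin_numE ?max_norm_ge0// ltey.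
apply: le_trans (cube_bound mQ Q0 Qy cQ MC0 hMC (iB _ cQ)) _.
rewrite -EFinM -EFinD lee_fin -/K.
apply: (@le_trans _ _ ((K + 1) * (M + e / (K + 1)))%R).
  by rewrite ler_wpM2r ?(ltW MC0)// lerDl.
by rewrite mulrDr mulrCA divff ?gt_eqF// mulr1.
Qed.

End Regular.

Local Close Scope ereal_scope.

(** * Changing a weight on a null set, and the theorem *)

Section Modification.
Context {R : realType} {d : nat}.
Local Notation C := R[i].
Local Notation E := (d.-tuple R).
Local Notation mu := (@leb R d).

Lemma posdef1 n : posdef (1%:M : 'M[C]_n).
Proof.
apply: posdefP => [|v v0]; first by rewrite -(mxfun_cst 0 1); exact: mxfun_herm.
rewrite /qform mulmx1 dot_sqnorm /= lt_def sqnorm_ge0 andbT -vnorm_sqr sqrf_eq0.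
by apply: contraNN v0 => /eqP/vnorm_eq0 ->.
Qed.

Lemma weight_modification n (W : E -> 'M[C]_n) : matrix_weight W ->
  exists W' : E -> 'M[C]_n, exists N : set E,
    [/\ measurable N, mu N = 0%E, mxmeas W', forall x, posdef (W' x) &
        forall x, ~ N x -> W' x = W x].
Proof.
move=> [mW [N [mN N0 hN]]].
exists (fun x => (\1_N x)%:C *: 1%:M + (\1_(~` N) x)%:C *: W x), N.
have in_ x : N x -> (\1_N x)%:C *: 1%:M + (\1_(~` N) x)%:C *: W x = 1%:M.
  move=> Nx; rewrite !indicE mem_set// memNset; last by [].
  by rewrite scale0r addr0 scale1r.
have out x : ~ N x -> (\1_N x)%:C *: 1%:M + (\1_(~` N) x)%:C *: W x = W x.
  move=> Nx; rewrite !indicE memNset// mem_set; last by [].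
  by rewrite scale0r add0r scale1r.
split=> //.
- apply: mxmeasD => i j; under eq_fun do rewrite mxE; apply: cmeasM.
  + by apply: cmeas_real; exact: measurable_indic.
  + exact: cmeas_cst.
  + by apply: cmeas_real; apply: measurable_indic; exact: measurableC.
  + exact: mW.
- move=> x; have [Nx|Nx] := pselect (N x); first by rewrite in_//; exact: posdef1.
  by rewrite out//; apply: contrapT => h; exact/Nx/hN.
Qed.

Section Invariance.
Variables (p : R) (n : nat) (W W' : E -> 'M[C]_n) (N : set E).
Hypotheses (mN : measurable N) (N0 : mu N = 0%E).
Hypothesis WW : forall x, ~ N x -> W' x = W x.

Lemma eavg_off_null (Q : set E) (f g : E -> \bar R) :
  (forall x, ~ N x -> f x = g x) -> eavg Q f = eavg Q g.
Proof.
by move=> fg; congr (_ * _)%E; apply: (eq_integral_off_null mN N0) => x _; exact: fg.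
Qed.

Lemma Ap_char_off_null : Ap_char p W' = Ap_char p W.
Proof.
pose F (X : E -> 'M[C]_n) Q := eavg Q (fun x => (eavg Q (fun y =>
  (mxnorm (mxpow (X x) p^-1 *m mxpow (X y) (- p^-1)) `^ conj_exp p)%:E)
  `^ (p / conj_exp p))%E).
have H Q : F W' Q = F W Q.
  apply: eavg_off_null => x Nx.
  apply: (congr1 (fun z => z `^ (p / conj_exp p))%E).
  by apply: eavg_off_null => y Ny; rewrite (WW Nx) (WW Ny).
exact: (congr1 (fun G => ereal_sup [set G Q | Q in cubes]) (funext H)).
Qed.

Lemma LpW_norm_off_null : LpW_norm p W' = LpW_norm p W.
Proof.
apply/funext => f; apply: (congr1 (fun z => z `^ p^-1)%E).
by apply: (eq_integral_off_null mN N0) => x _ Nx; rewrite (WW Nx).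
Qed.

Lemma LpW_off_null : LpW p W' = LpW p W.
Proof. by rewrite /LpW LpW_norm_off_null. Qed.

Lemma mxavg_off_null r (Q : set E) :
  mxavg Q (fun y => mxpow (W' y) r) = mxavg Q (fun y => mxpow (W y) r).
Proof.
have H (h : C -> R) i j : ravg Q (fun x => h (mxpow (W' x) r i j)) =
    ravg Q (fun x => h (mxpow (W x) r i j)).
  apply: (congr1 (fun z => (fine (mu Q))^-1 * fine z)).
  by apply: (eq_integral_off_null mN N0) => x _ Nx; rewrite (WW Nx).
apply/matrixP => i j; rewrite [LHS]mxE [RHS]mxE.
exact: (congr2 (fun s t : R => s +i* t) (H (@complex.Re R) i j)
  (H (@complex.Im R) i j)).
Qed.

End Invariance.
End Modification.

Theorem theorem1p2 (R : realType) (d : nat) (hd : (0 < d)%N)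
    (p : R) (hp : 1 < p) (N : nat) (T : 'I_N -> @op R d R[i])
    (hT : lower_bound_collection p T) (m : nat) (hm : (0 < m)%N) :
  exists2 c : R -> R -> R, (forall u v : R, 0 < c u v) &
    forall U V : d.-tuple R -> 'M[R[i]]_m, Ap_weight p U -> Ap_weight p V ->
    forall B : d.-tuple R -> 'M[R[i]]_m, locally_integrable_mx B ->
      (BMO_norm p V U B <=
         (c (fine (Ap_char p U)) (fine (Ap_char p V)))%:E *
         max_norm p U V
           (fun s => commutator (mult_op B) (tensor_id (T s) m)))%E.
Proof.
case: hT => lT lowT upT.
have mm0 : (0 < m + m)%N by rewrite addn_gt0 hm.
have [c c0 lower] := lowT _ mm0.
exists (fun u v => `|regular_const p m c u v| + 1).
  by move=> u v; rewrite ltr_wpDl.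
move=> U V [wU AU] [wV AV] B [mB iB].
have [U' [NU [mNU NU0 mU pU UU]]] := weight_modification wU.
have [V' [NV [mNV NV0 mV pV VV]]] := weight_modification wV.
have eAU := Ap_char_off_null p mNU NU0 UU.
have eAV := Ap_char_off_null p mNV NV0 VV.
have AU' : Ap_weight p U'.
  split; first by split; [exact: mU|exact: (aeW _ pU)].
  by rewrite eAU; exact: AU.
have AV' : Ap_weight p V'.
  split; first by split; [exact: mV|exact: (aeW _ pV)].
  by rewrite eAV; exact: AV.
have := regular_BMO hp hm c0 lT lower (upT m hm) mU mV mB pU pV AU' AV' iB.
have -> : BMO_norm p V' U' B = BMO_norm p V U B.
  apply: (congr1 (fun G => ereal_sup [set G Q | Q in cubes])).
  apply/funext => Q; apply: (congr1 (eavg Q)); apply/funext => x.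
  exact: (congr2 (fun X Z => (mxnorm (X *m (B x - mxavg Q B) *m invmx Z))%:E)
    (mxavg_off_null mNV NV0 VV p^-1 Q) (mxavg_off_null mNU NU0 UU p^-1 Q)).
have -> : max_norm p U' V' (fun s => commutator (mult_op B) (tensor_id (T s) m)) =
    max_norm p U V (fun s => commutator (mult_op B) (tensor_id (T s) m)).
  apply: eq_bigr => s _; rewrite /op_norm.
  rewrite (LpW_off_null p mNU NU0 UU) (LpW_off_null p mNV NV0 VV).
  by rewrite (LpW_norm_off_null p mNU NU0 UU) (LpW_norm_off_null p mNV NV0 VV).
rewrite eAU eAV => /le_trans; apply.
apply: lee_wpmul2r; first exact: max_norm_ge0.
by rewrite lee_fin lerD2r ler_norm.
Qed.
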